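(* Let $d\ge2$, let $Q^d=[-1,1]^d$, let $t=\big((d+1)!\,2^{1-d}\big)^{1/(d+1)}$, let $O^d=t\operatorname{Conv}\{\pm e_1,\dots,\pm e_d\}$ where $e_1,\dots,e_d$ is the standard basis of $\mathbb R^d$, and let $Q_0$ be the compact convex set with support function $$h_{Q_0}(\mathbf v)=\frac12\int_{O^d}|\mathbf x\cdot\mathbf v|\,d\mathbf x,\qquad \mathbf v\in\mathbb R^d.$$ Then for every $\eta>0$ $$\lim_{n\to\infty}\frac{\operatorname{card}\{P\in\mathcal F(Q^d,n): \operatorname{dist}(P,Q_0)>\eta\}}{\operatorname{card}\mathcal F(Q^d,n)}=0.$$
   Context: For a convex body $K\subset\mathbb R^d$ (compact convex set with non-empty interior) and a positive integer $n$, $\mathcal F(K,n)$ is the finite collection of all $\frac1n\mathbb Z^d$-lattice zonotopes contained in $K$, i.e. of all zonotopes (translates of finite Minkowski sums of segments) $P\subset K$ all of whose vertices lie in $\frac1n\mathbb Z^d$. The support function of a compact convex set $A$ is $h_A(\mathbf v)=\sup_{\mathbf x\in A}\mathbf x\cdot\mathbf v$. $\operatorname{dist}$ is the Hausdorff distance. *)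

(* Defs.v *)
From HB Require Import structures.
From mathcomp Require Import all_boot all_order all_algebra.
From mathcomp Require Import finmap.
From mathcomp Require Import all_classical all_reals all_analysis.

Set Implicit Arguments.
Unset Strict Implicit.
Unset Printing Implicit Defensive.

Import Order.TTheory GRing.Theory Num.Theory.
Import numFieldNormedType.Exports.

Local Open Scope classical_set_scope.
Local Open Scope ring_scope.

(* The library has Lebesgue measure on the line only; on R^n, seen
   as the measurable type of n-tuples, it is the n-fold product measure. *)
Section lebesgue_tuple.
Context {R : realType}.
Let mR := measurableTypeR R.

Definition consT n (p : mR * n.-tuple mR) : n.+1.-tuple mR :=
  [the n.+1.-tuple mR of p.1 :: p.2].

Lemma measurable_consT n : measurable_fun [set: mR * n.-tuple mR] (@consT n).
Proof. exact: measurable_cons. Qed.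

Section step.
Variables (n : nat) (mu : {sigma_finite_measure set (n.-tuple mR) -> \bar R}).

Definition lebesgue_cons : set (n.+1.-tuple mR) -> \bar R :=
  pushforward (@lebesgue_measure R \x mu)%E (@consT n).

Let lebesgue_cons0 : lebesgue_cons set0 = 0%E.
Proof. by rewrite /lebesgue_cons /pushforward preimage_set0 measure0. Qed.

Let lebesgue_cons_ge0 A : (0 <= lebesgue_cons A)%E.
Proof. by rewrite /lebesgue_cons /pushforward; exact: measure_ge0. Qed.

Let lebesgue_cons_sigma_additive : semi_sigma_additive lebesgue_cons.
Proof.
have mc (A : set (n.+1.-tuple mR)) : measurable A -> measurable (@consT n @^-1` A).
  by move=> mA; rewrite -[X in measurable X]setTI; exact: measurable_consT.
move=> F mF tF mUF; rewrite /lebesgue_cons /pushforward preimage_bigcup.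
apply: measure_semi_sigma_additive.
- by move=> k; exact: mc.
- apply/trivIsetP => /= i j _ _ ij; rewrite -preimage_setI.
  by move/trivIsetP : tF => /(_ _ _ _ _ ij) ->//; rewrite preimage_set0.
- by rewrite -preimage_bigcup; exact: mc.
Qed.

HB.instance Definition _ := isMeasure.Build _ _ _ lebesgue_cons
  lebesgue_cons0 lebesgue_cons_ge0 lebesgue_cons_sigma_additive.

Let lebesgue_cons_sigma_finite : sigma_finite setT lebesgue_cons.
Proof.
have /sigma_finiteP[F [TF ndF Foo]] := sigma_finiteT (@lebesgue_measure R).
have /sigma_finiteP[G [TG ndG Goo]] := sigma_finiteT mu.
pose u (x : n.+1.-tuple mR) : mR * n.-tuple mR :=
  (thead x, [tuple of behead x]).
have mu_ : measurable_fun setT u.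
  apply: measurable_fun_pair; first exact: measurable_tnth.
  exact: measurable_behead.
have uK : u \o @consT n = id.
  by apply/funext => -[a b]; rewrite /u/=; congr pair; apply/val_inj.
exists (fun k => u @^-1` (F k `*` G k)).
  rewrite -preimage_bigcup (_ : \bigcup_k _ = setT) ?preimage_setT//.
  rewrite -subTset => -[x y] _.
  have [i _ Fx] : (\bigcup_k F k) x by rewrite -TF.
  have [j _ Gy] : (\bigcup_k G k) y by rewrite -TG.
  exists (maxn i j) => //; split=> /=.
  - by move: x Fx; exact/subsetPset/ndF/leq_maxl.
  - by move: y Gy; exact/subsetPset/ndG/leq_maxr.
move=> k; have [? ?] := Foo k; have [? ?] := Goo k; split.
  by rewrite -[X in measurable X]setTI; apply: mu_ => //; exact: measurableX.
rewrite /lebesgue_cons /pushforward -comp_preimage uK preimage_id.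
by rewrite product_measure1E// lte_mul_pinfty// ge0_fin_numE.
Qed.

HB.instance Definition _ := Measure_isSigmaFinite.Build _ _ _ lebesgue_cons
  lebesgue_cons_sigma_finite.
End step.

Fixpoint lebesgue_tuple n : {sigma_finite_measure set (n.-tuple mR) -> \bar R} :=
  match n with
  | 0 => dirac [tuple]
  | m.+1 => lebesgue_cons (lebesgue_tuple m)
  end.

Lemma lebesgue_tuple_box n (A : 'I_n -> set mR) :
  (forall i, measurable (A i)) ->
  lebesgue_tuple n [set x | forall i, A i (tnth x i)] =
  (\prod_(i < n) lebesgue_measure (A i))%E.
Proof.
elim: n A => [|n ih] A mA.
  rewrite big_ord0 /= diracE mem_set//; by case.
rewrite big_ord_recl /= -ih//.
rewrite -product_measure1E//; last first.
  rewrite (_ : [set _ | _] =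
    \bigcap_(i in [set: 'I_n]) ((@tnth n mR ^~ i) @^-1` A (lift ord0 i))).
    apply: fin_bigcap_measurable => // i _; rewrite -[X in measurable X]setTI.
    exact: measurable_tnth.
  by apply/seteqP; split=> [x Ax i _|x Ax i]; [exact: Ax|exact: Ax].
rewrite /lebesgue_cons /pushforward; congr product_measure1.
apply/seteqP; split => -[a b] /= => [Ax|[Aa Ab] i].
  split; first exact: (Ax ord0).
  by move=> i; have := Ax (lift ord0 i); rewrite tnthS.
by case: (unliftP ord0 i) => [j ->|->]; rewrite ?tnthS.
Qed.

End lebesgue_tuple.

Section euclidean.
Context {R : realType} {d : nat}.
Implicit Types (x y v : 'rV[R]_d) (A B : set 'rV[R]_d).

Definition dot x y : R := \sum_(i < d) x 0 i * y 0 i.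

(* The norm carried by the library on 'rV[R]_d is the sup norm. *)
Definition enorm x : R := Num.sqrt (dot x x).

Definition support_fun A v : \bar R := ereal_sup [set (dot x v)%:E | x in A].

Definition hausdorff_dist A B : \bar R :=
  let excess A B := ereal_sup
    [set ereal_inf [set (enorm (x - y))%:E | y in B] | x in A] in
  maxe (excess A B) (excess B A).

Definition conv_hull A : set 'rV[R]_d := smallest (@convex_set R 'rV[R]_d) A.

Definition row_of_tuple (x : d.-tuple (measurableTypeR R)) : 'rV[R]_d :=
  \row_i tnth x i.

Definition Lebesgue_integral A (f : 'rV[R]_d -> R) : \bar R :=
  (\int[lebesgue_tuple d]_(x in row_of_tuple @^-1` A) (f (row_of_tuple x))%:E)%E.

End euclidean.

Section zonotopes.
Context {R : realType} {d : nat}.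
Implicit Types (x y : 'rV[R]_d) (A B P K : set 'rV[R]_d).

Definition minkowski_sum A B : set 'rV[R]_d := [set x + y | x in A & y in B].

Definition segment x y : set 'rV[R]_d :=
  [set (1 - s) *: x + s *: y | s in `[0, 1]%classic].

Definition zonotope P := exists (k : nat) (c : 'rV[R]_d) (a b : 'I_k -> 'rV[R]_d),
  P = [set c + x | x in
        \big[minkowski_sum/[set 0]]_(i < k) segment (a i) (b i)].

(* The vertices of a polytope are its extreme points. *)
Definition vertices P : set 'rV[R]_d := [set x | P x /\
  forall y z (s : R), P y -> P z -> 0 < s < 1 -> x = (1 - s) *: y + s *: z ->
  y = x /\ z = x].

Definition scaled_lattice n : set 'rV[R]_d :=
  [set n%:R^-1 *: map_mx intr z | z in [set: 'rV[int]_d]].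

Definition lattice_zonotopes K n : set (set 'rV[R]_d) :=
  [set P | [/\ zonotope P, P `<=` K & vertices P `<=` scaled_lattice n]].

End zonotopes.

Section limit_shape.
Variables (R : realType) (d : nat).

Definition cube : set 'rV[R]_d := [set x | forall i, -1 <= x 0 i <= 1].

Definition cross_scale : R :=
  (d.+1`!%:R * 2 `^ (1 - d%:R)) `^ (d.+1%:R^-1).

Definition cross_polytope : set 'rV[R]_d :=
  [set cross_scale *: x | x in
    conv_hull [set y | exists i, y = delta_mx 0 i \/ y = - delta_mx 0 i]].

Definition limit_support (v : 'rV[R]_d) : \bar R :=
  ((2^-1)%:E * Lebesgue_integral cross_polytope (fun x => `|dot x v|%R))%E.

End limit_shape.

(* The cardinal of a finite set; meaningless (0) on infinite ones. *)
Definition set_card {T : choiceType} (A : set T) : nat := #|` fset_set A|.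

(* Main.v *)
Require Import Defs.
From mathcomp Require Import all_boot all_order all_algebra.
From mathcomp Require Import finmap.
From mathcomp Require Import all_classical all_reals all_analysis.
From mathcomp Require Import measurable_realfun ring lra zify.

(** A lattice zonotope in the cube is a translate of a sum of segments
    [[0, k_p p / n]], where [p] ranges over the primitive integer vectors up to
    sign, the multiplicities [k_p] are natural numbers, and containment in the
    cube forces [sum_p k_p |p_j| <= 2n] for every coordinate [j].  Up to a
    polynomial factor, counting zonotopes is thus counting multiplicity
    functions, and one gives such a function the Boltzmann weight
    [exp (- b sum_p k_p |p|_1)]: the [k_p] become independent geometric
    variables.  With [b] of order [n^(-1/(d+1))] the sums [sum_p k_p |p . v|],
    which are [2n] times the support function of the centred zonotope,
    concentrate exponentially (Chernoff bound) around
    [sum_p |p . v| / (exp (b |p|_1) - 1)].  This mean is asymptotic to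
    [C b^(-d-1) h_{Q_0} v]: lattice sums over [|x|_1 <= N] are Riemann sums for
    the integral over the cross-polytope, an Abelian argument turns them into
    exponential sums, and the passage to primitive vectors is a contraction,
    because [sum_{j >= 2} j^(-d) < 1].  Since [h_{Q_0} e_j = 1], typical
    zonotopes touch all faces of the cube asymptotically, so their centre tends
    to the origin; closeness of the support functions on a finite net of
    directions then bounds the Hausdorff distance. *)

Set Implicit Arguments.
Unset Strict Implicit.
Unset Printing Implicit Defensive.

Import Order.TTheory GRing.Theory Num.Theory.
Import numFieldNormedType.Exports.

Local Open Scope classical_set_scope.
Local Open Scope ring_scope.

(** The partition function [partition_lim] is never evaluated: it is a factor both of the upper
    bound for the bad count and of the lower bound for the full count, and cancels. What must be
    matched is the energy. A configuration admissible for [n] has weight at least [exp (- 2nbd)],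
    while typical ones should have widths safely below [2n], so the mean width is set to
    [D = 2n(1 - delta)]. This mismatch costs a factor [exp (O(delta) * n * b)], which must lose
    against the Chernoff gain [exp (- c * D * b)]. Hence the order of choices: the net and its rate
    [c] come before [delta]; the rate [c'] for coordinate widths within [delta] comes after, and
    only has to make an error smaller than a constant. Translations contribute [(2n+1)^d],
    negligible since [D * b] grows like [n^(d/(d+1))]. The number [t] is the normalisation giving
    [h_{Q_0} e_j = 1]. This is obtained without integrating over the cross-polytope: the exponential
    sum in a coordinate direction has a closed form, and its limit is computed twice. Vectors are
    cut off at [M] and multiplicities at [K] to keep all sums finite; both are chosen after [b]. *)

Section finite_sums.
Variable (R : numDomainType).

Lemma ler_sum_uniq_sub (J : eqType) (s t : seq J) (F : J -> R) :
  uniq s -> uniq t -> {subset s <= t} -> (forall j, j \in t -> 0 <= F j) ->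
  \sum_(j <- s) F j <= \sum_(j <- t) F j.
Proof.
move=> us ut st F0; rewrite [leRHS](bigID (mem s))/=.
have -> : \sum_(j <- s) F j = \sum_(j <- t | j \in s) F j.
  rewrite -[RHS]big_filter; apply: perm_big; apply: uniq_perm => //.
    exact: filter_uniq.
  by move=> j; rewrite mem_filter; case: (boolP (j \in s)) => //= /st ->.
rewrite lerDl big_seq_cond sumr_ge0// => j /andP[jt _]; exact: F0.
Qed.

Lemma ler_sum_inj (I J : choiceType) (A : {fset I}) (B : {fset J}) (h : I -> J)
    (P : pred I) (Q : pred J) (F : J -> R) :
  (forall j, j \in B -> Q j -> 0 <= F j) ->
  {in [pred i | (i \in A) && P i] &, injective h} ->
  (forall i, i \in A -> P i -> (h i \in B) && Q (h i)) ->
  \sum_(i <- A | P i) F (h i) <= \sum_(j <- B | Q j) F j.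
Proof.
move=> F0 hinj hQ; rewrite -[leLHS]big_filter -[leRHS]big_filter.
rewrite -(big_map h predT); apply: ler_sum_uniq_sub.
- rewrite map_inj_in_uniq ?filter_uniq//.
  move=> x y; rewrite !mem_filter => /andP[Px xA] /andP[Py yA].
  by apply: hinj; rewrite inE ?Px ?Py ?xA ?yA.
- by rewrite filter_uniq.
- move=> j /mapP[i]; rewrite mem_filter => /andP[Pi iA] ->.
  by rewrite mem_filter andbC hQ.
- by move=> j; rewrite mem_filter => /andP[Qj jB]; exact: F0.
Qed.

End finite_sums.

(** * Integer vectors: boxes, l1 balls, primitive vectors up to sign *)

Section integer_vectors.
Variable d : nat.
Implicit Types x y : 'rV[int]_d.

Definition norm1 x : nat := (\sum_i `|x 0%R i|)%N.

Definition vgcd x : nat := \big[gcdn/0%N]_i `|x 0%R i|%N.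

Definition primitive x := vgcd x == 1%N.

(* Any total choice of one vector in each pair {x, -x} will do. *)
Definition positive x := (choice.pickle x < choice.pickle (- x)%R)%N.

Definition box_vector (M : nat) (f : {ffun 'I_d -> 'I_M.*2.+1}) : 'rV[int]_d :=
  \row_i ((f i : nat)%:Z - M%:Z).

Definition box (M : nat) : {fset 'rV[int]_d} :=
  [fset box_vector f | f in {: {ffun 'I_d -> 'I_M.*2.+1}}]%fset.

Definition ball1 (M : nat) : {fset 'rV[int]_d} := [fset x in box M | (norm1 x <= M)%N]%fset.

Lemma box_vector_inj M : injective (@box_vector M).
Proof.
move=> f g /rowP e; apply/ffunP => i; apply/val_inj.
by have := e i; rewrite !mxE => /addIr [].
Qed.

Lemma in_box M x : (x \in box M) = [forall i, (`|x 0%R i| <= M)%N].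
Proof.
apply/imfsetP/forallP => [[f _ ->] i|xM].
  rewrite mxE; move: (ltn_ord (f i)); move: (nat_of_ord _) => k; lia.
have lt i : (`|(x 0 i + M%:Z)%R| < M.*2.+1)%N by have := xM i; lia.
exists [ffun i => Ordinal (lt i)] => //; apply/rowP => i.
by rewrite !mxE ffunE/=; have := xM i; lia.
Qed.

Lemma leq_norm1 x i : (`|x 0%R i| <= norm1 x)%N.
Proof. by rewrite /norm1 (bigD1 i)//= leq_addr. Qed.

Lemma in_ball1 M x : (x \in ball1 M) = (norm1 x <= M)%N.
Proof.
rewrite !inE/= in_box andb_idl// => xM; apply/forallP => i.
exact: leq_trans (leq_norm1 x i) xM.
Qed.

Lemma big_box (R : Type) (idx : R) (op : Monoid.com_law idx) M
    (F : 'rV[int]_d -> R) :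
  \big[op/idx]_(x <- box M) F x =
  \big[op/idx]_(f : {ffun 'I_d -> 'I_M.*2.+1}) F (box_vector f).
Proof.
rewrite /box big_imfset/=; last by move=> f g _ _; exact: box_vector_inj.
by rewrite /= big_enum/=.
Qed.

Lemma norm1N x : norm1 (- x)%R = norm1 x.
Proof. by apply: eq_bigr => i _; rewrite mxE abszN. Qed.

Lemma norm1_eq0 x : (norm1 x == 0%N) = (x == 0%R).
Proof.
rewrite sum_nat_eq0; apply/forallP/eqP => [x0|-> i].
  by apply/rowP => i; move/(_ i) : x0 => /=; rewrite absz_eq0 mxE => /eqP.
by rewrite mxE.
Qed.

Lemma norm1Z (j : nat) x : norm1 (j%:Z *: x)%R = (j * norm1 x)%N.
Proof. by rewrite /norm1 big_distrr/=; apply: eq_bigr => i _; rewrite mxE abszM. Qed.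

Lemma vgcd_dvd x i : (vgcd x %| `|x 0%R i|)%N.
Proof. by rewrite /vgcd; exact: (@biggcdn_inf _ i). Qed.

Lemma vgcdN x : vgcd (- x)%R = vgcd x.
Proof. by apply: eq_bigr => i _; rewrite mxE abszN. Qed.

Lemma vgcdZ (j : nat) x : vgcd (j%:Z *: x)%R = (j * vgcd x)%N.
Proof.
rewrite /vgcd (big_morph (muln j) (id1 := 0%N) (op1 := gcdn)).
- by apply: eq_bigr => i _; rewrite mxE abszM.
- by move=> a b; rewrite muln_gcdr.
- by rewrite muln0.
Qed.

Lemma vgcd_gt0 x : (0 < vgcd x)%N = (x != 0%R).
Proof.
rewrite lt0n; congr negb; apply/eqP/eqP => [x0|->].
  by apply/rowP => i; have := vgcd_dvd x i; rewrite x0 dvd0n absz_eq0 mxE => /eqP.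
by rewrite /vgcd big1// => i _; rewrite mxE.
Qed.

Lemma vgcd_le_norm1 x : (vgcd x <= norm1 x)%N.
Proof.
have [->|x0] := eqVneq x 0%R; first by rewrite /vgcd big1// => i _; rewrite mxE.
have : (0 < norm1 x)%N by rewrite lt0n norm1_eq0.
apply: contraTT; rewrite -ltnNge => lt; rewrite -leqNgt leqn0 norm1_eq0.
apply/eqP/rowP => i; rewrite mxE; apply/eqP; rewrite -absz_eq0.
have := vgcd_dvd x i; apply: contraTT; rewrite -lt0n => xi.
by apply/negP => /(dvdn_leq xi); rewrite leqNgt (leq_ltn_trans (leq_norm1 x i)).
Qed.

Lemma primitive_neq0 x : primitive x -> x != 0%R.
Proof. by move=> /eqP p; rewrite -vgcd_gt0 p. Qed.

Lemma primitiveN x : primitive (- x)%R = primitive x.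
Proof. by rewrite /primitive vgcdN. Qed.

Definition vprim x : 'rV[int]_d := (\row_i (x 0%R i %/ (vgcd x)%:Z)%Z)%R.

Lemma vprimE x : x = ((vgcd x)%:Z *: vprim x)%R.
Proof.
apply/rowP => i; rewrite !mxE mulrC divzK//.
by rewrite dvdzE/=; exact: vgcd_dvd.
Qed.

Lemma primitive_vprim x : x != 0%R -> primitive (vprim x).
Proof.
rewrite -vgcd_gt0 => x0; have := congr1 vgcd (vprimE x); rewrite vgcdZ => /eqP.
by rewrite -[X in X == _]muln1 eqn_pmul2l// eq_sym.
Qed.

Lemma positiveN x : x != 0%R -> positive (- x)%R = ~~ positive x.
Proof.
move=> x0; rewrite /positive opprK -leqNgt ltn_neqAle andb_idl// => _.
apply/eqP => /(pcan_inj choice.pickleK) /rowP e.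
move/negP: x0; apply; apply/eqP/rowP => i.
by have := e i; rewrite !mxE; move: (x _ _) => k; lia.
Qed.

Definition pos_primitive x := primitive x && positive x.

(** Taking [vgcd] of both sides gives [a = b]; the minus sign is then excluded because exactly one
    of [x] and [- x] is positive. *)
Lemma pos_primitive_inj x y (a b : nat) : pos_primitive x -> pos_primitive y ->
  (0 < a)%N -> (a%:Z *: x = b%:Z *: y)%R \/ (a%:Z *: x = - (b%:Z *: y))%R -> x = y.
Proof.
move=> /andP[px posx] /andP[py posy] a0 e.
have ab : a = b.
  have : vgcd (a%:Z *: x)%R = vgcd (b%:Z *: y)%R by case: e => ->; rewrite ?vgcdN.
  by rewrite !vgcdZ (eqP px) (eqP py) !muln1.
have inj (u v : 'rV[int]_d) : (a%:Z *: u = a%:Z *: v)%R -> u = v.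
  move=> /rowP uv; apply/rowP => i; have := uv i; rewrite !mxE => /mulfI; apply.
  by rewrite eqz_nat -lt0n.
case: e; rewrite -ab; first exact: inj.
rewrite -scalerN => /inj xy; move: posx; rewrite xy positiveN ?posy//.
exact: primitive_neq0.
Qed.

Lemma sum_primitive (R : pzRingType) M (F : 'rV[int]_d -> R) : (forall x, F (- x)%R = F x) ->
  (\sum_(x <- ball1 M | primitive x) F x = 2 * \sum_(x <- ball1 M | pos_primitive x) F x)%R.
Proof.
move=> FN; rewrite (bigID positive)/= mulr2n mulrDl mul1r; congr (_ + _)%R.
rewrite -big_filter -[RHS]big_filter.
rewrite [RHS](eq_bigr (fun x => F (- x)%R)); last by move=> x _; rewrite FN.
rewrite -(big_map (fun x => (- x)%R) predT); apply: perm_big; apply: uniq_perm.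
- exact: filter_uniq (fset_uniq _).
- by rewrite map_inj_uniq; [exact: filter_uniq (fset_uniq _)|exact: oppr_inj].
move=> x; rewrite mem_filter; apply/idP/mapP.
  move=> /andP[/andP[px nx] xM]; exists (- x)%R; rewrite ?opprK// mem_filter.
  rewrite /pos_primitive primitiveN px/= positiveN ?primitive_neq0// nx/=.
  by rewrite in_ball1 norm1N -in_ball1.
case=> y; rewrite mem_filter => /andP[/andP[py posy] yM] ->.
rewrite primitiveN py/= positiveN ?primitive_neq0// negbK posy/=.
by rewrite in_ball1 norm1N -in_ball1.
Qed.

End integer_vectors.

(** * The cross-polytope as an l1 ball *)

Section cross_polytope.
Context {R : realType} {d : nat}.
Implicit Types (x y v : 'rV[R]_d).

Definition l1norm x : R := \sum_i `|x 0 i|.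

Lemma l1norm_ge0 x : 0 <= l1norm x.
Proof. by rewrite sumr_ge0. Qed.

Lemma ler_l1norm x i : `|x 0 i| <= l1norm x.
Proof. by rewrite /l1norm (bigD1 i)//= lerDl sumr_ge0. Qed.

Lemma l1normZ (a : R) x : l1norm (a *: x) = `|a| * l1norm x.
Proof. by rewrite mulr_sumr; apply: eq_bigr => i _; rewrite mxE normrM. Qed.

Lemma ler_l1normD x y : l1norm (x + y) <= l1norm x + l1norm y.
Proof. by rewrite -big_split/=; apply: ler_sum => i _; rewrite mxE ler_normD. Qed.

Lemma l1norm_delta (i : 'I_d) : l1norm (delta_mx 0 i) = 1.
Proof.
rewrite /l1norm (bigD1 i)//= mxE !eqxx/= normr1 big1 ?addr0// => j ji.
by rewrite mxE (negbTE ji) andbF normr0.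
Qed.

Lemma convex_setP (A : set 'rV[R]_d) : @convex_set R 'rV[R]_d A <->
  (forall x y (s : R), A x -> A y -> 0 <= s <= 1 -> A (s *: x + (1 - s) *: y)).
Proof.
split=> [cA x y s /mem_set Ax /mem_set Ay s01|cA x y l /set_mem Ax /set_mem Ay].
  have s01' : Itv.spec (@Itv.num_sem R) (Itv.Real `[0%Z, 1%Z]) s.
    by rewrite /Itv.spec/= /Itv.num_sem/= num_real/= in_itv/=.
  exact/set_mem/(cA x y (Itv.mk s01')).
by apply: mem_set; apply: cA => //; rewrite ge0 le1.
Qed.

Let signs : set 'rV[R]_d := [set y | exists i, y = delta_mx 0 i \/ y = - delta_mx 0 i].

(** Induction on a list containing the support of [y]: coordinate [i] is split off as [sg (y_i) e_i]
    with weight [|y_i|], and the remainder divided by [1 - |y_i|] again has l1 norm at most 1. When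
    [|y_i| = 1], where this division is impossible, the remainder vanishes. *)
Lemma conv_hull_signs : (0 < d)%N -> conv_hull signs = [set x | l1norm x <= 1].
Proof.
move=> d0; apply/seteqP; split => [x|x /= x1].
  apply: smallest_sub.
    apply/convex_setP => y z s /= y1 z1 /andP[s0 s1].
    apply: le_trans (ler_l1normD _ _) _; rewrite !l1normZ ger0_norm// ger0_norm ?subr_ge0//.
    have : s * l1norm y <= s * 1 by rewrite ler_wpM2l.
    have : (1 - s) * l1norm z <= (1 - s) * 1 by rewrite ler_wpM2l// subr_ge0.
    by lra.
  by move=> y [i [|]] -> /=; rewrite ?l1norm_delta// -scaleN1r l1normZ normrN1 l1norm_delta mul1r.
move=> C [/convex_setP cC sC].
have C0 : C 0.
  pose i := Ordinal d0.
  have -> : 0 = 2^-1 *: (delta_mx 0 i : 'rV[R]_d) + (1 - 2^-1) *: - (delta_mx 0 i).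
    by rewrite (_ : 1 - 2^-1 = 2^-1) ?scalerN ?subrr//; lra.
  by apply: cC; [apply: sC; exists i; left|apply: sC; exists i; right|lra].
suff : forall (s : seq 'I_d) y, (forall i, i \notin s -> y 0 i = 0) -> l1norm y <= 1 -> C y.
  by move/(_ (enum 'I_d) x); apply => // i; rewrite mem_enum.
elim=> [|i s ih] y ys y1.
  by rewrite (_ : y = 0)//; apply/rowP => i; rewrite mxE ys.
pose z := y - y 0 i *: delta_mx 0 i.
have zE j : z 0 j = if j == i then 0 else y 0 j.
  rewrite !mxE eqxx/=; case: (eqVneq j i) => [->|ji] /=; first by rewrite mulr1 subrr.
  by rewrite mulr0 subr0.
have yz : l1norm y = `|y 0 i| + l1norm z.
  rewrite /l1norm (bigD1 i)//=; congr (_ + _); rewrite [RHS](bigD1 i)//= zE eqxx normr0 add0r.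
  by apply: eq_bigr => j ji; rewrite zE (negbTE ji).
have zs (a : R) j : j \notin s -> (a *: z) 0 j = 0.
  rewrite mxE zE; case: eqVneq => [|ji js]; first by rewrite mulr0.
  by rewrite ys ?mulr0// inE negb_or ji.
have Csg : C (Num.sg (y 0 i) *: delta_mx 0 i).
  have [yi|yi|->] := ltgtP (y 0 i) 0.
  - by rewrite ltr0_sg// scaleN1r; apply: sC; exists i; right.
  - by rewrite gtr0_sg// scale1r; apply: sC; exists i; left.
  - by rewrite sgr0 scale0r.
have yE : y = `|y 0 i| *: (Num.sg (y 0 i) *: delta_mx 0 i) + z.
  by rewrite scalerA mulrC -numEsg addrC subrK.
have [yi1|yi1] := eqVneq `|y 0 i| 1.
  have z0 : z = 0.
    have : l1norm z <= 0 by move: y1; rewrite yz yi1; lra.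
    move=> z0; apply/rowP => j; rewrite [RHS]mxE; apply/eqP; rewrite -normr_le0.
    exact: le_trans (ler_l1norm z j) z0.
  by rewrite yE z0 addr0 yi1 scale1r.
have lt1 : 0 < 1 - `|y 0 i|.
  rewrite subr_gt0 lt_neqAle yi1/=; exact: le_trans (ler_l1norm y i) y1.
have -> : y = `|y 0 i| *: (Num.sg (y 0 i) *: delta_mx 0 i) +
    (1 - `|y 0 i|) *: ((1 - `|y 0 i|)^-1 *: z).
  by rewrite [(1 - _) *: _]scalerA divff ?gt_eqF// scale1r -yE.
apply: cC => //; last by rewrite normr_ge0/=; lra.
apply: ih; first exact: zs.
rewrite l1normZ ger0_norm ?invr_ge0 ?(ltW lt1)//.
by rewrite mulrC ler_pdivrMr// mul1r; move: y1; rewrite yz; lra.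
Qed.

Lemma cross_scale_gt0 : 0 < cross_scale R d.
Proof. by rewrite powR_gt0// mulr_gt0 ?powR_gt0// ltr0n fact_gt0. Qed.

Lemma cross_scale_exp : (0 < d)%N -> cross_scale R d ^+ d.+1 = d.+1`!%:R / 2 ^+ d.-1.
Proof.
move=> d0; rewrite /cross_scale -powR_mulrn ?powR_ge0// -powRrM mulVf ?pnatr_eq0//.
rewrite powRr1 ?mulr_ge0 ?powR_ge0//; congr (_ * _).
have -> : 1 - d%:R = - (d.-1%:R) :> R by rewrite -[in LHS](prednK d0) -natr1 opprD addrCA subrr addr0.
by rewrite powRN powR_mulrn.
Qed.

Lemma cross_polytopeE : (0 < d)%N ->
  @cross_polytope R d = [set x | l1norm x <= cross_scale R d].
Proof.
move=> d0; rewrite /cross_polytope -/signs conv_hull_signs//.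
have t0 := cross_scale_gt0; apply/seteqP; split => [_ [x /= x1 <-]|x /= xt].
  by rewrite l1normZ gtr0_norm// -[leRHS]mulr1 ler_pM2l.
exists ((cross_scale R d)^-1 *: x); last by rewrite scalerA divff ?gt_eqF// scale1r.
by rewrite /= l1normZ gtr0_norm ?invr_gt0// mulrC ler_pdivrMr// mul1r.
Qed.

End cross_polytope.

(** * The dot product and lattice sums of [|x . v|] *)

Section dot_product.
Context {R : realType} {d : nat}.
Implicit Types (x y v : 'rV[R]_d).

Lemma dotC x y : dot x y = dot y x.
Proof. by apply: eq_bigr => i _; rewrite mulrC. Qed.

Lemma dotDl x y v : dot (x + y) v = dot x v + dot y v.
Proof. by rewrite -big_split/=; apply: eq_bigr => i _; rewrite mxE mulrDl. Qed.

Lemma dotZl (a : R) x v : dot (a *: x) v = a * dot x v.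
Proof. by rewrite mulr_sumr; apply: eq_bigr => i _; rewrite mxE mulrA. Qed.

Lemma dotNl x v : dot (- x) v = - dot x v.
Proof. by rewrite -scaleN1r dotZl mulN1r. Qed.

Lemma dotBl x y v : dot (x - y) v = dot x v - dot y v.
Proof. by rewrite dotDl dotNl. Qed.

Lemma dot0l v : dot 0 v = 0.
Proof. by rewrite -(scale0r 0) dotZl mul0r. Qed.

Lemma dot_suml (I : Type) (s : seq I) (P : pred I) (F : I -> 'rV[R]_d) v :
  dot (\sum_(i <- s | P i) F i) v = \sum_(i <- s | P i) dot (F i) v.
Proof.
by apply: (big_morph (dot^~ v)) => [x y|]; rewrite ?dotDl ?dot0l.
Qed.

Lemma dot_delta x i : dot x (delta_mx 0 i) = x 0 i.
Proof.
rewrite /dot (bigD1 i)//= mxE !eqxx mulr1 big1 ?addr0// => j ji.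
by rewrite mxE (negbTE ji) andbF mulr0.
Qed.

Lemma ler_norm_dot x v (a : R) : (forall i, `|x 0 i| <= a) -> `|dot x v| <= a * l1norm v.
Proof.
move=> xa; rewrite mulr_sumr; apply: le_trans (ler_norm_sum _ _ _) _.
by apply: ler_sum => i _; rewrite normrM ler_wpM2r.
Qed.

End dot_product.

Section absdot.
Context {R : realType} {d : nat}.
Implicit Types (v : 'rV[R]_d) (x y : 'rV[int]_d).

Definition absdot v x : R := `|dot (map_mx intr x) v|.

Lemma absdot_ge0 v x : 0 <= absdot v x. Proof. exact: normr_ge0. Qed.

Lemma absdotN v x : absdot v (- x) = absdot v x.
Proof. by rewrite /absdot map_mxN dotNl normrN. Qed.

Lemma absdotZ v (j : nat) x : absdot v (j%:Z *: x) = j%:R * absdot v x.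
Proof. by rewrite /absdot map_mxZ dotZl normrM normr_nat. Qed.

Lemma absdot_delta x i : absdot (delta_mx 0 i) x = `|x 0%R i|%N%:R.
Proof. by rewrite /absdot dot_delta mxE -intr_norm natr_absz. Qed.

Lemma norm1E x : (norm1 x)%:R = l1norm (map_mx intr x : 'rV[R]_d).
Proof.
rewrite /norm1 /l1norm natr_sum; apply: eq_bigr => i _.
by rewrite mxE -intr_norm natr_absz.
Qed.

Lemma absdot_le_norm1 v x : absdot v x <= l1norm v * (norm1 x)%:R.
Proof.
rewrite mulrC; apply: ler_norm_dot => i; rewrite norm1E; exact: ler_l1norm.
Qed.

Definition ball_sum v N : R := \sum_(x <- ball1 d N) absdot v x.

Lemma ball_sum_ge0 v N : 0 <= ball_sum v N.
Proof. by rewrite sumr_ge0// => x _; exact: absdot_ge0. Qed.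

Lemma card_box N : (#|` box d N | = N.*2.+1 ^ d)%N.
Proof.
rewrite /box card_imfset/=; last exact: box_vector_inj.
by rewrite -cardE card_ffun !card_ord.
Qed.

Lemma card_ball1 N : (#|` ball1 d N | <= N.*2.+1 ^ d)%N.
Proof.
rewrite -card_box; apply: fsubset_leq_card; apply/fsubsetP => x.
by rewrite inE => /andP[].
Qed.

End absdot.

(** * Lattice sums over l1 balls as Riemann sums *)

Section riemann.
Context {R : realType} {d : nat}.
Let mR := measurableTypeR R.
Implicit Types (v : 'rV[R]_d) (x : 'rV[int]_d) (y : d.-tuple mR).

Definition cell (r : R) x : set (d.-tuple mR) :=
  [set y | forall i, `[r * (x 0 i)%:~R, r * (x 0 i + 1)%:~R[%classic (tnth y i)].

Definition vfloor (r : R) y : 'rV[int]_d := \row_i Num.floor (tnth y i / r).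

Lemma cellP r x y : 0 < r -> cell r x y <-> vfloor r y = x.
Proof.
move=> r0; have e i : (r * (x 0 i)%:~R <= tnth y i < r * (x 0 i + 1)%:~R) =
    (Num.floor (tnth y i / r) == x 0 i).
  by rewrite floor_eq ler_pdivlMr// ltr_pdivrMr// ![_ * r]mulrC.
split=> [c|E i].
  by apply/rowP => i; apply/eqP; rewrite mxE -e; have := c i; rewrite /= in_itv.
by rewrite /= in_itv/= e -E mxE.
Qed.

Lemma measurable_cell r x : measurable (cell r x).
Proof.
rewrite (_ : cell r x = \bigcap_(i in [set: 'I_d])
   ((@tnth d mR ^~ i) @^-1` `[r * (x 0 i)%:~R, r * (x 0 i + 1)%:~R[%classic)).
  apply: fin_bigcap_measurable => // i _; rewrite -[X in measurable X]setTI.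
  exact: measurable_tnth.
by apply/seteqP; split => [y c i _|y c i]; exact: c.
Qed.

Lemma measure_cell r x : 0 < r -> lebesgue_tuple d (cell r x) = (r ^+ d)%:E.
Proof.
move=> r0; rewrite /cell.
rewrite (@lebesgue_tuple_box _ _ (fun i => `[r * (x 0 i)%:~R, r * (x 0 i + 1)%:~R[%classic))//.
rewrite (eq_bigr (fun=> r%:E)); last first.
  move=> i _; rewrite lebesgue_measure_itv/= lte_fin ltr_pM2l// ltr_int ltrDl ltr01.
  by rewrite -EFinB; congr EFin; rewrite intrD; ring.
by rewrite prodEFin big_const_ord iter_mulr mulr1.
Qed.

Let step r (X : {fset 'rV[int]_d}) (c : 'rV[int]_d -> R) y : R :=
  \sum_(x <- X) c x * \1_(cell r x) y.

Lemma stepE r X c y : 0 < r ->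
  step r X c y = if vfloor r y \in X then c (vfloor r y) else 0.
Proof.
move=> r0; have e x : (\1_(cell r x) y : R) = (vfloor r y == x)%:R.
  rewrite indicE; congr (_%:R); congr nat_of_bool.
  by apply/idP/eqP => [/set_mem /cellP|/cellP -/(_ r0)]; [exact|exact: mem_set].
rewrite /step; case: ifPn => [yX|yX].
  rewrite (big_fsetD1 (vfloor r y))//= e eqxx mulr1 big1_fset ?addr0// => x.
  by rewrite !inE => /andP[xy _] _; rewrite e eq_sym (negbTE xy) mulr0.
rewrite big1_fset// => x xX _; rewrite e; case: eqP => [yx|]; last by rewrite mulr0.
by rewrite yx xX in yX.
Qed.

Lemma integral_step r X c : 0 < r -> (forall x, 0 <= c x) ->
  (\int[lebesgue_tuple d]_y (step r X c y)%:E)%E = (\sum_(x <- X) c x * r ^+ d)%:E.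
Proof.
move=> r0 c0; under eq_integral do rewrite /step -sumEFin.
rewrite ge0_integral_sum//.
- rewrite -sumEFin; apply: eq_bigr => x _.
  under eq_integral do rewrite EFinM.
  rewrite ge0_integralZl//.
  + rewrite integral_indic//; last exact: measurable_cell.
    by rewrite setIT [X in (_ * X)%E = _](measure_cell x r0).
  + by apply/measurable_EFinP; apply: measurable_indic; exact: measurable_cell.
  + by rewrite lee_fin.
- move=> x; apply/measurable_EFinP; apply: measurable_funM => //.
  apply: measurable_indic; exact: measurable_cell.
- by move=> x y _; rewrite lee_fin mulr_ge0.
Qed.

Lemma measurable_step r X c : measurable_fun setT (step r X c).
Proof.
apply: measurable_sum => x; apply: measurable_funM => //.
apply: measurable_indic; exact: measurable_cell.
Qed.

Lemma measurable_dot v : measurable_fun setT (fun y => dot (row_of_tuple y) v).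
Proof.
apply: measurable_sum => i; apply: measurable_funM => //.
rewrite (_ : (fun y => _) = (@tnth d mR ^~ i)); first exact: measurable_tnth.
by apply/funext => y; rewrite mxE.
Qed.

Lemma measurable_l1norm : measurable_fun setT (fun y => l1norm (row_of_tuple y)).
Proof.
apply: measurable_sum => i; apply: measurableT_comp => //.
rewrite (_ : (fun y => _) = (@tnth d mR ^~ i)); first exact: measurable_tnth.
by apply/funext => y; rewrite mxE.
Qed.

Lemma vfloor_near r y i : 0 < r ->
  `|(row_of_tuple y - r *: map_mx intr (vfloor r y) : 'rV[R]_d) 0 i| <= r.
Proof.
move=> r0; have /(cellP _ _ r0)/(_ i) : vfloor r y = vfloor r y by [].
rewrite /= in_itv/= !mxE => /andP[]; rewrite intrD; set f := _%:~R => h1 h2.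
by rewrite ler_norml; apply/andP; split; nra.
Qed.

Let D (t : R) : set (d.-tuple mR) := [set y | l1norm (row_of_tuple y) <= t].

Let measurable_D t : measurable (D t).
Proof.
rewrite (_ : D t = (fun y => l1norm (row_of_tuple y)) @^-1` `]-oo, t]%classic).
  by rewrite -[X in measurable X]setTI; exact: measurable_l1norm.
by apply/seteqP; split => y; rewrite /D/= in_itv.
Qed.

(** A point of the cell of [x] differs from [r x] by at most [r] in each coordinate, so [|y . v|]
    changes by at most [r * l1norm v] and the l1 norm by at most [r * d]. As [t = r * N], cells
    meeting the body have index in the ball of radius [N + d], and cells indexed by the ball of
    radius [N - d] lie inside it. *)
Lemma integral_ball_sum v (t : R) (N : nat) : 0 < t -> (d < N)%N ->
  let r := t / N%:R in
  let I := (\int[lebesgue_tuple d]_(y in D t) `|dot (row_of_tuple y) v|%:E)%E in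
  [/\ (I <= (r ^+ d.+1 * (ball_sum v (N + d) + l1norm v * #|` ball1 d (N + d)|%:R))%:E)%E &
   ((r ^+ d.+1 * (ball_sum v (N - d) - l1norm v * #|` ball1 d (N - d)|%:R))%:E <= I)%E].
Proof.
move=> t0 dN r I.
have N0 : (0 : R) < N%:R by rewrite ltr0n (leq_trans _ dN).
have r0 : 0 < r by rewrite divr_gt0.
have tr : t = r * N%:R by rewrite /r divfK// gt_eqF.
clearbody r; have rge0 := ltW r0.
have rabs x : r * absdot v x = `|r * dot (map_mx intr x) v| by rewrite normrM gtr0_norm.
have c0 x : 0 <= r * absdot v x + r * l1norm v.
  by apply: addr_ge0; apply: mulr_ge0 => //; [exact: absdot_ge0|exact: l1norm_ge0].
have mdot : measurable_fun setT (fun y => `|dot (row_of_tuple y) v|%:E).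
  by apply/measurable_EFinP; apply: measurableT_comp => //; exact: measurable_dot.
have near y : `|dot (row_of_tuple y) v - r * dot (map_mx intr (vfloor r y)) v| <= r * l1norm v.
  rewrite -dotZl -dotBl; apply: ler_norm_dot => i; exact: vfloor_near.
have l1near y : `|l1norm (row_of_tuple y) - r * (norm1 (vfloor r y))%:R| <= r * d%:R.
  rewrite norm1E mulr_sumr -sumrB; apply: le_trans (ler_norm_sum _ _ _) _.
  rewrite (_ : r * d%:R = \sum_(i < d) r); last by rewrite sumr_const card_ord mulr_natr.
  apply: ler_sum => i _; apply: le_trans (vfloor_near y i r0).
  rewrite -{1}(gtr0_norm r0) -normrM.
  by apply: le_trans (ler_dist_dist _ _) _; rewrite !mxE.
split.
  rewrite /I integral_mkcond.
  have -> : r ^+ d.+1 * (ball_sum v (N + d) + l1norm v * #|` ball1 d (N + d)|%:R) =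
      \sum_(x <- ball1 d (N + d)) (r * absdot v x + r * l1norm v) * r ^+ d.
    rewrite -mulr_suml big_split/= -mulr_sumr -/(ball_sum _ _).
    by rewrite big_const_seq count_predT iter_addr_0 exprS cardfE -mulr_natr; ring.
  rewrite -(@integral_step r (ball1 d (N + d)) (fun x => r * absdot v x + r * l1norm v))//.
  apply: ge0_le_integral => //.
  - by move=> y _; rewrite patchE; case: ifP => //; rewrite lee_fin.
  - apply/(measurable_restrictT _ _).1 => //; exact: measurable_funTS.
  - by apply/measurable_EFinP; exact: measurable_step.
  move=> y _; rewrite patchE; case: ifPn => [/set_mem yD|_]; rewrite lee_fin stepE//; last first.
    by case: ifP => // _; exact: c0.
  rewrite ifT.
    have := near y; rewrite rabs.
    set a := dot _ _; set b := r * _ => ab.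
    rewrite (_ : a = b + (a - b)); last by ring.
    by apply: le_trans (ler_normD _ _) _; rewrite lerD2l.
  rewrite in_ball1 -(ler_nat R) -(ler_pM2l r0) natrD mulrDr -tr.
  move: (l1near y) yD; rewrite /D/= ler_norml => /andP[+ _]; lra.
have [Y|Y] := leP (ball_sum v (N - d) - l1norm v * #|` ball1 d (N - d)|%:R) 0.
  apply: (@le_trans _ _ 0%E); last by apply: integral_ge0 => y _; rewrite lee_fin.
  by rewrite lee_fin mulr_ge0_le0// exprn_ge0// ltW.
(* Clipping at 0 makes the step function nonnegative, as [integral_step] asks; its integral only
   grows, and it stays below [|y . v|]. *)
pose c x := Num.max 0 (r * absdot v x - r * l1norm v).
apply: (@le_trans _ _ (\int[lebesgue_tuple d]_y (step r (ball1 d (N - d)) c y)%:E)%E).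
  rewrite integral_step//; last by move=> x; rewrite le_max lexx.
  rewrite lee_fin.
  have -> : r ^+ d.+1 * (ball_sum v (N - d) - l1norm v * #|` ball1 d (N - d)|%:R) =
      \sum_(x <- ball1 d (N - d)) (r * absdot v x - r * l1norm v) * r ^+ d.
    rewrite -mulr_suml sumrB -mulr_sumr -/(ball_sum _ _).
    by rewrite big_const_seq count_predT iter_addr_0 exprS cardfE -mulr_natr; ring.
  by apply: ler_sum => x _; rewrite ler_wpM2r ?exprn_ge0// le_max lexx orbT.
rewrite /I [leRHS]integral_mkcond; apply: ge0_le_integral => //.
- move=> y _; rewrite lee_fin stepE//; case: ifP => // _; by rewrite le_max lexx.
- by apply/measurable_EFinP; exact: measurable_step.
- apply/(measurable_restrictT _ _).1 => //; exact: measurable_funTS.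
move=> y _; rewrite patchE stepE//; case: ifPn => [yb|_]; last by case: ifP => //; rewrite lee_fin.
rewrite ifT.
  rewrite lee_fin ge_max normr_ge0/=.
  have := near y; rewrite rabs distrC.
  set b := r * dot _ _; set a := dot _ _ => ab.
  rewrite lerBlDr (_ : b = a + (b - a)); last by ring.
  by apply: le_trans (ler_normD _ _) _; rewrite lerD2l.
apply/mem_set; rewrite /D/=.
move: yb; rewrite in_ball1 -(ler_nat R) -(ler_pM2l r0) natrB ?(ltnW dN)// mulrBr -tr.
by move: (l1near y); rewrite ler_norml => /andP[_]; lra.
Qed.

End riemann.

(** * The negative binomial series *)

Section binomial_series.
Context {R : realType}.
Implicit Types (q : R) (k M : nat).

Definition binomial_sum q k M : R := \sum_(0 <= N < M) 'C(N + k, k)%:R * q ^+ N.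

(** Multiplication by [1 - q] takes differences of the coefficients, and Pascal's rule lowers [k].
    The subtracted term is the boundary of the truncation; without it, iteration would give
    [(1 - q)^-(k+1)] exactly. *)
Lemma binomial_sum_rec q k M :
  (1 - q) * binomial_sum q k.+1 M = binomial_sum q k M - 'C(M + k, k.+1)%:R * q ^+ M.
Proof.
rewrite /binomial_sum; elim: M => [|M ih].
  by rewrite !big_nil add0n bin_small// mulr0 mul0r subrr.
rewrite !big_nat_recr//= mulrDr ih addnS addSn binS natrD exprS; ring.
Qed.

Lemma binomial_sum_le q k M : 0 <= q < 1 -> binomial_sum q k M <= (1 - q) ^- k.+1.
Proof.
move=> /andP[q0 q1]; have q1' : 0 < 1 - q by rewrite subr_gt0.
elim: k => [|k ih].
  rewrite /binomial_sum expr1 -[leRHS]mul1r ler_pdivlMr//.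
  rewrite (eq_bigr (fun N => q ^+ N)); last by move=> N _; rewrite bin0 mul1r.
  rewrite big_mkord; have := subrX1 q M; have : 0 <= q ^+ M by rewrite exprn_ge0.
  by move: (\sum_(_ < _) _) => S; lra.
rewrite [_ ^+ k.+2]exprS invfM ler_pdivlMl// binomial_sum_rec.
by apply: le_trans ih; rewrite lerBlDr lerDl mulr_ge0 ?exprn_ge0.
Qed.

Lemma binomial_sum_nd q k : 0 <= q -> {homo binomial_sum q k : n m / (n <= m)%N >-> n <= m}.
Proof.
move=> q0 m n mn; rewrite /binomial_sum (big_cat_nat _ mn)//= lerDl sumr_ge0// => i _.
by rewrite mulr_ge0 ?exprn_ge0.
Qed.

Lemma cvg_binomial_term q k : 0 <= q < 1 ->
  ('C(M + k, k)%:R * q ^+ M : R) @[M --> \oo] --> (0 : R).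
Proof.
move=> q01; apply: cvg_series_cvg_0; apply: nondecreasing_is_cvgn.
  by apply: binomial_sum_nd; case/andP: q01.
by exists ((1 - q) ^- k.+1) => _ [M _ <-]; exact: binomial_sum_le.
Qed.

Lemma cvg_binomial_sum q k : 0 <= q < 1 ->
  binomial_sum q k M @[M --> \oo] --> (1 - q) ^- k.+1.
Proof.
move=> q01; have /andP[q0 q1] := q01; have q1' : 1 - q != 0 by rewrite subr_eq0 gt_eqF.
elim: k => [|k ih].
  rewrite expr1 -[X in _ --> X]mul1r.
  have -> : binomial_sum q 0 = series (geometric 1 q).
    by apply/funext => M; apply: eq_bigr => N _; rewrite bin0.
  by apply: cvg_geometric_series; rewrite ger0_norm.
have e : (fun M => binomial_sum q k.+1 M) =
    (fun M => (1 - q)^-1 * (binomial_sum q k M - 'C(M + k, k.+1)%:R * q ^+ M)).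
  by apply/funext => M; rewrite -binomial_sum_rec mulrA mulVf// mul1r.
rewrite e exprS invfM; apply: cvgMr; rewrite -[X in _ --> X]subr0; apply: cvgB => //.
apply: (@squeeze_cvgr _ _ _ _ (cst 0) (fun M => 'C(M + k.+1, k.+1)%:R * q ^+ M)).
- apply: nearW => M /=; rewrite mulr_ge0 ?exprn_ge0//= ler_wpM2r ?exprn_ge0// ler_nat.
  by rewrite leq_bin2l// leq_add2l.
- exact: cvg_cst.
- exact: cvg_binomial_term.
Qed.

End binomial_series.

(** * Sums over l1 balls up to an error of order [N^d] *)

Section ball_sum_asymptotics.
Context {R : realType} {d : nat}.
Hypothesis d_gt0 : (0 < d)%N.
Implicit Types (v : 'rV[R]_d) (x : 'rV[int]_d) (N : nat).

Definition limit_h v : R := fine (limit_support v).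

Local Notation t := (cross_scale R d).

Let D : set (d.-tuple (measurableTypeR R)) := [set y | l1norm (row_of_tuple y) <= t].

Let I v := (\int[lebesgue_tuple d]_(y in D) `|dot (row_of_tuple y) v|%:E)%E.

Let limit_supportI v : limit_support v = ((2^-1)%:E * I v)%E.
Proof. by rewrite /limit_support /Lebesgue_integral cross_polytopeE. Qed.

Let I_fin v : I v \is a fin_num.
Proof.
have [ub _] := integral_ball_sum v (cross_scale_gt0 : 0 < t) (ltnSn d).
rewrite ge0_fin_numE; first exact: le_lt_trans ub (ltry _).
by apply: integral_ge0 => y _; rewrite lee_fin.
Qed.

Lemma limit_supportE v : limit_support v = (limit_h v)%:E.
Proof. by rewrite /limit_h fineK// limit_supportI fin_numM. Qed.

Let IE v : I v = (2 * limit_h v)%:E.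
Proof.
by rewrite EFinM -limit_supportE limit_supportI muleA -EFinM divff ?pnatr_eq0// mul1e.
Qed.

Lemma limit_h_ge0 v : 0 <= limit_h v.
Proof.
have : (0 <= I v)%E by apply: integral_ge0 => y _; rewrite lee_fin.
by rewrite IE lee_fin pmulr_rge0.
Qed.

(** Here the value of [t] enters: [t^(d+1) = (d+1)! / 2^(d-1)] turns [2 / (t / M)^(d+1)] into
    [2^d M^(d+1) / (d+1)!]. *)
Let scaleE v (M : nat) : (0 < M)%N -> 2 * limit_h v / (t / M%:R) ^+ d.+1 =
  2 ^+ d * limit_h v * (M%:R ^+ d.+1 / d.+1`!%:R).
Proof.
move=> M0; rewrite expr_div_n cross_scale_exp// -[in 2 ^+ d](prednK d_gt0) [2 ^+ _.+1]exprS.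
have M0' : M%:R ^+ d.+1 != 0 :> R by rewrite expf_neq0// pnatr_eq0 -lt0n.
have f0 : (d.+1)`!%:R != 0 :> R by rewrite pnatr_eq0 -lt0n fact_gt0.
have p0 : 2 ^+ d.-1 != 0 :> R by rewrite expf_neq0.
by move: M0' f0 p0; move: (M%:R ^+ _) (_`!%:R) (2 ^+ _) => a b c ? ? ?; field; apply/and3P; split.
Qed.

(** The lower Riemann bound at parameter [N + d], whose ball has radius exactly [N], solved for the
    ball sum. Dually, [ball_sum_lower] uses the upper bound at [N - d]. *)
Lemma ball_sum_upper v N : (0 < N)%N -> ball_sum v N <=
  2 ^+ d * limit_h v * ((N + d)%:R ^+ d.+1 / d.+1`!%:R) + l1norm v * N.*2.+1%:R ^+ d.
Proof.
move=> N0; have dN : (d < N + d)%N by rewrite -[ltnLHS]add0n ltn_add2r.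
have [_] := integral_ball_sum v (cross_scale_gt0 : 0 < t) dN.
have Nd0 : (0 < N + d)%N by rewrite addn_gt0 N0.
rewrite -/(I v) IE lee_fin addnK -scaleE//.
rewrite -ler_pdivlMl ?exprn_gt0 ?divr_gt0 ?cross_scale_gt0 ?ltr0n// => h.
rewrite -lerBlDr; apply: le_trans (le_trans _ h) _; last by rewrite mulrC.
by rewrite lerB// ler_wpM2l ?l1norm_ge0// -natrX ler_nat card_ball1.
Qed.

Lemma ball_sum_lower v N : (d.*2 < N)%N ->
  2 ^+ d * limit_h v * ((N - d)%:R ^+ d.+1 / d.+1`!%:R) - l1norm v * N.*2.+1%:R ^+ d
    <= ball_sum v N.
Proof.
move=> N0; have dN : (d < N - d)%N by lia.
have [+ _] := integral_ball_sum v (cross_scale_gt0 : 0 < t) dN.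
have Nd0 : (0 < N - d)%N by exact: leq_trans dN.
rewrite -/(I v) IE lee_fin subnK; last by lia.
rewrite -scaleE//.
rewrite -ler_pdivrMl ?exprn_gt0 ?divr_gt0 ?cross_scale_gt0 ?ltr0n// => h.
rewrite lerBlDr mulrC; apply: le_trans h _.
by rewrite lerD// ler_wpM2l ?l1norm_ge0// -natrX ler_nat card_ball1.
Qed.

(** Stand-in for [N^(d+1) / (d+1)!], chosen because its Abel transform is explicit (see
    [abel_binomial_ref]). *)
Definition binomial_ref N : R := 'C(N + d, d.+1)%:R.

Lemma binomial_refE N : binomial_ref N = (\prod_(i < d.+1) (N + d - i))%:R / d.+1`!%:R.
Proof.
by rewrite /binomial_ref -ffact_prod -bin_ffact natrM mulfK.
Qed.

Lemma binomial_ref_lower N : N%:R ^+ d.+1 / d.+1`!%:R <= binomial_ref N.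
Proof.
rewrite binomial_refE ler_pM2r ?invr_gt0 ?ltr0n ?fact_gt0// -natrX ler_nat.
rewrite -[X in (N ^ X)%N]card_ord -prod_nat_const; apply: leq_prod => i _.
by have := ltn_ord i; lia.
Qed.

Lemma binomial_ref_upper N : binomial_ref N <= (N + d)%:R ^+ d.+1 / d.+1`!%:R.
Proof.
rewrite binomial_refE ler_pM2r ?invr_gt0 ?ltr0n ?fact_gt0// -natrX ler_nat.
rewrite -[X in (_ ^ X)%N]card_ord -prod_nat_const; apply: leq_prod => i _.
exact: leq_subr.
Qed.

Lemma ler_subX (x y : R) n : 0 <= y -> y <= x -> x ^+ n.+1 - y ^+ n.+1 <= n.+1%:R * (x - y) * x ^+ n.
Proof.
move=> y0 yx; have x0 : 0 <= x by exact: le_trans yx.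
elim: n => [|n ih]; first by rewrite !expr1 expr0 mul1r mulr1.
rewrite [x ^+ n.+2]exprS [y ^+ n.+2]exprS.
have -> : x * x ^+ n.+1 - y * y ^+ n.+1 = x * (x ^+ n.+1 - y ^+ n.+1) + (x - y) * y ^+ n.+1 by ring.
have -> : n.+2%:R * (x - y) * x ^+ n.+1 = x * (n.+1%:R * (x - y) * x ^+ n) + (x - y) * x ^+ n.+1.
  by rewrite exprS -(natr1 n.+1); ring.
by rewrite lerD// ler_wpM2l ?subr_ge0// lerXn2r ?nnegrE.
Qed.

(* Both [ball_sum] and the binomial coefficient are [N^(d+1)/(d+1)!] up to [O(N^d)]. *)
Lemma ball_sum_approx v : exists2 c : R, 0 <= c & forall N,
  `|ball_sum v N - 2 ^+ d * limit_h v * binomial_ref N| <= c * N.+1%:R ^+ d.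
Proof.
pose L := 2 ^+ d * limit_h v; pose F : R := d.+1`!%:R.
have L0 : 0 <= L by rewrite mulr_ge0 ?limit_h_ge0// exprn_ge0.
have F0 : 0 < F by rewrite ltr0n fact_gt0.
(* [c1] absorbs the finitely many [N <= 2d], to which [ball_sum_lower] does not apply; [c2] collects
   the gap between [(N - d)^(d+1)] and [(N + d)^(d+1)] and the boundary terms of the Riemann
   sums. *)
pose c1 := \sum_(N < d.*2.+1) `|ball_sum v N - L * binomial_ref N|.
pose c2 := L * ((d.+1%:R * d.*2%:R * (d.+1%:R ^+ d)) / F) + l1norm v * 2 ^+ d.
have c10 : 0 <= c1 by rewrite sumr_ge0.
have c20 : 0 <= c2.
  apply: addr_ge0; apply: mulr_ge0 => //; [|exact: l1norm_ge0].
  by apply: divr_ge0 (ltW F0); rewrite !mulr_ge0 ?exprn_ge0.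
exists (c1 + c2) => [|N]; first by rewrite addr_ge0.
have [Nd|dN] := leqP N d.*2.
  rewrite mulrDl -[leLHS]addr0 lerD//; last by rewrite mulr_ge0 ?exprn_ge0.
  rewrite -[leLHS]mulr1 ler_pM//; last by rewrite exprn_ege1// ler1n.
  by rewrite /c1 (bigD1 (Ordinal (Nd : (N < d.*2.+1)%N)))//= lerDl sumr_ge0.
have N0 : (0 < N)%N by lia.
have diff : ((N + d)%:R ^+ d.+1 - (N - d)%:R ^+ d.+1) / F <=
    (d.+1%:R * d.*2%:R * (d.+1%:R ^+ d)) / F * N.+1%:R ^+ d.
  rewrite mulrAC ler_pM2r ?invr_gt0//.
  apply: le_trans (ler_subX _ _ _) _ => //; first by rewrite ler_nat; lia.
  rewrite -natrB; last by lia.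
  have -> : (N + d - (N - d) = d.*2)%N by lia.
  rewrite -[leRHS]mulrA ler_wpM2l ?mulr_ge0// -exprMn lerXn2r ?nnegrE ?mulr_ge0//.
  by rewrite -natrM ler_nat; nia.
have e2 : l1norm v * N.*2.+1%:R ^+ d <= l1norm v * 2 ^+ d * N.+1%:R ^+ d.
  rewrite -mulrA ler_wpM2l ?l1norm_ge0// -exprMn lerXn2r ?nnegrE ?mulr_ge0//.
  by rewrite -natrM ler_nat; lia.
have up := ball_sum_upper v N0; have lo := ball_sum_lower v dN.
have rup := binomial_ref_upper N; have rlo := binomial_ref_lower N.
have rlo' : (N - d)%:R ^+ d.+1 / F <= binomial_ref N.
  apply: le_trans rlo; rewrite ler_pM2r ?invr_gt0// lerXn2r ?nnegrE// ler_nat.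
  exact: leq_subr.
have c2N : c2 * N.+1%:R ^+ d <= (c1 + c2) * N.+1%:R ^+ d.
  by rewrite ler_wpM2r ?exprn_ge0// lerDr.
apply: le_trans c2N; rewrite /c2 [leRHS]mulrDl -[L * _ * _]mulrA.
have key (S a b r k k' e : R) : S <= L * a + k -> L * b - k <= S -> r <= a ->
    b <= r -> a - b <= e -> k <= k' -> `|S - L * r| <= L * e + k'.
  move=> h1 h2 h3 h4 h5 h6.
  have := ler_wpM2l L0 h3; have := ler_wpM2l L0 h4; have := ler_wpM2l L0 h5.
  by rewrite mulrBr => *; rewrite ler_norml; apply/andP; split; lra.
by apply: key up lo rup rlo' _ e2; rewrite -mulrBl.
Qed.

End ball_sum_asymptotics.

Arguments binomial_ref {R} d N.

(** * Abel summation, from ball sums to exponential sums *)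

Section abel.
Context {R : realType}.
Implicit Types (q : R) (a : nat -> R).

(** Summation by parts of [\sum_(N <= M) (a N - a (N - 1)) q^N] with [a (-1) = 0]; the increments
    reappear in [abelS]. *)
Definition abel q a M : R := (1 - q) * (\sum_(0 <= N < M) a N * q ^+ N) + a M * q ^+ M.

Lemma abel0 q a : abel q a 0 = a 0%N.
Proof. by rewrite /abel big_nil mulr0 add0r mulr1. Qed.

Lemma abelS q a M : abel q a M.+1 = abel q a M + (a M.+1 - a M) * q ^+ M.+1.
Proof. by rewrite /abel big_nat_recr//= exprS; ring. Qed.

Lemma abelE q a (x y : R) M : abel q (fun N => x * a N + y) M = x * abel q a M + y.
Proof. by elim: M => [|M ih]; rewrite ?abel0// !abelS ih; ring. Qed.

(** [abel q] is an average: its weights [(1 - q) q^N] and [q^M] are nonnegative with sum 1, so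
    pointwise estimates pass to it and constants are preserved. *)
Lemma abel_norm q a a' (L x y : R) M : 0 <= q <= 1 ->
  (forall N, `|a N - L * a' N| <= x * a' N + y) ->
  `|abel q a M - L * abel q a' M| <= x * abel q a' M + y.
Proof.
move=> /andP[q0 q1] h; rewrite -abelE.
have -> : abel q a M - L * abel q a' M = abel q (fun N => a N - L * a' N) M.
  by elim: M => [|M ih]; rewrite ?abel0// !abelS -ih; ring.
rewrite /abel; apply: le_trans (ler_normD _ _) _.
rewrite !normrM (ger0_norm (_ : 0 <= 1 - q)) ?subr_ge0// (ger0_norm (exprn_ge0 _ q0)).
rewrite lerD ?ler_wpM2r ?exprn_ge0// ler_wpM2l ?subr_ge0//.
apply: le_trans (ler_norm_sum _ _ _) _; apply: ler_sum => N _.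
by rewrite normrM (ger0_norm (exprn_ge0 _ q0)) ler_wpM2r ?exprn_ge0.
Qed.

(** The increments of the ball sums are sums over the spheres [norm1 x = N], on which the weight is
    constant. *)
Lemma ball1_abel d (F : 'rV[int]_d -> R) q M :
  \sum_(x <- ball1 d M) F x * q ^+ norm1 x =
  abel q (fun N => \sum_(x <- ball1 d N) F x) M.
Proof.
have split (G : 'rV[int]_d -> R) N : \sum_(x <- ball1 d N.+1) G x =
    \sum_(x <- ball1 d N) G x + \sum_(x <- ball1 d N.+1 | norm1 x == N.+1) G x.
  rewrite (bigID (fun x => norm1 x == N.+1))/= addrC; congr (_ + _).
  rewrite -big_filter; apply: perm_big; apply: uniq_perm => [||x].
  - exact: filter_uniq (fset_uniq _).
  - exact: fset_uniq.
  - by rewrite mem_filter !in_ball1 leq_eqVlt ltnS; case: eqP => //= ->; rewrite ltnn.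
elim: M => [|M ih].
  rewrite abel0 !big_seq; apply: eq_bigr => x; rewrite in_ball1 leqn0 => /eqP ->.
  by rewrite mulr1.
rewrite abelS -ih [LHS]split; congr (_ + _).
rewrite split [X in (X - _)]addrC addrK mulr_suml; apply: eq_bigr => x.
by move=> /eqP ->.
Qed.

End abel.

Section weighted_sums.
Context {R : realType} {d : nat}.
Hypothesis d_gt0 : (0 < d)%N.
Implicit Types (v : 'rV[R]_d) (b : R).

Definition wsum v b M : R := \sum_(x <- ball1 d M) absdot v x * expR (- (b * (norm1 x)%:R)).

Lemma expRNM b (n : nat) : expR (- (b * n%:R)) = expR (- b) ^+ n.
Proof. by rewrite -mulNr mulrC expRM_natl. Qed.

Lemma wsumE v b M : wsum v b M = abel (expR (- b)) (ball_sum v) M.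
Proof. by rewrite -ball1_abel; apply: eq_bigr => x _; rewrite expRNM. Qed.

Lemma abel_binomial_ref q M :
  abel q (@binomial_ref R d) M = q * binomial_sum q d M.
Proof.
elim: M => [|M ih].
  by rewrite abel0 /binomial_sum big_nil mulr0 /binomial_ref add0n bin_small.
rewrite abelS ih /binomial_sum big_nat_recr//= mulrDr; congr (_ + _).
by rewrite /binomial_ref addSn binS natrD addrC addKr exprS; ring.
Qed.

Lemma expRN_itv b : 0 < b -> 0 <= expR (- b) < 1.
Proof. by move=> b0; rewrite expR_ge0/= expR_lt1 oppr_lt0. Qed.

(** With [a = b / (d + 1)] the numerator is [exp (- a)^(d+1)], and each factor
    [exp (- a) / (1 - exp (- b))] is at most [1 / (exp a - 1) <= 1 / a]. *)
Lemma exp_ratio_le b : 0 < b ->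
  expR (- b) / (1 - expR (- b)) ^+ d.+1 <= d.+1%:R ^+ d.+1 / b ^+ d.+1.
Proof.
move=> b0; have /andP[_ q1] := expRN_itv b0.
have q1' : 0 < 1 - expR (- b) by rewrite subr_gt0.
pose a := b / d.+1%:R.
have a0 : 0 < a by rewrite divr_gt0.
have qE : expR (- b) = expR (- a) ^+ d.+1 by rewrite -expRNM /a divfK.
rewrite {1}qE -!expr_div_n lerXn2r ?nnegrE ?divr_ge0 ?expR_ge0 ?(ltW q1') ?(ltW b0)//.
rewrite -[leRHS]invf_div -/a -[leRHS]mul1r ler_pdivlMr// mulrAC ler_pdivrMr// mul1r.
have ab : expR (- b) <= expR (- a).
  by rewrite ler_expR lerN2 ler_pdivrMr// ler_peMr ?(ltW b0)// ler1n.
have := expR_ge1Dx a; have : expR (- a) * expR a = 1 by rewrite expRN mulVf// expR_eq0.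
have := expR_gt0 (- a); nra.
Qed.

End weighted_sums.

(** * Exponential sums over all integer vectors, as [b] tends to 0 *)

Section weighted_limit.
Context {R : realType} {d : nat}.
Hypothesis d_gt0 : (0 < d)%N.
Implicit Types (v : 'rV[R]_d) (b : R).

Lemma ball_sum_le_ref v N :
  ball_sum v N <= l1norm v * 3 ^+ d * d.+1`!%:R * binomial_ref d N.
Proof.
have -> : l1norm v * 3 ^+ d * d.+1`!%:R * binomial_ref d N =
  l1norm v * (3 ^+ d * (binomial_ref d N * d.+1`!%:R)) by ring.
apply: (@le_trans _ _ (l1norm v * (3 ^+ d * N%:R ^+ d.+1))); last first.
  rewrite !ler_wpM2l ?l1norm_ge0 ?exprn_ge0// -ler_pdivrMr ?ltr0n ?fact_gt0//.
  exact: binomial_ref_lower.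
apply: (@le_trans _ _ (\sum_(x <- ball1 d N) l1norm v * N%:R)).
  rewrite /ball_sum !big_seq; apply: ler_sum => x; rewrite in_ball1 => xN.
  apply: le_trans (absdot_le_norm1 _ _) _; by rewrite ler_wpM2l ?l1norm_ge0// ler_nat.
rewrite big_const_seq count_predT iter_addr_0 -[leLHS]mulr_natr -mulrA.
rewrite ler_wpM2l ?l1norm_ge0//; case: N => [|N]; first by rewrite mul0r exprS mul0r mulr0.
rewrite exprS mulrCA ler_wpM2l// -exprMn -natrM -natrX ler_nat.
by apply: leq_trans (card_ball1 _) _; rewrite leq_exp2r//; lia.
Qed.

Lemma wsum_nd v b : {homo wsum v b : n m / (n <= m)%N >-> n <= m}.
Proof.
move=> m n mn; apply: ler_sum_uniq_sub.
- exact: fset_uniq.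
- exact: fset_uniq.
- by move=> x; rewrite !in_ball1 => /leq_trans; apply.
- by move=> x _; rewrite mulr_ge0 ?absdot_ge0 ?expR_ge0.
Qed.

(** The bound is uniform in all [b > 0], because the passage to primitive vectors evaluates such
    sums at every multiple [j b], however small [b] is. *)
Lemma wsum_bounded v : exists2 U : R, 0 <= U &
  forall b M, 0 < b -> b ^+ d.+1 * wsum v b M <= U.
Proof.
pose c := l1norm v * 3 ^+ d * d.+1`!%:R.
have c0 : 0 <= c by rewrite !mulr_ge0 ?l1norm_ge0 ?exprn_ge0.
exists (c * d.+1%:R ^+ d.+1) => [|b M b0]; first by rewrite mulr_ge0 ?exprn_ge0.
have bd0 : 0 < b ^+ d.+1 by rewrite exprn_gt0.
rewrite mulrC -ler_pdivlMr// wsumE -mulrA.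
have q01 := expRN_itv b0; have /andP[q0 q1] := q01.
(* With comparison factor 0, [abel_norm] serves as monotonicity of [abel]. *)
have h : `|abel (expR (- b)) (ball_sum v) M - 0 * abel (expR (- b)) (binomial_ref d) M| <=
    c * abel (expR (- b)) (binomial_ref d) M + 0.
  apply: abel_norm; first by rewrite q0 ltW.
  by move=> N; rewrite mul0r subr0 addr0 ger0_norm ?ball_sum_ge0// ball_sum_le_ref.
move: h; rewrite mul0r subr0 addr0 abel_binomial_ref => h.
apply: le_trans (ler_norm _) (le_trans h _); rewrite ler_wpM2l//.
by apply: le_trans (exp_ratio_le b0); rewrite ler_wpM2l// binomial_sum_le.
Qed.

Definition wlim v b : R := limn (wsum v b).

Lemma cvg_wsum v b : 0 < b -> wsum v b M @[M --> \oo] --> wlim v b.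
Proof.
move=> b0; apply: nondecreasing_is_cvgn; first exact: wsum_nd.
have [U _ h] := wsum_bounded v; exists (U / b ^+ d.+1) => _ [M _ <-].
by rewrite ler_pdivlMr ?exprn_gt0// mulrC h.
Qed.

Lemma wsum_le_wlim v b M : 0 < b -> wsum v b M <= wlim v b.
Proof.
by move=> b0; apply: nondecreasing_cvgn_le; [exact: wsum_nd|apply/cvg_ex; exists (wlim v b); exact: cvg_wsum].
Qed.

Lemma wlim_le v b (c : R) : 0 < b -> (forall M, wsum v b M <= c) -> wlim v b <= c.
Proof. by move=> b0 h; apply: (cvgr_to_le (@cvg_wsum v b b0)); exact: (nearW _ h). Qed.

Lemma power_le_ref (c e : R) : 0 <= c -> 0 < e -> exists Q : R, forall N,
  c * N.+1%:R ^+ d <= e * binomial_ref d N + Q.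
Proof.
move=> c0 e0; pose X := c * 2 ^+ d * d.+1`!%:R / e.
have F0 : (0 : R) < d.+1`!%:R by rewrite ltr0n fact_gt0.
have X0 : 0 <= X by rewrite divr_ge0 ?(ltW e0)// !mulr_ge0 ?exprn_ge0.
have r0 N : 0 <= binomial_ref d N :> R by rewrite /binomial_ref.
exists (c * (X + 2) ^+ d) => N; have [NX|XN] := leP (N.+1%:R : R) (X + 2).
  rewrite -[leLHS]add0r lerD ?mulr_ge0 ?(ltW e0)//.
  by rewrite ler_wpM2l// lerXn2r ?nnegrE ?addr_ge0.
rewrite -[leLHS]addr0 lerD//; last by rewrite mulr_ge0 ?exprn_ge0 ?addr_ge0.
have N1 : X <= N%:R by move: XN; rewrite -natr1; lra.
have N0 : (0 < N)%N by rewrite -(ltr0n R); move: XN; rewrite -natr1; lra.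
apply: (@le_trans _ _ (e * (N%:R ^+ d.+1 / d.+1`!%:R))); last first.
  by rewrite ler_wpM2l ?(ltW e0)// binomial_ref_lower.
apply: (@le_trans _ _ (c * 2 ^+ d * N%:R ^+ d)).
  rewrite -mulrA -exprMn ler_wpM2l// lerXn2r ?nnegrE ?mulr_ge0//.
  by rewrite -natrM ler_nat; lia.
have -> : e * (N%:R ^+ d.+1 / d.+1`!%:R) = e * N%:R / d.+1`!%:R * N%:R ^+ d.
  by rewrite exprS; ring.
rewrite ler_wpM2r ?exprn_ge0//.
move: N1; rewrite /X ler_pdivrMr// => N1.
by rewrite ler_pdivlMr// [leRHS]mulrC.
Qed.

Lemma cvg_expRN : expR (- b) @[b --> (0:R)^'+] --> (1 : R).
Proof.
apply: cvg_at_right_filter; rewrite -[X in _ --> X]expR0 -[X in expR X]oppr0.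
apply: continuous_cvg; first exact: continuous_expR.
by apply: cvgN; exact: cvg_id.
Qed.

Lemma cvg_ratio : b / (1 - expR (- b)) @[b --> (0:R)^'+] --> (1 : R).
Proof.
apply: (@squeeze_cvgr _ _ _ _ (cst 1) (fun b => (expR (- b))^-1)).
- near=> b; have b0 : 0 < b by near: b; exact: nbhs_right_gt.
  have /andP[_ q1] := expRN_itv b0.
  have q1' : 0 < 1 - expR (- b) by rewrite subr_gt0.
  rewrite /= ler_pdivlMr// ler_pdivrMr// -expRN opprK mul1r.
  have := expR_ge1Dx (- b); have := expR_ge1Dx b.
  have : expR b * expR (- b) = 1 by rewrite expRN divff// expR_eq0.
  by rewrite mulrBr => -> ? ?; apply/andP; split; lra.
- exact: cvg_cst.
- rewrite -[X in _ --> X]invr1; apply: cvgV => //; exact: cvg_expRN.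
Unshelve. all: by end_near. Qed.

(** Averaging [ball_sum_approx] compares the sum with [2^d h] times [q / (1 - q)^(d+1)], where
    [q = exp (- b)], and [b^(d+1) q / (1 - q)^(d+1)] tends to 1. The error [c N^d] is at most a
    small part of the reference plus a constant [Q], which the factor [b^(d+1)] kills. *)
Lemma wlim_limit v :
  b ^+ d.+1 * wlim v b @[b --> (0:R)^'+] --> 2 ^+ d * limit_h v.
Proof.
pose L := 2 ^+ d * limit_h v; pose rho b := b ^+ d.+1 * (expR (- b) / (1 - expR (- b)) ^+ d.+1).
have L0 : 0 <= L by rewrite mulr_ge0 ?limit_h_ge0// exprn_ge0.
have rho1 : rho b @[b --> (0:R)^'+] --> (1 : R).
  have -> : rho = (fun b => expR (- b) * (b / (1 - expR (- b))) ^+ d.+1).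
    by apply/funext => b; rewrite /rho expr_div_n mulrCA.
  rewrite -[X in _ --> X]mulr1; apply: cvgM; first exact: cvg_expRN.
  suff : (b / (1 - expR (- b))) ^+ d.+1 @[b --> (0:R)^'+] --> (1 : R) ^+ d.+1 by rewrite expr1n.
  exact: cvg_comp cvg_ratio (@exprn_continuous _ d.+1 1).
apply/cvgrPdist_le => e e0.
(* [e' * rho b] is at most [2 e']; the terms with [Q] and with [rho b - 1] take one [e'] each. *)
pose e' := e / 4.
have e'0 : 0 < e' by rewrite divr_gt0.
have [c c0 approx] := ball_sum_approx d_gt0 v.
have [Q hQ] := power_le_ref c0 e'0.
have Lrho : L * rho b @[b --> (0:R)^'+] --> L * 1 by apply: cvgM => //; exact: cvg_cst.
have bd : Q * b ^+ d.+1 @[b --> (0:R)^'+] --> Q * 0 ^+ d.+1.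
  apply: cvgM; first exact: cvg_cst.
  by apply: cvg_at_right_filter; exact: exprn_continuous.
near=> b; have b0 : 0 < b by near: b; exact: nbhs_right_gt.
have bd0 : 0 < b ^+ d.+1 by rewrite exprn_gt0.
have q01 := expRN_itv b0; have /andP[q0 q1] := q01.
pose g := expR (- b) / (1 - expR (- b)) ^+ d.+1.
have key : `|wlim v b - L * g| <= e' * g + Q.
  have wl := @cvg_wsum v b b0.
  have gl : (expR (- b) * binomial_sum (expR (- b)) d M) @[M --> \oo] --> g.
    by apply: cvgMr; exact: cvg_binomial_sum.
  pose G M := expR (- b) * binomial_sum (expR (- b)) d M.
  have c1 : `|wsum v b M - L * G M| @[M --> \oo] --> `|wlim v b - L * g|.
    by apply: cvg_norm; apply: cvgB => //; apply: cvgMr.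
  have c2 : e' * G M + Q @[M --> \oo] --> e' * g + Q.
    by apply: cvgD; [apply: cvgMr|exact: cvg_cst].
  apply: (ler_cvg_to c1 c2).
  apply: nearW => M; rewrite /G wsumE -abel_binomial_ref; apply: abel_norm; first by rewrite q0 ltW.
  by move=> N; apply: le_trans (approx N) _.
have h1 : `|L * 1 - L * rho b| <= e'.
  by near: b; move/cvgrPdist_le : Lrho; apply.
have h2 : `|1 - rho b| <= 1.
  by near: b; move/cvgrPdist_le : rho1; apply.
have h3 : `|Q * 0 ^+ d.+1 - Q * b ^+ d.+1| <= e'.
  by near: b; move/cvgrPdist_le : bd; apply.
have key' : `|b ^+ d.+1 * wlim v b - L * rho b| <= e' * rho b + Q * b ^+ d.+1.
  rewrite (_ : rho b = b ^+ d.+1 * g)//.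
  have -> : b ^+ d.+1 * wlim v b - L * (b ^+ d.+1 * g) = b ^+ d.+1 * (wlim v b - L * g).
    by clearbody g L; ring.
  have -> : e' * (b ^+ d.+1 * g) + Q * b ^+ d.+1 = b ^+ d.+1 * (e' * g + Q).
    by clearbody g e'; ring.
  by rewrite normrM (gtr0_norm bd0) ler_wpM2l// ltW.
have e'rho : e' * rho b <= e' * 2.
  by rewrite ler_pM2l//; move: h2; rewrite ler_norml => /andP[]; lra.
move: h1 h3 key'; rewrite expr0n/= !mulr0 mulr1 sub0r normrN -/L distrC => h1 h3 key'.
rewrite distrC (_ : _ - L = (b ^+ d.+1 * wlim v b - L * rho b) + (L * rho b - L)); last first.
  by rewrite addrA subrK.
apply: le_trans (ler_normD _ _) _; have := ler_norm (Q * b ^+ d.+1).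
by move: key' h1 h3 e'rho; rewrite /e'; lra.
Unshelve. all: by end_near. Qed.

End weighted_limit.

(** * Closed form in a coordinate direction, and the normalisation of [h] *)

Section coordinate_direction.
Context {R : realType} {d : nat}.
Hypothesis d_gt0 : (0 < d)%N.
Implicit Types (j : 'I_d) (q b : R).

Lemma sum_symmetric (F : nat -> R) M :
  \sum_(a < M.*2.+1) F `|(a : nat)%:Z - M%:Z|%N = F 0%N + 2 * \sum_(0 <= k < M) F k.+1.
Proof.
rewrite -(big_mkord xpredT (fun a : nat => F `|a%:Z - M%:Z|%N)).
elim: M => [|M ih]; first by rewrite double0 big_nat1 [in RHS]big_nil mulr0 [RHS]addr0.
rewrite doubleS big_nat_recl// [in RHS]big_nat_recr//= mulrDr addrA -ih big_nat_recr//=.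
rewrite [X in X + _ = _](_ : _ = F M.+1); last by congr F; lia.
rewrite [X in _ + (_ + X) = _](_ : _ = F M.+1); last by congr F; lia.
rewrite [X in _ + (X + _) = _](eq_bigr (fun a : nat => F `|a%:Z - M%:Z|%N)); last first.
  by move=> a _; congr F; lia.
by ring.
Qed.

(** Over a box instead of a ball the sum factors: [d - 1] symmetric geometric sums and, for
    coordinate [j], one with the extra factor [|x_j|]. *)
Lemma box_sum_delta j q M :
  \sum_(x <- box d M) absdot (delta_mx 0 j) x * q ^+ norm1 x =
  2 * q * binomial_sum q 1 M * (1 + 2 * q * binomial_sum q 0 M) ^+ d.-1.
Proof.
rewrite big_box.
pose F (i : 'I_d) (n : nat) : R := if i == j then n%:R * q ^+ n else q ^+ n.
transitivity (\sum_(f : {ffun 'I_d -> 'I_M.*2.+1}) \prod_i F i `|(f i : nat)%:Z - M%:Z|%N).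
  apply: eq_bigr => f _; rewrite absdot_delta /norm1 -prodrXr.
  rewrite [X in _ * X](bigD1 j)//= [RHS](bigD1 j)//= mulrA /F eqxx !mxE; congr (_ * _).
  by apply: eq_bigr => i ij; rewrite (negbTE ij) mxE.
rewrite -(bigA_distr_bigA (fun i (a : 'I_M.*2.+1) => F i `|(a : nat)%:Z - M%:Z|%N)).
rewrite (bigD1 j)//=; congr (_ * _).
  rewrite (sum_symmetric (F j)) /F eqxx mul0r add0r -!mulrA; congr (_ * _).
  rewrite /binomial_sum mulr_sumr; apply: eq_bigr => k _.
  by rewrite addn1 bin1 exprS; ring.
rewrite (eq_bigr (fun=> 1 + 2 * q * binomial_sum q 0 M)).
  by rewrite prodr_const cardC1 card_ord.
move=> i ij; rewrite (sum_symmetric (F i)) /F (negbTE ij) expr0 -mulrA; congr (_ + _ * _).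
by rewrite /binomial_sum mulr_sumr; apply: eq_bigr => k _; rewrite addn0 bin0 exprS; ring.
Qed.

(** The box lies between the balls of radii [M] and [d M], so boxes and balls exhaust the same
    series. *)
Lemma wlim_delta j b : 0 < b -> let q := expR (- b) in
  wlim (delta_mx 0 j) b = 2 * q / (1 - q) ^+ 2 * (1 + 2 * q / (1 - q)) ^+ d.-1.
Proof.
move=> b0 q; have q01 : 0 <= q < 1 := expRN_itv b0.
pose S M := 2 * q * binomial_sum q 1 M * (1 + 2 * q * binomial_sum q 0 M) ^+ d.-1.
have SE M : S M = \sum_(x <- box d M) absdot (delta_mx 0 j) x * expR (- (b * (norm1 x)%:R)).
  by rewrite /S -(box_sum_delta j); apply: eq_bigr => x _; rewrite expRNM.
have t0 (x : 'rV[int]_d) : 0 <= absdot (delta_mx 0 j) x * expR (- (b * (norm1 x)%:R)).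
  by rewrite mulr_ge0 ?absdot_ge0 ?expR_ge0.
have cS : S M @[M --> \oo] --> 2 * q / (1 - q) ^+ 2 * (1 + 2 * q / (1 - q)) ^+ d.-1.
  apply: cvgM; first by apply: cvgMr; exact: cvg_binomial_sum.
  have c : 1 + 2 * q * binomial_sum q 0 M @[M --> \oo] --> 1 + 2 * q / (1 - q).
    apply: cvgD; [exact: cvg_cst|apply: cvgMr].
    exact: (@cvg_binomial_sum R q 0 q01).
  exact: cvg_comp c (@exprn_continuous _ d.-1 _).
apply/eqP; rewrite eq_le; apply/andP; split.
  apply: (ler_cvg_to (@cvg_wsum _ _ d_gt0 (delta_mx 0 j) b b0) cS); apply: nearW => M.
  by rewrite SE; apply: ler_sum_uniq_sub => // x; rewrite inE => /andP[].
apply: (cvgr_to_le cS); apply: nearW => M; rewrite SE.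
apply: le_trans (wsum_le_wlim d_gt0 _ (d * M) b0).
apply: ler_sum_uniq_sub => // x.
rewrite in_box in_ball1 => /forallP xM; rewrite /norm1.
apply: (@leq_trans (\sum_(i < d) M)%N); first by apply: leq_sum => i _; exact: xM.
by rewrite sum_nat_const card_ord.
Qed.

(** The limit of [b^(d+1) wlim] is [2^d h] by [wlim_limit] and [2 * 2^(d-1)] by the closed form. *)
Lemma limit_h_delta j : limit_h (delta_mx 0 j : 'rV[R]_d) = 1.
Proof.
have l1 := @wlim_limit R d d_gt0 (delta_mx 0 j).
have rl : b / (1 - expR (- b)) @[b --> (0:R)^'+] --> (1 : R) by exact: cvg_ratio.
have l2 : b ^+ d.+1 * wlim (delta_mx 0 j : 'rV[R]_d) b @[b --> (0:R)^'+] --> (2 ^+ d : R).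
  (* The powers of [b] are distributed so that every factor converges: two go to [1 / (1 - q)^2] for
     coordinate [j], one to each of the other [d - 1] coordinates. *)
  have e : {near (0:R)^'+, (fun b => 2 * (expR (- b) * ((b / (1 - expR (- b))) *
        (b / (1 - expR (- b))) * (b + 2 * (expR (- b) * (b / (1 - expR (- b))))) ^+ d.-1)))
      =1 (fun b => b ^+ d.+1 * wlim (delta_mx 0 j : 'rV[R]_d) b)}.
    near=> b; have b0 : 0 < b by near: b; exact: nbhs_right_gt.
    have /andP[_ q1] := expRN_itv b0.
    have q1' : 1 - expR (- b) != 0 by rewrite subr_eq0 gt_eqF.
    rewrite /= wlim_delta//.
    have -> : b ^+ d.+1 = b ^+ d.-1 * b * b by rewrite -[in LHS](prednK d_gt0) !exprSr.
    move: (expR (- b)) q1' => q q1'.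
    have -> : b + 2 * (q * (b / (1 - q))) = b * (1 + 2 * q / (1 - q)) by field.
    by rewrite exprMn; move: (b ^+ d.-1) ((1 + _) ^+ d.-1) => x y; field.
  apply: cvg_trans (near_eq_cvg e) _.
  have -> : (2 ^+ d : R) = 2 * (1 * (1 * 1 * (0 + 2 * (1 * 1)) ^+ d.-1)).
    by rewrite -[in LHS](prednK d_gt0) exprS !mul1r mulr1 add0r.
  have qc : expR (- b) @[b --> (0:R)^'+] --> (1 : R) by exact: cvg_expRN.
  apply: cvgMr; apply: cvgM => //; apply: cvgM; first exact: cvgM.
  have c : b + 2 * (expR (- b) * (b / (1 - expR (- b)))) @[b --> (0:R)^'+] --> (0 + 2 * (1 * 1) : R).
    apply: cvgD; first by apply: cvg_at_right_filter; exact: cvg_id.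
    by apply: cvgMr; exact: cvgM.
  exact: cvg_comp c (@exprn_continuous _ d.-1 _).
apply: (@mulfI _ (2 ^+ d)); first by rewrite expf_neq0.
by rewrite mulr1; exact: cvg_unique l1 l2.
Unshelve. all: by end_near. Qed.

End coordinate_direction.

(** * From all vectors to primitive vectors *)

Section primitive_sums.
Context {R : realType} {d : nat}.
Hypothesis d_gt1 : (1 < d)%N.
Let d_gt0 : (0 < d)%N := ltnW d_gt1.
Implicit Types (v : 'rV[R]_d) (b : R).

Let term v b (x : 'rV[int]_d) : R := absdot v x * expR (- (b * (norm1 x)%:R)).

Let term_ge0 v b x : 0 <= term v b x.
Proof. by rewrite mulr_ge0 ?absdot_ge0 ?expR_ge0. Qed.

Let termZ v b (j : nat) x : term v b (j%:Z *: x) = j%:R * term v (j%:R * b) x.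
Proof.
by rewrite /term absdotZ norm1Z natrM (_ : b * _ = j%:R * b * (norm1 x)%:R) ?mulrA//; ring.
Qed.

Definition psum v b M : R :=
  \sum_(x <- ball1 d M | primitive x) absdot v x * expR (- (b * (norm1 x)%:R)).

Lemma psum_ge0 v b M : 0 <= psum v b M.
Proof. by apply: sumr_ge0 => x _; exact: term_ge0. Qed.

Lemma psum_le_wsum v b M : psum v b M <= wsum v b M.
Proof.
rewrite /psum /wsum [leRHS](bigID (@primitive d))/= lerDl.
by apply: sumr_ge0 => x _; exact: term_ge0.
Qed.

Lemma psum_nd v b : {homo psum v b : n m / (n <= m)%N >-> n <= m}.
Proof.
move=> m n mn; apply: (ler_sum_inj (h := id)) => //.
- by move=> x _ _; exact: term_ge0.
- by move=> x; rewrite !in_ball1 => xm px; rewrite (leq_trans xm mn).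
Qed.

Definition plim v b : R := limn (psum v b).

Lemma cvg_psum v b : 0 < b -> psum v b M @[M --> \oo] --> plim v b.
Proof.
move=> b0; apply: nondecreasing_is_cvgn; first exact: psum_nd.
exists (wlim v b) => _ [M _ <-].
exact: le_trans (psum_le_wsum _ _ _) (wsum_le_wlim d_gt0 _ _ b0).
Qed.

Lemma psum_le_plim v b M : 0 < b -> psum v b M <= plim v b.
Proof.
by move=> b0; apply: nondecreasing_cvgn_le; [exact: psum_nd|apply/cvg_ex; exists (plim v b); exact: cvg_psum].
Qed.

Lemma plim_ge0 v b : 0 < b -> 0 <= plim v b.
Proof. by move=> b0; apply: le_trans (psum_le_plim v 0 b0); exact: psum_ge0. Qed.

(** A nonzero vector is uniquely [j p] with [p] primitive and [j > 0] its [vgcd], and its term at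
    [b] is [j] times that of [p] at [j b]. Multiplication by [j <= J] sends the ball of radius [M]
    into that of radius [J M]. *)
Lemma sum_psum_le_wsum v b J M :
  \sum_(1 <= j < J.+1) j%:R * psum v (j%:R * b) M <= wsum v b (J * M).
Proof.
apply: (@le_trans _ _ (\sum_(1 <= j < J.+1)
    \sum_(x <- ball1 d (J * M) | vgcd x == j) term v b x)).
  rewrite big_nat_cond [leRHS]big_nat_cond; apply: ler_sum => j /andP[/andP[j0 jJ] _].
  rewrite /psum mulr_sumr.
  under eq_bigr do rewrite -/(term _ _ _) -termZ.
  apply: (ler_sum_inj (h := fun x => j%:Z *: x)) => //.
  - move=> x y _ _ /rowP xy; apply/rowP => i; have := xy i; rewrite !mxE => /mulfI; apply.
    by rewrite eqz_nat -lt0n.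
  - move=> x; rewrite !in_ball1 vgcdZ norm1Z => xM /eqP ->.
    by rewrite muln1 eqxx andbT leq_mul.
under eq_bigr do rewrite big_mkcond/=.
rewrite exchange_big/=; apply: ler_sum => x _; rewrite -big_mkcond/=.
under eq_bigl do rewrite eq_sym.
by rewrite big_nat1_eq; case: ifP => // _; exact: term_ge0.
Qed.

(** Conversely one divides by [vgcd x <= norm1 x <= M]; the vector 0, whose [vgcd] is 0, has a zero
    term. *)
Lemma wsum_le_sum_psum v b M :
  wsum v b M <= \sum_(1 <= j < M.+1) j%:R * psum v (j%:R * b) M.
Proof.
apply: (@le_trans _ _ (\sum_(1 <= j < M.+1)
    \sum_(x <- ball1 d M | vgcd x == j) term v b x)).
  under [leRHS]eq_bigr do rewrite big_mkcond/=.
  rewrite exchange_big/= /wsum !big_seq; apply: ler_sum => x; rewrite in_ball1 => xM.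
  rewrite -big_mkcond/=; under eq_bigl do rewrite eq_sym.
  have [x0|x0] := eqVneq x 0.
    have -> : absdot v x = 0 by rewrite x0 /absdot map_mx0 dot0l normr0.
    by rewrite mul0r sumr_ge0// => j _; exact: term_ge0.
  by rewrite big_nat1_eq vgcd_gt0 x0/= ltnS (leq_trans (vgcd_le_norm1 x)).
rewrite big_nat_cond [leRHS]big_nat_cond; apply: ler_sum => j /andP[/andP[j0 jM] _].
rewrite /psum mulr_sumr; under [leRHS]eq_bigr do rewrite -/(term _ _ _) -termZ.
rewrite (eq_bigr (fun x => term v b (j%:Z *: vprim x))); last first.
  by move=> x /eqP xj; rewrite {1}(vprimE x) xj.
apply: (ler_sum_inj (h := @vprim d) (F := fun p => term v b (j%:Z *: p))).
- by move=> x _ _; exact: term_ge0.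
- move=> x y; rewrite !inE => /andP[_ /eqP xj] /andP[_ /eqP yj] xy.
  by rewrite (vprimE x) (vprimE y) xj yj xy.
- move=> x; rewrite !in_ball1 => xM /eqP xj.
  have x0 : x != 0 by rewrite -vgcd_gt0 xj.
  rewrite primitive_vprim// andbT (leq_trans _ xM)// [leqRHS](congr1 (@norm1 d) (vprimE x)) norm1Z.
  by rewrite leq_pmull// xj.
Qed.

Definition nplim v b : R := b ^+ d.+1 * plim v b.

Lemma nplim_ge0 v b : 0 < b -> 0 <= nplim v b.
Proof. by move=> b0; rewrite mulr_ge0 ?plim_ge0// exprn_ge0 ?ltW. Qed.

Lemma nplim_bounded v : exists2 U : R, 0 <= U & forall b, 0 < b -> nplim v b <= U.
Proof.
have [U U0 h] := wsum_bounded d_gt0 v; exists U => // b b0.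
have bd0 : 0 < b ^+ d.+1 by rewrite exprn_gt0.
rewrite /nplim mulrC -ler_pdivlMr//; apply: (cvgr_to_le (@cvg_psum v b b0)); apply: nearW => M.
by rewrite ler_pdivlMr// mulrC (le_trans _ (h b M b0))// ler_wpM2l ?(ltW bd0) ?psum_le_wsum.
Qed.

(** After normalisation by [b^(d+1)], the factor [j] of the [j]-th layer becomes the summable weight
    [j^(-d)]. *)
Lemma nplim_scale v b (j : nat) : (0 < j)%N -> 0 < b ->
  b ^+ d.+1 * (j%:R * plim v (j%:R * b)) = j%:R ^- d * nplim v (j%:R * b).
Proof.
move=> j0 b0; rewrite /nplim exprMn [j%:R ^+ d.+1]exprS.
have : j%:R ^+ d != 0 :> R by rewrite expf_neq0// pnatr_eq0 -lt0n.
by move: (j%:R ^+ d) (b ^+ _) (plim _ _) => x y z x0; field.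
Qed.

Lemma sum_inv_sqr (J M : nat) : (0 < J)%N -> (\sum_(J.+1 <= j < M.+1) (j%:R ^- 2 : R)) <= J%:R^-1.
Proof.
move=> J0; have [MJ|JM] := leqP M J; first by rewrite big_geq// invr_ge0.
suff : \sum_(J.+1 <= j < M.+1) (j%:R ^- 2 : R) <= J%:R^-1 - M%:R^-1.
  by move/le_trans; apply; rewrite lerBlDr lerDl invr_ge0.
elim: M JM => // M ih; rewrite ltnS leq_eqVlt => /orP[/eqP <-|JM].
  rewrite big_nat1; have J0' : (0 : R) < J%:R by rewrite ltr0n.
  rewrite -natr1; have ne1 : J%:R + 1 != 0 :> R by rewrite gt_eqF// addr_gt0.
  have -> : J%:R^-1 - (J%:R + 1)^-1 = (J%:R * (J%:R + 1))^-1 :> R by field; rewrite ne1 gt_eqF.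
  by rewrite expr2 lef_pV2 ?posrE ?mulr_gt0 ?addr_gt0// ler_pM2r ?addr_gt0// lerDl.
rewrite big_nat_recr/=; last by rewrite ltnW.
have M0 : (0 : R) < M%:R by rewrite ltr0n (leq_trans _ JM).
have /(lerD (ih JM)) : (M.+1%:R ^- 2 : R) <= M%:R^-1 - M.+1%:R^-1.
  rewrite -natr1; have ne1 : M%:R + 1 != 0 :> R by rewrite gt_eqF// addr_gt0.
  have -> : M%:R^-1 - (M%:R + 1)^-1 = (M%:R * (M%:R + 1))^-1 :> R by field; rewrite ne1 gt_eqF.
  by rewrite expr2 lef_pV2 ?posrE ?mulr_gt0 ?addr_gt0// ler_pM2r ?addr_gt0// lerDl.
by move=> h; apply: le_trans h _; rewrite addrA subrK.
Qed.

Lemma sum_inv_pow (e J M : nat) : (1 < e)%N -> (0 < J)%N ->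
  (\sum_(J.+1 <= j < M.+1) (j%:R ^- e : R)) <= J%:R^-1.
Proof.
move=> e1 J0; apply: le_trans (sum_inv_sqr M J0).
rewrite big_nat_cond [leRHS]big_nat_cond; apply: ler_sum => j /andP[/andP[jJ _] _].
have j0 : (0 < j)%N by rewrite (leq_trans _ jJ).
rewrite lef_pV2 ?posrE ?exprn_gt0 ?ltr0n//.
by rewrite ler_weXn2l// ler1n.
Qed.

(** The layers [j > J] contribute at most [U \sum_(j > J) j^(-d) <= U / J]. *)
Lemma wlim_sandwich v (U : R) b J : (forall c, 0 < c -> nplim v c <= U) ->
  0 < b -> (0 < J)%N ->
  let s := \sum_(1 <= j < J.+1) j%:R ^- d * nplim v (j%:R * b) in
  s <= b ^+ d.+1 * wlim v b <= s + U / J%:R.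
Proof.
move=> hU b0 J0 /=; set s := \sum_(1 <= j < J.+1) _.
have U0 : 0 <= U by apply: le_trans (hU _ b0); exact: nplim_ge0.
have bd0 : 0 < b ^+ d.+1 by rewrite exprn_gt0.
have sE (a M : nat) : (0 < a)%N -> \sum_(a <= j < M) j%:R ^- d * nplim v (j%:R * b) =
    b ^+ d.+1 * \sum_(a <= j < M) j%:R * plim v (j%:R * b).
  move=> a0; rewrite mulr_sumr big_nat_cond [RHS]big_nat_cond.
  by apply: eq_bigr => j /andP[/andP[j0 _] _]; rewrite nplim_scale// (leq_trans a0).
apply/andP; split.
  rewrite /s sE// ler_pM2l//.
  have c K : \sum_(1 <= j < K.+1) j%:R * psum v (j%:R * b) M @[M --> \oo] -->
      \sum_(1 <= j < K.+1) j%:R * plim v (j%:R * b).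
    elim: K => [|K ih].
      rewrite big_geq//; under eq_cvg do rewrite big_geq//; exact: cvg_cst.
    rewrite big_nat_recr//=; under eq_cvg do rewrite big_nat_recr//=.
    by apply: cvgD => //; apply: cvgMr; apply: cvg_psum; rewrite mulr_gt0// ltr0n.
  apply: (cvgr_to_le (c J)); apply: nearW => M.
  exact: le_trans (sum_psum_le_wsum _ _ _ _) (wsum_le_wlim d_gt0 _ _ b0).
rewrite mulrC -ler_pdivlMr//; apply: (wlim_le d_gt0 b0) => M.
have [MJ|JM] := leqP M J.
  apply: (le_trans (wsum_nd v b MJ)); apply: (le_trans (wsum_le_sum_psum _ _ _)).
  rewrite ler_pdivlMr// mulrC; apply: (@le_trans _ _ s); last by rewrite lerDl divr_ge0.
  rewrite /s sE// ler_pM2l// big_nat_cond [leRHS]big_nat_cond.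
  apply: ler_sum => j /andP[/andP[j0 _] _].
  by rewrite ler_wpM2l// psum_le_plim// mulr_gt0// ltr0n.
apply: (le_trans (wsum_le_sum_psum _ _ _)); rewrite ler_pdivlMr// mulrC.
apply: (@le_trans _ _ (\sum_(1 <= j < M.+1) j%:R ^- d * nplim v (j%:R * b))).
  rewrite sE// ler_pM2l// big_nat_cond [leRHS]big_nat_cond.
  apply: ler_sum => j /andP[/andP[j0 _] _].
  by rewrite ler_wpM2l// psum_le_plim// mulr_gt0// ltr0n.
rewrite (@big_cat_nat _ _ _ J.+1)//=; last by rewrite ltnW.
rewrite lerD2l; apply: (@le_trans _ _ (\sum_(J.+1 <= j < M.+1) j%:R ^- d * U)).
  rewrite big_nat_cond [leRHS]big_nat_cond; apply: ler_sum => j /andP[/andP[j0 _] _].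
  rewrite ler_wpM2l ?invr_ge0 ?exprn_ge0//; apply: hU.
  by rewrite mulr_gt0// ltr0n (leq_trans _ j0).
by rewrite -mulr_suml mulrC ler_wpM2l// sum_inv_pow.
Qed.

End primitive_sums.

(** * Zeta values and limits of series [\sum_j j^(-e) f (j b)] *)

Section zeta.
Context {R : realType}.

Definition zeta_sum (e J : nat) : R := \sum_(1 <= j < J.+1) j%:R ^- e.

Definition zeta (e : nat) : R := limn (zeta_sum e).

Lemma zeta_sum_nd e : {homo zeta_sum e : n m / (n <= m)%N >-> n <= m}.
Proof.
by move=> m n mn; rewrite /zeta_sum [leRHS](@big_cat_nat _ _ _ m.+1)//= lerDl sumr_ge0.
Qed.

Lemma zeta_sum_tail e J M : (1 < e)%N -> (0 < J)%N -> zeta_sum e M <= zeta_sum e J + J%:R^-1.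
Proof.
move=> e1 J0; have [MJ|JM] := leqP M J.
  by apply: (le_trans (zeta_sum_nd e MJ)); rewrite lerDl invr_ge0.
rewrite /zeta_sum (@big_cat_nat _ _ _ J.+1)//=; last exact: ltnW.
by rewrite lerD2l sum_inv_pow.
Qed.

Lemma cvg_zeta e : (1 < e)%N -> zeta_sum e J @[J --> \oo] --> zeta e.
Proof.
move=> e1; apply: nondecreasing_is_cvgn; first exact: zeta_sum_nd.
exists (zeta_sum e 1 + 1%:R^-1) => _ [M _ <-]; exact: zeta_sum_tail.
Qed.

Lemma zeta_sum_le e J : (1 < e)%N -> zeta_sum e J <= zeta e.
Proof.
by move=> e1; apply: nondecreasing_cvgn_le; [exact: zeta_sum_nd|apply/cvg_ex; exists (zeta e); exact: cvg_zeta].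
Qed.

Lemma zeta_le e J : (1 < e)%N -> (0 < J)%N -> zeta e <= zeta_sum e J + J%:R^-1.
Proof. by move=> e1 J0; apply: (cvgr_to_le (@cvg_zeta e e1)); apply: nearW => M; exact: zeta_sum_tail. Qed.

Lemma zeta_ge1 e : (1 < e)%N -> 1 <= zeta e.
Proof.
by move=> e1; apply: le_trans (zeta_sum_le 1 e1); rewrite /zeta_sum big_nat1 expr1n invr1.
Qed.

End zeta.

Section scaled_series.
Context {R : realType}.
Implicit Types (f alpha : R -> R) (b l c U : R).

Lemma near_scale (P : R -> Prop) (k : R) : 0 < k ->
  (\forall b \near (0:R)^'+, P b) -> \forall b \near (0:R)^'+, P (k * b).
Proof.
move=> k0 [e /= e0 he]; exists (e / k); rewrite /= ?divr_gt0// => b /=.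
rewrite sub0r normrN => be b0; apply: he; rewrite /= ?mulr_gt0//.
by rewrite sub0r normrN normrM (gtr0_norm k0) mulrC -ltr_pdivlMr.
Qed.

Lemma near_and_scales (P : R -> Prop) (J : nat) : (\forall b \near (0:R)^'+, P b) ->
  \forall b \near (0:R)^'+, forall j, (0 < j <= J)%N -> P (j%:R * b).
Proof.
move=> nP; elim: J => [|J ih]; first by apply: nearW => b [].
have h : \forall b \near (0:R)^'+, P (J.+1%:R * b) by apply: near_scale.
near=> b => j /andP[j0]; rewrite leq_eqVlt ltnS => /orP[/eqP ->|jJ].
  by near: b.
suff : forall j, (0 < j <= J)%N -> P (j%:R * b) by apply; rewrite j0.
by near: b; exact: ih.
Unshelve. all: by end_near. Qed.

(** Truncated form of [alpha b = \sum_(j >= 1) j^(-e) f (j b)]. It occurs with [e = d], all vectors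
    against primitive ones, and with [e = d + 1], geometric means against exponential sums. *)
Definition sandwiched (e : nat) U f alpha := forall b J, 0 < b -> (0 < J)%N ->
  let s := \sum_(1 <= j < J.+1) j%:R ^- e * f (j%:R * b) in s <= alpha b <= s + U / J%:R.

Lemma scaled_sum_dist e f l (E : R) b J : (forall j, (0 < j <= J)%N -> `|l - f (j%:R * b)| <= E) ->
  `|zeta_sum e J * l - \sum_(1 <= j < J.+1) j%:R ^- e * f (j%:R * b)| <= zeta_sum e J * E.
Proof.
move=> h; rewrite /zeta_sum !mulr_suml -sumrB; apply: le_trans (ler_norm_sum _ _ _) _.
rewrite big_nat_cond [leRHS]big_nat_cond; apply: ler_sum => j /andP[/andP[j0 jJ] _].
rewrite -mulrBr normrM ger0_norm ?invr_ge0 ?exprn_ge0// ler_wpM2l ?invr_ge0 ?exprn_ge0//.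
by apply: h; rewrite j0 -ltnS.
Qed.

Lemma large_nat (x e : R) : 0 < e -> exists2 J : nat, (0 < J)%N & x / J%:R <= e.
Proof.
move=> e0; exists (Num.bound `|x / e|).+1 => //.
rewrite ler_pdivrMr ?ltr0n// mulrC -ler_pdivrMr// (le_trans (ler_norm _))//.
apply: (le_trans (ltW (archi_boundP _))) => //; by rewrite ler_nat.
Qed.

Lemma sandwiched_limit e U f alpha l : (1 < e)%N -> 0 <= U -> sandwiched e U f alpha ->
  f b @[b --> (0:R)^'+] --> l -> alpha b @[b --> (0:R)^'+] --> zeta e * l.
Proof.
move=> e1 U0 hs fl; apply/cvgrPdist_le => eps eps0.
(* [U / J] bounds the tail of [alpha] and [|l| / J] that of [zeta e * l]. *)
have [J J0 hJ] := @large_nat (U + `|l|) (eps / 2) (divr_gt0 eps0 (ltr0n _ 2)).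
have Z0 : (0 : R) < zeta e := lt_le_trans ltr01 (zeta_ge1 e1).
pose E := eps / 2 / zeta e.
have E0 : 0 < E by rewrite !divr_gt0.
have nf : \forall b \near (0:R)^'+, `|l - f b| <= E by move/cvgrPdist_le : fl; apply.
near=> b; have b0 : 0 < b by near: b; exact: nbhs_right_gt.
have h j : (0 < j <= J)%N -> `|l - f (j%:R * b)| <= E.
  by move: j; near: b; exact: (@near_and_scales (fun c => `|l - f c| <= E) J nf).
have := scaled_sum_dist e h; have := hs b J b0 J0; rewrite /=.
move: (\sum_(1 <= j < J.+1) _) => s /andP[s1 s2].
have zE : zeta_sum e J * E <= eps / 2.
  by rewrite /E mulrCA ger_pMr ?divr_gt0// ler_pdivrMr// mul1r zeta_sum_le.
have zl : `|zeta e * l - zeta_sum e J * l| <= `|l| / J%:R.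
  rewrite -mulrBl normrM mulrC ler_wpM2l//.
  have zj1 : zeta_sum e J <= zeta e :> R := zeta_sum_le J e1.
  have zj2 : zeta e <= zeta_sum e J + J%:R^-1 :> R := zeta_le e1 J0.
  have zj3 : (0 : R) <= J%:R^-1 by rewrite invr_ge0.
  by rewrite ler_norml; apply/andP; split; lra.
have sa : `|s - alpha b| <= U / J%:R by rewrite ler_norml; apply/andP; split; lra.
move=> hd; rewrite (_ : _ - alpha b = (zeta e * l - zeta_sum e J * l) +
   ((zeta_sum e J * l - s) + (s - alpha b))); last by ring.
apply: le_trans (ler_normD _ _) _; rewrite [leRHS](_ : _ = eps / 2 + eps / 2); last by field.
have := ler_normD (zeta_sum e J * l - s) (s - alpha b).
move: hJ; rewrite mulrDl; lra.
Unshelve. all: by end_near. Qed.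

(* The terms [j >= 2] contract the distance to the limit, as [zeta e - 1 < 1]. *)
Lemma sandwiched_inv e U f alpha c : (1 < e)%N -> 0 <= U ->
  (forall b, 0 < b -> 0 <= f b <= U) -> sandwiched e U f alpha ->
  alpha b @[b --> (0:R)^'+] --> c -> f b @[b --> (0:R)^'+] --> c / zeta e.
Proof.
move=> e1 U0 fU hs ac; set l := c / zeta e.
have Z0 : (0 : R) < zeta e := lt_le_trans ltr01 (zeta_ge1 e1).
have cE : c = zeta e * l by rewrite /l mulrC divfK// gt_eqF.
pose V := U + `|l| + 1.
have V0 : 0 < V by rewrite ltr_pwDr// addr_ge0.
(* The term [j = 2] is at most [1/4], and those from 3 on sum to at most [1/2]. *)
have z34 J : (0 < J)%N -> (zeta_sum e J : R) - 1 <= 3 / 4.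
  move=> J0; rewrite /zeta_sum big_ltn ?ltnS// expr1n invr1 addrC addKr.
  have [J1|J1] := leqP J 1; first by rewrite big_geq//; lra.
  rewrite big_ltn ?ltnS//; have := @sum_inv_pow R e 2 J e1 isT => h2.
  have h1 : (2 ^- e : R) <= 4^-1.
    rewrite lef_pV2 ?posrE ?exprn_gt0// (_ : 4 = 2 ^+ 2) ?ler_weXn2l ?ler1n//.
    by rewrite -natrX.
  by apply: (@le_trans _ _ (4^-1 + 2^-1)); [exact: lerD|lra].
(* One pass contracts by [3/4]; [1/16] for [c - alpha b] and [1/16] for the truncation at [J] make
   up [7/8]. The neighbourhood shrinks with [k], as the previous bound is applied at
   [2 b, ..., J b]. *)
have key k : \forall b \near (0:R)^'+, `|l - f b| <= (7 / 8) ^+ k * V.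
  elim: k => [|k ih].
    near=> b; have b0 : 0 < b by near: b; exact: nbhs_right_gt.
    have /andP[f0 fU'] := fU b b0; rewrite mul1r (le_trans (ler_normB _ _))//.
    by rewrite /V (ger0_norm f0); lra.
  set E := (7 / 8) ^+ k * V in ih *.
  have E0 : 0 < E by rewrite mulr_gt0// exprn_gt0//; lra.
  have [J J0 hJ] := @large_nat (U + `|l|) (E / 16) (divr_gt0 E0 (ltr0n _ 16)).
  have na : \forall b \near (0:R)^'+, `|c - alpha b| <= E / 16.
    by move/cvgrPdist_le : ac; apply; rewrite divr_gt0.
  near=> b; have b0 : 0 < b by near: b; exact: nbhs_right_gt.
  have h j : (0 < j <= J)%N -> `|l - f (j%:R * b)| <= E.
    by move: j; near: b; exact: (@near_and_scales (fun c => `|l - f c| <= E) J ih).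
  have ha : `|c - alpha b| <= E / 16 by near: b.
  have := hs b J b0 J0; rewrite /= big_ltn ?ltnS// expr1n invr1 !mul1r.
  set s := \sum_(2 <= j < J.+1) _ => /andP[s1 s2].
  have hd : `|(zeta_sum e J - 1) * l - s| <= (zeta_sum e J - 1) * E.
    rewrite /s /zeta_sum big_ltn ?ltnS// expr1n invr1 [1 + _]addrC addrK !mulr_suml -sumrB.
    apply: le_trans (ler_norm_sum _ _ _) _.
    rewrite big_nat_cond [leRHS]big_nat_cond; apply: ler_sum => j /andP[/andP[j0 jJ] _].
    rewrite -mulrBr normrM ger0_norm ?invr_ge0 ?exprn_ge0// ler_wpM2l ?invr_ge0 ?exprn_ge0//.
    by apply: h; rewrite (ltnW j0) -ltnS.
  have zl : `|zeta e * l - zeta_sum e J * l| <= `|l| / J%:R.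
    rewrite -mulrBl normrM mulrC ler_wpM2l//.
    have zj1 : zeta_sum e J <= zeta e :> R := zeta_sum_le J e1.
  have zj2 : zeta e <= zeta_sum e J + J%:R^-1 :> R := zeta_le e1 J0.
  have zj3 : (0 : R) <= J%:R^-1 by rewrite invr_ge0.
    by rewrite ler_norml; apply/andP; split; lra.
  have zE : (zeta_sum e J - 1) * E <= 3 / 4 * E by rewrite ler_pM2r// z34.
  have sa : `|f b + s - alpha b| <= U / J%:R by rewrite ler_norml; apply/andP; split; lra.
  rewrite (_ : l - f b = (c - (zeta_sum e J * l)) * (-1) + ((c - alpha b) +
     (alpha b - (f b + s)) + (s - (zeta_sum e J - 1) * l))); last by ring.
  apply: le_trans (ler_normD _ _) _; rewrite normrM normrN1 mulr1 [in X in X + _]cE.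
  have h1 := ler_normD (c - alpha b + (alpha b - (f b + s))) (s - (zeta_sum e J - 1) * l).
  have h2 := ler_normD (c - alpha b) (alpha b - (f b + s)).
  rewrite exprS -mulrA -/E.
  move: hJ sa hd h1 h2; rewrite mulrDl (distrC _ s) (distrC _ (alpha b)).
  lra.
apply/cvgrPdist_le => eps eps0.
have : ((7 / 8) ^+ k * V : R) @[k --> \oo] --> (0 * V : R).
  by apply: cvgMl; apply: cvg_expr; rewrite ger0_norm; lra.
rewrite mul0r => /cvgrPdist_le/(_ _ eps0)[k _ /(_ k (leqnn k))].
rewrite /= sub0r normrN => hk.
near=> b; apply: (@le_trans _ _ ((7 / 8) ^+ k * V)); first by near: b; exact: key.
exact: le_trans (ler_norm _) hk.
Unshelve. all: by end_near. Qed.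

End scaled_series.

(** * Mean values under the Boltzmann weight *)

Section bose_sums.
Context {R : realType} {d : nat}.
Hypothesis d_gt1 : (1 < d)%N.
Let d_gt0 : (0 < d)%N := ltnW d_gt1.
Implicit Types (v : 'rV[R]_d) (b u : R).

(** Mean of a geometric variable of ratio [exp (- u)], the Bose-Einstein occupation number. *)
Definition bose u : R := (expR u - 1)^-1.

Lemma bose_gt0 u : 0 < u -> 0 < bose u.
Proof. by move=> u0; rewrite invr_gt0 subr_gt0 expR_gt1. Qed.

Lemma sum_exp_bose u J : 0 < u ->
  \sum_(1 <= j < J.+1) expR (- (j%:R * u)) = bose u * (1 - expR (- u) ^+ J).
Proof.
move=> u0; have u1 : expR u - 1 != 0 by rewrite gt_eqF// subr_gt0 expR_gt1.
elim: J => [|J ih]; first by rewrite big_geq// subrr mulr0.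
rewrite big_nat_recr//= ih [J.+1%:R * u]mulrC expRNM exprS.
have : expR u * expR (- u) = 1 by rewrite expRN divff// expR_eq0.
rewrite /bose; move: (expR (- u)) (expR u) u1 => r s s1 sr.
have s0 : s != 0 by apply: contra_eq_neq sr => ->; rewrite mul0r eq_sym oner_neq0.
have -> : r = s^-1 by apply: (mulfI s0); rewrite sr divff.
by move: (_ ^+ J) => x; field; rewrite s0.
Qed.

Definition tsum v b M : R :=
  \sum_(x <- ball1 d M | pos_primitive x) absdot v x * bose (b * (norm1 x)%:R).

Lemma norm1_gt0 (x : 'rV[int]_d) : primitive x -> (0 < norm1 x)%N.
Proof. by move=> px; rewrite lt0n norm1_eq0 primitive_neq0. Qed.

Lemma bose_norm1_gt0 b (x : 'rV[int]_d) : 0 < b -> primitive x -> 0 < b * (norm1 x)%:R.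
Proof. by move=> b0 px; rewrite mulr_gt0// ltr0n norm1_gt0. Qed.

Lemma tsum2 v b M :
  2 * tsum v b M = \sum_(x <- ball1 d M | primitive x) absdot v x * bose (b * (norm1 x)%:R).
Proof. by rewrite sum_primitive// => x; rewrite absdotN norm1N. Qed.

Lemma tsum_nd v b : 0 < b -> {homo tsum v b : n m / (n <= m)%N >-> n <= m}.
Proof.
move=> b0 m n mn; apply: (ler_sum_inj (h := id)) => //.
- move=> x _ /andP[px _]; rewrite mulr_ge0 ?absdot_ge0// ltW// bose_gt0//.
  exact: bose_norm1_gt0.
- by move=> x; rewrite !in_ball1 => xm px; rewrite (leq_trans xm mn).
Qed.

Lemma sum_psumE v b M J : 0 < b ->
  \sum_(1 <= j < J.+1) psum v (j%:R * b) M =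
  \sum_(x <- ball1 d M | primitive x)
    absdot v x * (bose (b * (norm1 x)%:R) * (1 - expR (- (b * (norm1 x)%:R)) ^+ J)).
Proof.
move=> b0; rewrite /psum exchange_big/=; apply: eq_bigr => x px.
rewrite -mulr_sumr -sum_exp_bose ?bose_norm1_gt0//; congr (_ * _).
by apply: eq_bigr => j _; rewrite mulrA.
Qed.

Lemma sum_psum_le_tsum v b M J : 0 < b ->
  \sum_(1 <= j < J.+1) psum v (j%:R * b) M <= 2 * tsum v b M.
Proof.
move=> b0; rewrite sum_psumE// tsum2; apply: ler_sum => x px.
rewrite ler_wpM2l ?absdot_ge0//; apply: ler_piMr.
  by rewrite ltW// bose_gt0// bose_norm1_gt0.
by rewrite lerBlDr lerDl exprn_ge0// expR_ge0.
Qed.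

Lemma cvg_sum_psum v b M : 0 < b ->
  \sum_(1 <= j < J.+1) psum v (j%:R * b) M @[J --> \oo] --> 2 * tsum v b M.
Proof.
move=> b0; under eq_cvg do rewrite sum_psumE//.
rewrite tsum2; apply: cvg_big => [|x px]; first exact: add_continuous.
have u0 := bose_norm1_gt0 b0 px; set u := b * _ in u0 *.
apply: cvgMr.
suff : bose u * (1 - expR (- u) ^+ J) @[J --> \oo] --> bose u * (1 - 0) by rewrite subr0 mulr1.
apply: cvgMr; apply: cvgB; first exact: cvg_cst.
by apply: cvg_expr; rewrite ger0_norm ?expR_ge0// expR_lt1 oppr_lt0.
Qed.

Lemma sum_plimE v b a M : 0 < b -> (0 < a)%N ->
  \sum_(a <= j < M) j%:R ^- d.+1 * nplim v (j%:R * b) =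
  b ^+ d.+1 * \sum_(a <= j < M) plim v (j%:R * b).
Proof.
move=> b0 a0; rewrite mulr_sumr big_nat_cond [RHS]big_nat_cond.
apply: eq_bigr => j /andP[/andP[j0 _] _]; rewrite /nplim exprMn mulrA mulKf//.
by rewrite expf_neq0// pnatr_eq0 -lt0n (leq_trans a0).
Qed.

Lemma tsum_upper v (U : R) b J M : (forall c, 0 < c -> nplim v c <= U) ->
  0 < b -> (0 < J)%N ->
  b ^+ d.+1 * (2 * tsum v b M) <=
    \sum_(1 <= j < J.+1) j%:R ^- d.+1 * nplim v (j%:R * b) + U / J%:R.
Proof.
move=> hU b0 J0.
have U0 : 0 <= U by apply: le_trans (hU _ b0); exact: nplim_ge0.
have bd0 : 0 < b ^+ d.+1 by rewrite exprn_gt0.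
rewrite mulrC -ler_pdivlMr//; apply: (cvgr_to_le (@cvg_sum_psum v b M b0)).
near=> K; have JK : (J < K)%N by near: K; exact: nbhs_infty_gt.
rewrite ler_pdivlMr// mulrC.
apply: (@le_trans _ _ (\sum_(1 <= j < K.+1) j%:R ^- d.+1 * nplim v (j%:R * b))).
  rewrite sum_plimE// ler_pM2l// big_nat_cond [leRHS]big_nat_cond.
  apply: ler_sum => j /andP[/andP[j0 _] _].
  by rewrite psum_le_plim// mulr_gt0// ltr0n.
rewrite (@big_cat_nat _ _ _ J.+1)//=; last by rewrite ltnW.
rewrite lerD2l; apply: (@le_trans _ _ (\sum_(J.+1 <= j < K.+1) j%:R ^- d.+1 * U)).
  rewrite big_nat_cond [leRHS]big_nat_cond; apply: ler_sum => j /andP[/andP[j0 _] _].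
  rewrite ler_wpM2l ?invr_ge0 ?exprn_ge0//; apply: hU.
  by rewrite mulr_gt0// ltr0n (leq_trans _ j0).
by rewrite -mulr_suml mulrC ler_wpM2l// sum_inv_pow// ltnS ltnW.
Unshelve. all: by end_near. Qed.

Definition tlim v b : R := limn (tsum v b).

Lemma cvg_tsum v b : 0 < b -> tsum v b M @[M --> \oo] --> tlim v b.
Proof.
move=> b0; apply: nondecreasing_is_cvgn; first exact: tsum_nd.
have [U U0 hU] := nplim_bounded d_gt1 v.
have bd0 : 0 < b ^+ d.+1 by rewrite exprn_gt0.
exists ((\sum_(1 <= j < 2) j%:R ^- d.+1 * nplim v (j%:R * b) + U / 1%:R) / b ^+ d.+1 / 2) => _ [M _ <-].
by rewrite !ler_pdivlMr// mulrC [_ * 2]mulrC; exact: tsum_upper.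
Qed.

Lemma tsum_le_tlim v b M : 0 < b -> tsum v b M <= tlim v b.
Proof.
by move=> b0; apply: nondecreasing_cvgn_le; [exact: tsum_nd|apply/cvg_ex; exists (tlim v b); exact: cvg_tsum].
Qed.

(** The geometric expansion of [bose] gives [2 tlim v b = \sum_j plim v (j b)], the 2 accounting for
    the pairs [p], [- p]. No factor [j] appears in front of [plim], so the exponent is [d + 1]
    instead of [d]. *)
Lemma tlim_sandwiched v (U : R) : (forall c, 0 < c -> nplim v c <= U) ->
  sandwiched d.+1 U (nplim v) (fun b => b ^+ d.+1 * (2 * tlim v b)).
Proof.
move=> hU b J b0 J0 /=; have bd0 : 0 < b ^+ d.+1 by rewrite exprn_gt0.
have c2 : 2 * tsum v b M @[M --> \oo] --> 2 * tlim v b.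
  by apply: cvgMr; exact: cvg_tsum.
apply/andP; split.
  rewrite sum_plimE// ler_pM2l//.
  have c K : \sum_(1 <= j < K.+1) psum v (j%:R * b) M @[M --> \oo] -->
      \sum_(1 <= j < K.+1) plim v (j%:R * b).
    elim: K => [|K ih].
      rewrite big_geq//; under eq_cvg do rewrite big_geq//; exact: cvg_cst.
    rewrite big_nat_recr//=; under eq_cvg do rewrite big_nat_recr//=.
    by apply: cvgD => //; apply: cvg_psum; rewrite ?mulr_gt0// ltr0n.
  by apply: (ler_cvg_to (c J) c2); apply: nearW => M; exact: sum_psum_le_tsum.
rewrite mulrC -ler_pdivlMr//; apply: (cvgr_to_le c2); apply: nearW => M.
by rewrite ler_pdivlMr// mulrC; exact: tsum_upper.
Qed.

(** Product of [2^d / zeta d] from the passage to primitive vectors, [zeta d.+1] from the geometric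
    expansion, and [1/2] from the choice of signs. *)
Definition bose_cst : R := 2 ^+ d.-1 * zeta d.+1 / zeta d.

Lemma bose_cst_gt0 : 0 < bose_cst.
Proof.
have z1 := lt_le_trans ltr01 (@zeta_ge1 R d d_gt1).
have z2 := lt_le_trans ltr01 (@zeta_ge1 R d.+1 (ltnW d_gt1 : (1 < d.+1)%N)).
by rewrite divr_gt0// mulr_gt0// exprn_gt0.
Qed.

Lemma tlim_limit v : b ^+ d.+1 * tlim v b @[b --> (0:R)^'+] --> bose_cst * limit_h v.
Proof.
have [U U0 hU] := nplim_bounded d_gt1 v.
have l1 : nplim v b @[b --> (0:R)^'+] --> 2 ^+ d * limit_h v / zeta d.
  apply: (sandwiched_inv d_gt1 U0 _ _ (@wlim_limit R d d_gt0 v)) => [b b0|b J b0 J0].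
    by rewrite nplim_ge0// hU.
  exact: wlim_sandwich.
have l2 := sandwiched_limit (leqW d_gt1 : (1 < d.+1)%N) U0 (tlim_sandwiched hU) l1.
have -> : (fun b => b ^+ d.+1 * tlim v b) = (fun b => 2^-1 * (b ^+ d.+1 * (2 * tlim v b))).
  by apply/funext => b; field.
have -> : bose_cst * limit_h v = 2^-1 * (zeta d.+1 * (2 ^+ d * limit_h v / zeta d)).
  rewrite /bose_cst -[in 2 ^+ d](prednK d_gt0) exprS.
  have z0 : zeta d != 0 :> R by rewrite gt_eqF// (lt_le_trans ltr01 (@zeta_ge1 R d d_gt1)).
  by field.
by apply: cvgMr.
Qed.

End bose_sums.

Arguments bose_cst R d : clear implicits.

(** * The Chernoff bound for truncated geometric variables *)

Section chernoff.
Context {R : realType} {I : finType}.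
Implicit Types (f g : I -> R) (K : nat).

Definition energy K f (k : {ffun I -> 'I_K.+1}) : R := \sum_i (k i : nat)%:R * f i.

Definition partition_fun K f : R := \prod_i \sum_(a < K.+1) expR (- ((a : nat)%:R * f i)).

Definition partition_lim f : R := \prod_i (1 - expR (- f i))^-1.

Lemma sum_expR_energy K f :
  \sum_(k : {ffun I -> 'I_K.+1}) expR (- energy f k) = partition_fun K f.
Proof.
rewrite /partition_fun (bigA_distr_bigA (fun i (a : 'I_K.+1) => expR (- ((a : nat)%:R * f i))))/=.
by apply: eq_bigr => k _; rewrite /energy -sumrN expR_sum.
Qed.

Lemma sum_expR_geometric K (u : R) : 0 < u ->
  \sum_(a < K.+1) expR (- ((a : nat)%:R * u)) = (1 - expR (- u) ^+ K.+1) / (1 - expR (- u)).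
Proof.
move=> u0; have /andP[_ q1] := expRN_itv u0.
have q1' : 1 - expR (- u) != 0 by rewrite subr_eq0 gt_eqF.
apply: (mulIf q1'); rewrite divfK// -[1 - _ ^+ _]opprB subrX1 mulrC -mulNr opprB.
by congr (_ * _); apply: eq_bigr => a _; rewrite mulrC expRNM.
Qed.

Lemma partition_lim_gt0 f : (forall i, 0 < f i) -> 0 < partition_lim f.
Proof.
move=> f0; apply: prodr_gt0 => i _; rewrite invr_gt0 subr_gt0.
by have /andP[] := expRN_itv (f0 i).
Qed.

Lemma partition_fun_le K f : (forall i, 0 < f i) -> partition_fun K f <= partition_lim f.
Proof.
move=> f0; apply: ler_prod => i _; have /andP[q0 q1] := expRN_itv (f0 i).
rewrite sumr_ge0/= => [|a _]; last exact: expR_ge0.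
rewrite sum_expR_geometric// -[leRHS]mul1r ler_wpM2r ?invr_ge0 ?subr_ge0 ?(ltW q1)//.
Qed.

Lemma cvg_partition_fun f : (forall i, 0 < f i) ->
  partition_fun K f @[K --> \oo] --> partition_lim f.
Proof.
move=> f0; apply: cvg_big => [|i _]; first exact: mul_continuous.
under eq_cvg do rewrite sum_expR_geometric//.
have /andP[q0 q1] := expRN_itv (f0 i).
suff : (1 - expR (- f i) ^+ K.+1) * (1 - expR (- f i))^-1 @[K --> \oo] -->
    (1 - 0) * (1 - expR (- f i))^-1 by rewrite subr0 mul1r.
apply: cvgMl; apply: cvgB; first exact: cvg_cst.
rewrite (cvg_shiftS (fun K => expR (- f i) ^+ K)).
by apply: cvg_expr; rewrite ger0_norm.
Qed.

(** The quotient of the two geometric factors is exactly [1 + (1 - exp (- y)) * bose (f - y)], and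
    [1 - exp (- y) <= y] whatever the sign of [y]. *)
Lemma tilted_factor_le (f y : R) : 0 < f -> y < f ->
  (1 - expR (- (f - y)))^-1 <= (1 - expR (- f))^-1 * expR (y * bose (f - y)).
Proof.
move=> f0 yf; have w0 : 0 < f - y by rewrite subr_gt0.
have /andP[_ q1] := expRN_itv f0; have /andP[_ p1] := expRN_itv w0.
have q1' : 0 < 1 - expR (- f) by rewrite subr_gt0.
have p1' : 0 < 1 - expR (- (f - y)) by rewrite subr_gt0.
have e1 : 0 < expR (f - y) - 1 by rewrite subr_gt0 expR_gt1.
rewrite mulrC ler_pdivlMr//; apply: le_trans (expR_ge1Dx _).
have -> : (1 - expR (- (f - y)))^-1 * (1 - expR (- f)) = 1 + (1 - expR (- y)) * bose (f - y).
  rewrite /bose (_ : expR (- f) = expR (- (f - y)) * expR (- y)); last first.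
    by rewrite -expRD; congr expR; ring.
  have : expR (f - y) * expR (- (f - y)) = 1 by rewrite expRN divff// expR_eq0.
  move: (lt0r_neq0 p1') (lt0r_neq0 e1); move: (expR (f - y)) (expR (- (f - y))) (expR (- y)) => s r z.
  move=> r1 s1 sr; have s0 : s != 0 by apply: contra_eq_neq sr => ->; rewrite mul0r eq_sym oner_neq0.
  have rE : r = s^-1 by apply: (mulfI s0); rewrite sr divff.
  by move: r1; rewrite rE => r1; field; rewrite s1 s0/=; rewrite subr_eq0 in r1 *.
rewrite lerD2l ler_wpM2r ?(ltW (bose_gt0 w0))//.
by have := expR_ge1Dx (- y); lra.
Qed.

(** On the event, [exp (s (energy g - G))] is at least 1, and this factor turns the weight into that
    of the tilted parameters [f - s g]. The two signs of [s] give the two tails. The exponent keeps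
    the mean at the tilted parameters instead of a second-order expansion, because [tlim_limit]
    controls such means. *)
Lemma chernoff K f g (s G : R) : (forall i, 0 < f i) -> (forall i, s * g i < f i) ->
  \sum_(k : {ffun I -> 'I_K.+1} | 0 <= s * (energy g k - G)) expR (- energy f k) <=
  partition_lim f * expR (- (s * G) + \sum_i s * g i * bose (f i - s * g i)).
Proof.
move=> f0 sgf.
apply: (@le_trans _ _ (\sum_(k : {ffun I -> 'I_K.+1})
    expR (- (s * G)) * expR (- energy (fun i => f i - s * g i) k))).
  rewrite [leRHS](bigID (fun k : {ffun I -> 'I_K.+1} => 0 <= s * (energy g k - G)))/=.
  apply: ler_wpDr; first by apply: sumr_ge0 => k _; rewrite mulr_ge0 ?expR_ge0.
  apply: ler_sum => k hk; rewrite -expRD ler_expR.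
  have -> : energy (fun i => f i - s * g i) k = energy f k - s * energy g k.
    by rewrite /energy mulr_sumr -sumrB; apply: eq_bigr => i _; ring.
  by move: hk; rewrite mulrBr; lra.
rewrite -mulr_sumr sum_expR_energy expRD mulrCA ler_wpM2l ?expR_ge0//.
apply: le_trans (partition_fun_le _ _) _ => [i|]; first by rewrite subr_gt0.
rewrite /partition_lim expR_sum -big_split/=; apply: ler_prod => i _.
rewrite tilted_factor_le// andbT invr_ge0 subr_ge0.
by have /andP[_ /ltW] : 0 <= expR (- (f i - s * g i)) < 1 by rewrite expRN_itv// subr_gt0.
Qed.

End chernoff.

(** * Exponential concentration of the width in one direction *)

Section deviations.
Context {R : realType} {d : nat}.
Hypothesis d_gt1 : (1 < d)%N.
Implicit Types (v : 'rV[R]_d) (b : R).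

Definition pos_prims M : {fset 'rV[int]_d} := [fset x in ball1 d M | pos_primitive x]%fset.

Definition weight b M (i : pos_prims M) : R := b * (norm1 (val i))%:R.

Definition slope v M (i : pos_prims M) : R := absdot v (val i).

Lemma pos_primsP M (i : pos_prims M) : pos_primitive (val i).
Proof. by have := fsvalP i; rewrite !inE => /andP[]. Qed.

Lemma weight_gt0 b M (i : pos_prims M) : 0 < b -> 0 < weight b i.
Proof. by move=> b0; apply: bose_norm1_gt0 => //; have /andP[] := pos_primsP i. Qed.

Lemma tsumE v b M : tsum v b M = \sum_(i : pos_prims M) slope v i * bose (weight b i).
Proof.
rewrite /tsum /slope /weight -(big_seq_fsetE _ _ xpredT (fun x => absdot v x * bose (b * (norm1 x)%:R))).
rewrite -[LHS]big_filter; apply: perm_big; apply: uniq_perm.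
- exact: filter_uniq (fset_uniq _).
- exact: fset_uniq.
- by move=> x; rewrite mem_filter !inE andbC.
Qed.

Lemma ler_bose (u w : R) : 0 < u -> u <= w -> bose w <= bose u.
Proof.
move=> u0 uw; rewrite /bose lef_pV2 ?posrE ?subr_gt0 ?expR_gt1//; last exact: lt_le_trans uw.
by rewrite lerB// ler_expR.
Qed.

(** [D * limit_h v] is the asymptotic mean of the [slope] energy, and [D * b], of order [b^(-d)],
    the scale of the exponent. *)
Definition tail_bound v (eps c b : R) M K : Prop :=
  let D := bose_cst R d / b ^+ d.+1 in
  \sum_(k : {ffun pos_prims M -> 'I_K.+1} | D * (limit_h v + eps) <= energy (@slope v M) k)
     expR (- energy (@weight b M) k) <= partition_lim (@weight b M) * expR (- (c * (D * b))) /\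
  \sum_(k : {ffun pos_prims M -> 'I_K.+1} | energy (@slope v M) k <= D * (limit_h v - eps))
     expR (- energy (@weight b M) k) <= partition_lim (@weight b M) * expR (- (c * (D * b))).

(** The tilt is [sig * b] or its opposite, with [sig] so small that no weight changes by more than
    the relative amount [x]. Tilted means are then controlled by [tsum] at [(1 - x) b], at most
    [D (h + eps / 2)], and at [(1 + x) b], at least [D (h - eps / 2)]; the remaining half of [eps]
    gives the rate. [M0] serves the lower tail, where [tsum] must be close to [tlim] from below. *)
Lemma deviation v (eps : R) : 0 < eps -> exists2 c : R, 0 < c &
  \forall b \near (0:R)^'+, exists M0, forall M K, (M0 <= M)%N -> tail_bound v eps c b M K.
Proof.
move=> eps0; pose h := limit_h v; pose C := bose_cst R d.
have h0 : 0 <= h by apply: limit_h_ge0; exact: ltnW.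
have C0 : 0 < C := bose_cst_gt0 d_gt1.
(* By [bern], rescaling [b] by [1 - x] then costs at most [(d + 1) x (h + eps / 2) = eps / 4]. *)
pose x := eps / (4 * d.+1%:R * (h + eps / 2)).
have he0 : 0 < h + eps / 2 by lra.
have x0 : 0 < x by rewrite divr_gt0// !mulr_gt0.
have xE : d.+1%:R * x * (h + eps / 2) = eps / 4.
  by rewrite /x; field; rewrite ?pnatr_eq0// gt_eqF//= ; lra.
have x1 : x < 1.
  rewrite /x ltr_pdivrMr ?mulr_gt0// mul1r.
  have d1 : (1 : R) <= d.+1%:R by rewrite ler1n.
  by apply: (@lt_le_trans _ _ (4 * 1 * (h + eps / 2))); [lra|rewrite ler_pM2r// ler_pM2l].
pose kap := 1 + l1norm v.
have kap0 : 0 < kap by have := l1norm_ge0 v; rewrite /kap; lra.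
pose sig := x / kap.
have sig0 : 0 < sig by rewrite divr_gt0.
have sk : sig * kap = x by rewrite divfK// gt_eqF.
exists (sig * eps / 2); first by rewrite divr_gt0// mulr_gt0.
pose e1 := C * eps / 8.
have e10 : 0 < e1 by rewrite divr_gt0// mulr_gt0.
have tl := @tlim_limit R d d_gt1 v.
have tl' : \forall b \near (0:R)^'+, `|C * h - b ^+ d.+1 * tlim v b| <= e1.
  by move/cvgrPdist_le : tl; apply.
have bern : 1 - (1 - x) ^+ d.+1 <= d.+1%:R * x.
  have := @ler_subX R 1 (1 - x) d; rewrite !expr1n mulr1 => /(_ _ _).
  by rewrite subr_ge0 (ltW x1) (_ : 1 - (1 - x) = x); [apply => //; lra|lra].
have x1' : 0 < 1 - x by lra.
have x2' : 0 < 1 + x by lra.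
near=> b; have b0 : 0 < b by near: b; exact: nbhs_right_gt.
have bd0 : 0 < b ^+ d.+1 by rewrite exprn_gt0.
have t1 : `|C * h - ((1 - x) * b) ^+ d.+1 * tlim v ((1 - x) * b)| <= e1.
  by near: b; exact: (@near_scale _ (fun c => `|C * h - c ^+ d.+1 * tlim v c| <= e1) _ x1' tl').
have t2 : `|C * h - ((1 + x) * b) ^+ d.+1 * tlim v ((1 + x) * b)| <= e1.
  by near: b; exact: (@near_scale _ (fun c => `|C * h - c ^+ d.+1 * tlim v c| <= e1) _ x2' tl').
have b20 : 0 < (1 + x) * b by rewrite mulr_gt0.
have [M0 _ hM0] : \forall M \near \oo, `|tlim v ((1 + x) * b) - tsum v ((1 + x) * b) M| <= e1 / b ^+ d.+1.
  by have /cvgrPdist_le := @cvg_tsum R d d_gt1 v _ b20; apply; rewrite divr_gt0.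
have sb0 : 0 < sig * b by rewrite mulr_gt0.
have b10 : 0 < (1 - x) * b by rewrite mulr_gt0.
exists M0 => M K M0M; rewrite /tail_bound; set D := bose_cst R d / b ^+ d.+1.
have D0 : 0 < D by rewrite divr_gt0.
have w0 (i : pos_prims M) : 0 < weight b i by exact: weight_gt0.
have sl (i : pos_prims M) : b * slope v i <= kap * weight b i.
  rewrite /slope /weight mulrCA ler_pM2l//.
  apply: le_trans (absdot_le_norm1 _ _) _; rewrite ler_wpM2r// /kap; lra.
have sg0 (i : pos_prims M) : 0 <= sig * b * slope v i.
  by apply: mulr_ge0; [exact: ltW|exact: absdot_ge0].
have sl' (i : pos_prims M) : sig * b * slope v i <= x * weight b i.
  by have := ler_wpM2l (ltW sig0) (sl i); rewrite !mulrA sk.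
have Db : D * b ^+ d.+1 = C by rewrite divfK// gt_eqF.
rewrite /=; split.
  have lt (i : pos_prims M) : sig * b * slope v i < weight b i.
    by apply: le_lt_trans (sl' i) _; rewrite gtr_pMl.
  have sgn (k : {ffun pos_prims M -> 'I_K.+1}) : (D * (limit_h v + eps) <= energy (@slope v M) k) =
      (0 <= sig * b * (energy (@slope v M) k - D * (limit_h v + eps))).
    by rewrite pmulr_rge0// subr_ge0.
  under eq_bigl => k do rewrite sgn.
  apply: le_trans (chernoff _ _ w0 lt) _.
  apply: ler_wpM2l; first by rewrite ltW// partition_lim_gt0.
  rewrite ler_expR.
  apply: (@le_trans _ _ (- (sig * b * (D * (h + eps))) + sig * b * tlim v ((1 - x) * b))).
    rewrite lerD2l; apply: (@le_trans _ _ (sig * b * tsum v ((1 - x) * b) M)); last first.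
      by rewrite ler_pM2l// tsum_le_tlim.
    rewrite tsumE mulr_sumr; apply: ler_sum => i _; rewrite [leRHS]mulrA; apply: ler_wpM2l; first exact: sg0.
    apply: ler_bose; first by rewrite mulr_gt0 ?mulr_gt0// ltr0n norm1_gt0//; have /andP[] := pos_primsP i.
    by have := sl' i; rewrite /weight; lra.
  have tb : tlim v ((1 - x) * b) <= D * (h + eps / 2).
    have p0 : 0 < (1 - x) ^+ d.+1 by rewrite exprn_gt0.
    rewrite -(ler_pM2l (mulr_gt0 p0 bd0)) -exprMn.
    apply: (@le_trans _ _ (C * h + e1)).
      by move: t1; rewrite ler_norml => /andP[]; lra.
    rewrite exprMn (_ : _ * (D * _) = (1 - x) ^+ d.+1 * (D * b ^+ d.+1) * (h + eps / 2)); last by ring.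
    rewrite Db; have : (1 - d.+1%:R * x) * (h + eps / 2) <= (1 - x) ^+ d.+1 * (h + eps / 2).
      by rewrite ler_pM2r//; lra.
    rewrite mulrBl mul1r xE => hh; rewrite [(1 - x) ^+ _ * C]mulrC -[leRHS]mulrA.
    apply: le_trans (ler_wpM2l (ltW C0) hh); rewrite /e1 -[C * eps / 8]mulrA -mulrDr ler_pM2l//; lra.
  have : sig * b * tlim v ((1 - x) * b) <= sig * b * (D * (h + eps / 2)) by rewrite ler_pM2l.
  by rewrite !mulrDr; lra.
have sgn (k : {ffun pos_prims M -> 'I_K.+1}) : (energy (@slope v M) k <= D * (limit_h v - eps)) =
    (0 <= - (sig * b) * (energy (@slope v M) k - D * (limit_h v - eps))).
  by rewrite mulNr oppr_ge0 pmulr_rle0// subr_le0.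
under eq_bigl => k do rewrite sgn.
have lt (i : pos_prims M) : - (sig * b) * slope v i < weight b i.
  by apply: le_lt_trans (w0 i); rewrite mulNr oppr_le0.
apply: le_trans (chernoff _ _ w0 lt) _.
apply: ler_wpM2l; first by rewrite ltW// partition_lim_gt0.
  rewrite ler_expR.
apply: (@le_trans _ _ (sig * b * (D * (h - eps)) - sig * b * tsum v ((1 + x) * b) M)).
  rewrite mulNr opprK lerD2l tsumE mulr_sumr -sumrN; apply: ler_sum => i _.
  rewrite !mulNr lerN2 [leLHS]mulrA; apply: ler_wpM2l; first exact: sg0.
  apply: ler_bose.
    by rewrite opprK; apply: lt_le_trans (w0 i) _; rewrite lerDl.
  by have := sl' i; rewrite opprK /weight; lra.
have tb : D * (h - eps / 2) <= tsum v ((1 + x) * b) M.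
  have tl0 : 0 <= tlim v ((1 + x) * b).
    apply: le_trans (tsum_le_tlim d_gt1 v 0 b20); apply: sumr_ge0 => y /andP[py _].
    by rewrite mulr_ge0 ?absdot_ge0// ltW// bose_gt0// bose_norm1_gt0.
  pose X := b ^+ d.+1 * tlim v ((1 + x) * b).
  have X0 : 0 <= X by rewrite mulr_ge0// ltW.
  have hX : C * h - e1 <= (1 + x) ^+ d.+1 * X.
    have t2' : ((1 + x) * b) ^+ d.+1 * tlim v ((1 + x) * b) = (1 + x) ^+ d.+1 * X.
      by rewrite exprMn -mulrA.
    by move: t2; rewrite t2' ler_norml => /andP[_]; lra.
  have Q0 : 0 <= (1 - x) ^+ d.+1 by rewrite exprn_ge0// ltW.
  have Q1 : (1 - x) ^+ d.+1 <= 1 by rewrite exprn_ile1//; lra.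
  (* This lets [(1 - x)^(d+1)] replace the inverse of [(1 + x)^(d+1)], so that [bern] serves both
     tails. *)
  have QP : (1 - x) ^+ d.+1 * (1 + x) ^+ d.+1 <= 1.
    rewrite -exprMn exprn_ile1// ?mulr_ge0 ?ltW//; nra.
  have hX2 : C * h - C * eps / 4 - e1 <= X.
    apply: (@le_trans _ _ ((1 - x) ^+ d.+1 * (1 + x) ^+ d.+1 * X)); last by rewrite ler_piMl.
    apply: (@le_trans _ _ ((1 - x) ^+ d.+1 * (C * h - e1))); last by rewrite -mulrA ler_wpM2l.
    have Ch0 : 0 <= C * h by rewrite mulr_ge0// ltW.
    have q1 : (1 - d.+1%:R * x) * (C * h) <= (1 - x) ^+ d.+1 * (C * h) by rewrite ler_wpM2r//; lra.
    have q2 : (1 - x) ^+ d.+1 * e1 <= e1 by rewrite ler_piMl// ltW.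
    have q3 : C * (d.+1%:R * x * h) <= C * (eps / 4).
      rewrite ler_pM2l// -xE; apply: ler_wpM2l; [exact: mulr_ge0 (ler0n _ _) (ltW x0)|lra].
    have q4 : (1 - d.+1%:R * x) * (C * h) = C * h - C * (d.+1%:R * x * h) by clearbody C h; ring.
    have q5 : C * eps / 4 = C * (eps / 4) by rewrite mulrA.
    by rewrite mulrBr; move: q1 q2 q3; rewrite q4 q5; lra.
  have := hM0 M M0M; rewrite /= ler_norml => /andP[_]; rewrite ler_pdivlMr// mulrBl => hM.
  rewrite -(ler_pM2r bd0) mulrAC Db.
  move: hM; rewrite [tlim _ _ * _]mulrC -/X; move: hX2; rewrite /e1 mulrBr; lra.
have : sig * b * (D * (h - eps / 2)) <= sig * b * tsum v ((1 + x) * b) M by rewrite ler_pM2l.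
by rewrite !mulrBr; lra.
Unshelve. all: by end_near. Qed.

End deviations.

Arguments pos_prims d M : clear implicits.

(** * Zonotopes as affine images of cubes: support function and vertices *)

Section zonotope_sets.
Context {R : realType} {d : nat}.
Implicit Types (c v w x y : 'rV[R]_d) (P : set 'rV[R]_d).

Lemma dotDr x y v : dot v (x + y) = dot v x + dot v y.
Proof. by rewrite dotC dotDl !(dotC v). Qed.

Lemma dotZr (s : R) x v : dot v (s *: x) = s * dot v x.
Proof. by rewrite dotC dotZl dotC. Qed.

Lemma dotNr x v : dot v (- x) = - dot v x.
Proof. by rewrite dotC dotNl dotC. Qed.

Lemma dot_ge0 x : 0 <= dot x x.
Proof. by apply: sumr_ge0 => i _; rewrite -expr2 sqr_ge0. Qed.

Lemma dot_eq0 x : (dot x x == 0) = (x == 0).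
Proof.
rewrite /dot psumr_eq0; last by move=> i _; rewrite -expr2 sqr_ge0.
apply/allP/eqP => [x0|-> i _]; last by rewrite /= mxE mulr0 eqxx.
apply/rowP => i; rewrite mxE; apply/eqP.
by have := x0 i (mem_index_enum i); rewrite mulf_eq0 orbb.
Qed.

Lemma dot_gt0 x : x != 0 -> 0 < dot x x.
Proof. by move=> x0; rewrite lt_neqAle dot_ge0 eq_sym dot_eq0 x0. Qed.

Section zset.
Context {I : finType}.
Implicit Types (a : I -> 'rV[R]_d) (s : I -> R).

Definition zset c a : set 'rV[R]_d :=
  [set c + \sum_i s i *: a i | s in [set s : I -> R | forall i, 0 <= s i <= 1]].

(** A corner maximising [w]; generators orthogonal to [w] are left out, which selects one maximiser
    among several. *)
Definition zvert c a w : 'rV[R]_d := c + \sum_(i | 0 < dot (a i) w) a i.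

Lemma zvertE c a w : zvert c a w = c + \sum_i (0 < dot (a i) w)%R%:R *: a i.
Proof.
by congr (_ + _); rewrite big_mkcond; apply: eq_bigr => i _; case: ifP; rewrite ?scale1r ?scale0r.
Qed.

Lemma zset_vert c a w : zset c a (zvert c a w).
Proof.
exists (fun i => (0 < dot (a i) w)%R%:R); last by rewrite zvertE.
by move=> i /=; case: (_ < _); rewrite !lexx !ler01.
Qed.

Lemma zset_base c a : zset c a c.
Proof.
exists (fun=> 0) => [i|]; first by rewrite lexx ler01.
by rewrite big1 ?addr0// => i _; rewrite scale0r.
Qed.

Lemma zset_convex c a x y (t : R) : zset c a x -> zset c a y -> 0 <= t <= 1 ->
  zset c a (t *: x + (1 - t) *: y).
Proof.
move=> [s /= s01 <-] [s' /= s'01 <-] /andP[t0 t1].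
exists (fun i => t * s i + (1 - t) * s' i) => [i /=|].
  by have /andP[? ?] := s01 i; have /andP[? ?] := s'01 i; apply/andP; split; nra.
rewrite !scalerDr addrACA -scalerDl subrKC scale1r !scaler_sumr -big_split/=.
by congr (_ + _); apply: eq_bigr => i _; rewrite scalerDl !scalerA.
Qed.

Definition zsupp c a w : R := dot c w + \sum_i Num.max 0 (dot (a i) w).

Lemma zsupp_vert c a w : dot (zvert c a w) w = zsupp c a w.
Proof.
rewrite zvertE dotDl dot_suml; congr (_ + _); apply: eq_bigr => i _.
by rewrite dotZl maxEle; case: ltgtP => [|_|<-]; rewrite ?mul1r ?mul0r.
Qed.

Lemma term_le_max (s x : R) : 0 <= s <= 1 -> s * x <= Num.max 0 x.
Proof.
move=> /andP[s0 s1]; rewrite le_max; have [x0|x0] := leP x 0.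
  by rewrite mulr_ge0_le0.
by rewrite ler_piMl ?orbT// ltW.
Qed.

Lemma zsupp_ge c a w x : zset c a x -> dot x w <= zsupp c a w.
Proof.
move=> [s /= s01 <-]; rewrite dotDl dot_suml lerD2l; apply: ler_sum => i _.
by rewrite dotZl term_le_max.
Qed.

(** Each term is at most [max 0 (dot (a i) w)], so equality of the sums forces equality termwise,
    and genericity of [w] then determines the coefficient of each nonzero generator. *)
Lemma zsupp_eq c a w x : (forall i, a i != 0 -> dot (a i) w != 0) ->
  zset c a x -> dot x w = zsupp c a w -> x = zvert c a w.
Proof.
move=> aw [s /= s01 <-]; rewrite zvertE dotDl dot_suml => /addrI e'.
have e : \sum_i s i * dot (a i) w = \sum_i Num.max 0 (dot (a i) w).
  by rewrite -e'; apply: eq_bigr => i _; rewrite dotZl.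
congr (_ + _); apply: eq_bigr => i _.
have [->|ai0] := eqVneq (a i) 0; first by rewrite !scaler0.
have ei : s i * dot (a i) w = Num.max 0 (dot (a i) w).
  apply/eqP; rewrite -subr_eq0; move/eqP: e; rewrite -subr_eq0 -sumrB.
  rewrite -oppr_eq0 -sumrN psumr_eq0; last first.
    by move=> j _; rewrite opprB subr_ge0 term_le_max.
  by move=> /allP /(_ i (mem_index_enum i)); rewrite /= oppr_eq0.
congr (_ *: _); move: ei; have := aw i ai0.
have [x0|x0|//] := ltgtP (dot (a i) w) 0 => _.
  by move=> /eqP; rewrite mulf_eq0 (lt_eqF x0) orbF => /eqP ->.
by rewrite -[RHS]mul1r => /(mulIf (lt0r_neq0 x0)).
Qed.

Lemma zvert_vertex c a w : (forall i, a i != 0 -> dot (a i) w != 0) ->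
  vertices (zset c a) (zvert c a w).
Proof.
move=> aw; split; first exact: zset_vert.
move=> y z s Py Pz /andP[s0 s1] e.
have yw := zsupp_ge w Py; have zw := zsupp_ge w Pz.
have : dot (zvert c a w) w = (1 - s) * dot y w + s * dot z w by rewrite {1}e dotDl !dotZl.
rewrite zsupp_vert => ew.
split; apply: zsupp_eq => //; nra.
Qed.

Lemma zset_reindex (J : finType) (h : J -> I) c a : bijective h ->
  zset c a = [set c + \sum_j s j *: a (h j) | s in [set s : J -> R | forall j, 0 <= s j <= 1]].
Proof.
move=> [h' hK h'K]; have bh : {on xpredT, bijective h} by exists h' => ? _; rewrite ?hK ?h'K.
apply/seteqP; split => x [s /= s01 <-].
  exists (s \o h) => [j /=|]; first exact: s01.
  by rewrite [in RHS](reindex h).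
exists (s \o h') => [j /=|]; first exact: s01.
by rewrite (reindex h)//=; congr (_ + _); apply: eq_bigr => j _; rewrite hK.
Qed.

End zset.

Lemma big_minkowskiE k (A : 'I_k -> set 'rV[R]_d) :
  \big[minkowski_sum/[set 0]]_(i < k) A i =
  [set \sum_i x i | x in [set x : 'I_k -> 'rV[R]_d | forall i, A i (x i)]].
Proof.
elim: k A => [|k ih] A.
  rewrite big_ord0; apply/seteqP; split => [x /= ->|_ [x _ <-]]; last by rewrite big_ord0.
  by exists (fun=> 0) => [[]//|]; rewrite big_ord0.
rewrite big_ord_recl ih; apply/seteqP; split => [_ [x Ax [_ [y /= Ay <-] <-]]|_ [x /= Ax <-]].
  exists (fun i => if unlift ord0 i is Some j then y j else x).
    by move=> i /=; case: unliftP => [j ->|->].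
  rewrite big_ord_recl unlift_none; congr (_ + _); apply: eq_bigr => i _.
  by rewrite liftK.
rewrite big_ord_recl; exists (x ord0) => //.
by exists (\sum_(i < k) x (lift ord0 i)) => //; exists (fun i => x (lift ord0 i)) => // i /=; exact: Ax.
Qed.

Lemma zonotopeP P : zonotope P <-> exists k c (a : 'I_k -> 'rV[R]_d), P = zset c a.
Proof.
split=> [[k [c [a [b ->]]]]|[k [c [a ->]]]].
  exists k, (c + \sum_i a i), (fun i => b i - a i); rewrite big_minkowskiE.
  have e (s : 'I_k -> R) : c + \sum_i a i + \sum_i s i *: (b i - a i) =
      c + \sum_i ((1 - s i) *: a i + s i *: b i).
    rewrite -addrA -big_split/=; congr (_ + _); apply: eq_bigr => i _.
    by apply/rowP => j; rewrite !mxE; ring.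
  apply/seteqP; split => [_ [_ [x /= Ax <-] <-]|_ [s /= s01 <-]].
    have /choice[s hs] : forall i, exists s, 0 <= s <= 1 /\ (1 - s) *: a i + s *: b i = x i.
      by move=> i; have [s /= s01 sx] := Ax i; exists s; split=> //; move: s01; rewrite ?in_itv.
    exists s => [i /=|]; first by case: (hs i).
    by rewrite e; congr (_ + _); apply: eq_bigr => i _; case: (hs i).
  rewrite e; exists (\sum_i ((1 - s i) *: a i + s i *: b i)) => //.
  exists (fun i => (1 - s i) *: a i + s i *: b i) => // i /=.
  by exists (s i) => //; rewrite /= in_itv/=.
exists k, c, (fun=> 0), a; rewrite big_minkowskiE.
apply/seteqP; split => [_ [s /= s01 <-]|_ [_ [x /= Ax <-] <-]].
  exists (\sum_i s i *: a i) => //; exists (fun i => s i *: a i) => // i /=.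
  by exists (s i); rewrite ?scaler0 ?add0r//= in_itv/=.
have /choice[s hs] : forall i, exists s, 0 <= s <= 1 /\ s *: a i = x i.
  move=> i; have [s /= s01 sx] := Ax i; exists s; split.
    by move: s01; rewrite ?in_itv.
  by move: sx; rewrite scaler0 add0r.
exists s => [i /=|]; first by case: (hs i).
by congr (_ + _); apply: eq_bigr => i _; case: (hs i).
Qed.

Lemma zonotope_zset (I : finType) c (a : I -> 'rV[R]_d) : zonotope (zset c a).
Proof.
apply/zonotopeP; exists #|I|, c, (a \o enum_val).
by rewrite (zset_reindex c a (enum_val_bij I)).
Qed.

End zonotope_sets.

(** * Generic directions and directions exposing an edge *)

Section generic_directions.
Context {R : realType} {d : nat} {I : finType}.
Implicit Types (a : I -> 'rV[R]_d) (w : 'rV[R]_d).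

(** On the moment curve [(1, s, s^2, ...)] each [dot (a i) w] is a nonzero polynomial in [s], and
    their product has finitely many roots. *)
Lemma generic_direction a : (forall i, a i != 0) -> exists w, forall i, dot (a i) w != 0.
Proof.
move=> a0; pose p i : {poly R} := \poly_(j < d) (if insub j is Some j' then a i 0 j' else 0).
have p0 i : p i != 0.
  apply: contraNneq (a0 i) => /polyP pi; apply/eqP/rowP => j; rewrite mxE.
  by have := pi j; rewrite coef_poly ltn_ord coef0 valK.
have pw i (s : R) : dot (a i) (\row_j s ^+ j) = (p i).[s].
  rewrite horner_poly; apply: eq_bigr => j _; by rewrite valK mxE.
pose q := \prod_i p i.
have q0 : q != 0 by apply/prodf_neq0.
have [s qs] : exists s : R, q.[s] != 0.
  apply: contrapT => /forallNP qs.
  pose rs := [seq (k%:R : R) | k <- iota 0 (size q)].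
  have allr : all (root q) rs.
    by apply/allP => x _; rewrite rootE; apply/negPn/negP => hx; exact: (qs x).
  have ur : uniq rs.
    by rewrite map_inj_uniq ?iota_uniq//; move=> x y /eqP; rewrite eqr_nat => /eqP.
  by have := max_poly_roots q0 allr ur; rewrite size_map size_iota ltnn.
exists (\row_j s ^+ j) => i; rewrite pw.
by move: qs; rewrite horner_prod => /prodf_neq0; apply.
Qed.

Definition parallel (a0 x : 'rV[R]_d) := x == (dot x a0 / dot a0 a0) *: a0.

(** A vector generic for the generators projected along [a0] is itself projected; the projection is
    self-adjoint, so [w] is generic within the hyperplane orthogonal to [a0]. The number [e] makes
    [w + e a0] and [w - e a0] give the same sign to each generator not parallel to [a0]. *)
Lemma edge_direction a (a0 : 'rV[R]_d) : a0 != 0 -> exists w (e : R), 0 < e /\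
  forall i, (parallel a0 (a i) -> dot (a i) w = 0) /\
    (~~ parallel a0 (a i) -> e * `|dot (a i) a0| < `|dot (a i) w|).
Proof.
move=> a00; have aa := dot_gt0 a00.
pose pr (x : 'rV[R]_d) := x - (dot x a0 / dot a0 a0) *: a0.
have prd x w : dot (pr x) w = dot x (pr w).
  by rewrite /pr dotBl dotZl dotDr dotNr dotZr (dotC a0 w); ring.
(* Generators parallel to [a0] project to 0; [a0] stands in for them to keep the family nonzero. *)
pose u i := if parallel a0 (a i) then a0 else pr (a i).
have [w hw] : exists w, forall i, dot (u i) w != 0.
  apply: generic_direction => i; rewrite /u; case: ifPn => //; by rewrite /parallel -subr_eq0.
have hpr i : parallel a0 (a i) -> dot (a i) (pr w) = 0.
  by move=> pi; rewrite -prd /pr {1}(eqP pi) subrr dot0l.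
have hnp i : ~~ parallel a0 (a i) -> dot (a i) (pr w) != 0.
  by move=> pi; have := hw i; rewrite /u (negbTE pi) prd.
pose S := \sum_i `|dot (a i) a0| / `|dot (a i) (pr w)|.
have S0 : 0 <= S by apply: sumr_ge0 => i _; rewrite divr_ge0.
exists (pr w), (1 + S)^-1; split; first by rewrite invr_gt0; lra.
move=> i; split; first exact: hpr.
move=> pi; rewrite mulrC ltr_pdivrMr; last by lra.
rewrite -ltr_pdivrMl ?normr_gt0 ?hnp// mulrC; apply: (@le_lt_trans _ _ S); last by lra.
by rewrite /S (bigD1 i)//= lerDl sumr_ge0// => j _; rewrite divr_ge0.
Qed.

End generic_directions.

(** * Lattice zonotopes: integrality of edges, grouping of parallel generators *)

Section lattice_zonotopes.
Context {R : realType} {d : nat}.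
Implicit Types (c x w : 'rV[R]_d) (P : set 'rV[R]_d) (p q z : 'rV[int]_d) (n : nat).

Local Notation toR := (map_mx (intr : int -> R)).

Section lattice.
Variable n : nat.
Local Notation lat := (@scaled_lattice R d n).

Lemma lat0 : lat 0.
Proof. by exists 0; rewrite // map_mx0 scaler0. Qed.

Lemma latN x : lat x -> lat (- x).
Proof. by move=> [z _ <-]; exists (- z); rewrite // map_mxN scalerN. Qed.

Lemma latD x y : lat x -> lat y -> lat (x + y).
Proof. by move=> [z _ <-] [z' _ <-]; exists (z + z'); rewrite // map_mxD scalerDr. Qed.

Lemma latB x y : lat x -> lat y -> lat (x - y).
Proof. by move=> lx ly; apply: latD => //; exact: latN. Qed.

Lemma lat_sum (I : Type) (r : seq I) (Q : pred I) (F : I -> 'rV[R]_d) :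
  (forall i, Q i -> lat (F i)) -> lat (\sum_(i <- r | Q i) F i).
Proof. by move=> h; apply: big_ind => //; [exact: lat0|exact: latD]. Qed.

Lemma lat_mult (k : nat) p : lat ((k%:R / n%:R) *: toR p).
Proof. by exists (k%:Z *: p); rewrite // map_mxZ scalerA mulrC. Qed.

(** At an extreme point a nonzero generator has coefficient 0 or 1, since otherwise the point is the
    midpoint of two others. *)
Lemma vertices_zset_lat (I : finType) c (a : I -> 'rV[R]_d) :
  lat c -> (forall i, lat (a i)) -> vertices (zset c a) `<=` lat.
Proof.
move=> lc la x [[s /= s01 xE] ext].
suff h i : s i *: a i = 0 \/ s i *: a i = a i.
  rewrite -xE; apply: latD => //; apply: lat_sum => i _; case: (h i) => -> //; exact: lat0.
have /andP[s0 s1] := s01 i.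
have [->|si0] := eqVneq (s i) 0; first by left; rewrite scale0r.
have [->|si1] := eqVneq (s i) 1; first by right; rewrite scale1r.
left; pose e := Num.min (s i) (1 - s i).
have e0 : 0 < e.
  by rewrite lt_min; apply/andP; split; rewrite ?subr_gt0 lt_neqAle ?si1 ?s1// eq_sym si0.
have es : e <= s i by rewrite ge_min lexx.
have e1 : e <= 1 - s i by rewrite ge_min lexx orbT.
have mv (t : R) : - e <= t <= e -> zset c a (x + t *: a i).
  move=> /andP[t0 t1]; exists (fun j => if j == i then s i + t else s j).
    by move=> j /=; case: eqP => // _; apply/andP; split; lra.
  rewrite -xE (bigD1 i)//= eqxx [in RHS](bigD1 i)//= scalerDl -!addrA; congr (_ + (_ + _)).
  rewrite addrC; congr (_ + _); apply: eq_bigr => j ji; by rewrite (negbTE ji).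
have [] := ext (x + e *: a i) (x + (- e) *: a i) 2^-1.
- by apply: mv; rewrite lexx andbT; lra.
- by apply: mv; rewrite lexx/=; lra.
- by apply/andP; split; lra.
- by apply/rowP => j; rewrite !mxE; field.
move=> h _; have /eqP : e *: a i = 0 by apply: (addrI x); rewrite addr0.
by rewrite scaler_eq0 gt_eqF//= => /eqP ->; rewrite scaler0.
Qed.

(** A single generator of a lattice zonotope need not be a lattice vector, as an edge may be cut
    into parallel pieces; the whole edge is one. The directions [w + e a0] and [w - e a0] select its
    two endpoints, whose difference is the signed sum of the parallel generators. *)
Lemma edge_lattice (I : finType) c (a : I -> 'rV[R]_d) (a0 : 'rV[R]_d) :
  vertices (zset c a) `<=` lat -> a0 != 0 ->
  lat (\sum_(j | parallel a0 (a j)) Num.sg (dot (a j) a0) *: a j).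
Proof.
move=> vl a00; have [w [e [e0 he]]] := edge_direction a a00.
have aa := dot_gt0 a00.
have par0 j : parallel a0 (a j) -> a j != 0 -> dot (a j) a0 != 0.
  move=> pj; apply: contra_neq => h; by rewrite (eqP pj) h mul0r scale0r.
have gen (t : R) : `|t| = e -> forall j, a j != 0 -> dot (a j) (w + t *: a0) != 0.
  move=> te j aj; rewrite dotDr dotZr; have [h1 h2] := he j.
  have [pj|npj] := boolP (parallel a0 (a j)).
    by rewrite h1// add0r mulf_neq0 ?par0// -normr_gt0 te.
  have := h2 npj; rewrite -te -normrM => lt; rewrite addr_eq0; apply/eqP => h.
  by move: lt; rewrite h normrN ltxx.
have v1 := vl _ (zvert_vertex c (gen e (gtr0_norm e0))).
have v2 := vl _ (zvert_vertex c (gen (- e) (etrans (normrN _) (gtr0_norm e0)))).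
have := latB v1 v2; rewrite !zvertE opprD addrACA subrr add0r -sumrB.
set T := \sum_j (_ - _) => lT; suff -> : \sum_(j | parallel a0 (a j)) Num.sg (dot (a j) a0) *: a j = T by [].
rewrite big_mkcond/=; apply: eq_bigr => j _.
rewrite -scalerBl; have [h1 h2] := he j.
rewrite !dotDr !dotZr; have [pj|npj] := boolP (parallel a0 (a j)).
  rewrite h1// !add0r mulNr oppr_gt0 pmulr_rgt0// pmulr_rlt0//.
  congr (_ *: _); have [h|h|h] := ltgtP (dot (a j) a0) 0.
  - by rewrite ltr0_sg// sub0r.
  - by rewrite gtr0_sg// subr0.
  - by rewrite h sgr0 subrr.
have := h2 npj; rewrite -{1}(gtr0_norm e0) -normrM mulNr.
set u := dot (a j) w; set t := e * _ => lt.
suff -> : (0 < u + t) = (0 < u - t) by rewrite subrr scale0r.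
move: lt; rewrite lter_norml; have [u0|u0|->] := ltgtP u 0; last by rewrite normr0 oppr0; lra.
  by rewrite ltr0_norm// => /andP[? ?]; apply/idP/idP => ?; lra.
by rewrite gtr0_norm// => /andP[? ?]; apply/idP/idP => ?; lra.
Qed.

End lattice.

Lemma toR_eq0 p : (toR p == 0) = (p == 0).
Proof.
apply/eqP/eqP => [/rowP h|->]; last by rewrite map_mx0.
by apply/rowP => i; have := h i; rewrite !mxE => /eqP; rewrite intr_eq0 => /eqP.
Qed.

Lemma pos_primitive_parallel p q (l : R) : pos_primitive p -> pos_primitive q ->
  toR p = l *: toR q -> p = q.
Proof.
move=> pp pq e; have q0 : q != 0 by apply: primitive_neq0; case/andP: pq.
have [j qj] : exists j, q 0 j != 0.
  apply: contrapT => /forallNP h; move/eqP: q0; apply; apply/rowP => j; rewrite mxE.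
  by have /negP/negPn/eqP := h j.
have cross i : q 0 j * p 0 i = p 0 j * q 0 i.
  have /rowP e' := e; have := e' i; have := e' j; rewrite !mxE => ej ei.
  by apply/eqP; rewrite -(eqr_int R) !intrM ej ei; apply/eqP; ring.
have vec : q 0 j *: p = p 0 j *: q by apply/rowP => i; rewrite !mxE cross.
apply: (@pos_primitive_inj _ p q `|q 0%R j|%N `|p 0%R j|%N) => //; first by rewrite absz_gt0.
have sgn (a : int) : (`|a|%N%:Z = a) \/ (`|a|%N%:Z = - a) by lia.
case: (sgn (q 0 j)) => ->; case: (sgn (p 0 j)) => ->; rewrite ?scaleNr vec ?opprK.
- by left.
- by right.
- by right.
- by left.
Qed.

Lemma pos_primitive_rep z : z != 0 -> exists p (g : nat), [/\ pos_primitive p, (0 < g)%N &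
  z = g%:Z *: p \/ z = - (g%:Z *: p)].
Proof.
move=> z0; have pz := primitive_vprim z0; have v0 := primitive_neq0 pz.
have g0 : (0 < vgcd z)%N by rewrite vgcd_gt0.
have [pos|npos] := boolP (positive (vprim z)).
  exists (vprim z), (vgcd z); split; rewrite /pos_primitive ?pz//; left; exact: vprimE.
exists (- vprim z), (vgcd z); split; rewrite /pos_primitive ?primitiveN ?pz ?positiveN//.
by right; rewrite scalerN opprK; exact: vprimE.
Qed.

Lemma parallelZ (a0 : 'rV[R]_d) (l : R) : a0 != 0 -> parallel a0 (l *: a0).
Proof. by move=> a00; rewrite /parallel dotZl mulfK// dot_eq0. Qed.

Lemma zset_width (I : finType) c (a : I -> 'rV[R]_d) w :
  zsupp c a w + zsupp c a (- w) = \sum_i `|dot (a i) w|.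
Proof.
rewrite /zsupp dotNr addrACA subrr add0r -big_split/=; apply: eq_bigr => i _.
rewrite dotNr; have /orP[h|h] := le_total 0 (dot (a i) w).
  by rewrite (max_r h) max_l ?oppr_le0// addr0 ger0_norm.
by rewrite (max_l h) max_r ?oppr_ge0// add0r ler0_norm.
Qed.

Lemma zset_cube_width (I : finType) c (a : I -> 'rV[R]_d) (j : 'I_d) :
  zset c a `<=` @cube R d -> \sum_i `|a i 0 j| <= 2.
Proof.
move=> sub; have := zset_width c a (delta_mx 0 j).
under [in RHS]eq_bigr do rewrite dot_delta.
move=> <-; rewrite -!zsupp_vert dotNr !dot_delta.
have /(_ j)/andP[? ?] := sub _ (zset_vert c a (delta_mx 0 j)).
have /(_ j)/andP[? ?] := sub _ (zset_vert c a (- delta_mx 0 j)).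
lra.
Qed.

Definition gens n M (k : pos_prims d M -> nat) (i : pos_prims d M) : 'rV[R]_d :=
  ((k i)%:R / n%:R) *: toR (val i).

(** [n] times the width of the zonotope along the [j]-th axis, so that fitting into the cube after a
    translation means at most [2n]. *)
Definition kwidth M (k : pos_prims d M -> nat) (j : 'I_d) : nat :=
  (\sum_(i : pos_prims d M) k i * `|val i 0%R j|)%N.

(** A segment with negative coefficient is reversed by moving the base point to its other end;
    parallel segments then add up to one whose length is the sum of theirs. *)
Lemma zset_group (I : finType) M c (p : I -> 'rV[int]_d) (mu : I -> R) :
  (forall i, p i \in pos_prims d M) ->
  zset c (fun i => mu i *: toR (p i)) =
  zset (c + \sum_(i | mu i < 0) mu i *: toR (p i))
    (fun q : pos_prims d M => (\sum_(i | p i == val q) `|mu i|) *: toR (val q)).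
Proof.
move=> pM; pose K (q : 'rV[int]_d) := \sum_(i | p i == q) `|mu i|.
pose flip (s : I -> R) i := if mu i < 0 then 1 - s i else s i.
have flip01 s : (forall i, 0 <= s i <= 1) -> forall i, 0 <= flip s i <= 1.
  by move=> s01 i; rewrite /flip; case: ifP => // _; have /andP[? ?] := s01 i; apply/andP; split; lra.
have flipK s : flip (flip s) = s.
  by apply/funext => i; rewrite /flip; case: (mu i < 0) => //; ring.
have e1 s : \sum_i s i *: (mu i *: toR (p i)) =
    \sum_(i | mu i < 0) mu i *: toR (p i) + \sum_i (flip s i * `|mu i|) *: toR (p i).
  rewrite [X in _ = X + _]big_mkcond/= -big_split/=; apply: eq_bigr => i _; rewrite /flip scalerA.
  case: ltP => [m0|m0]; last by rewrite add0r ger0_norm.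
  by rewrite ltr0_norm// -scalerDl; congr (_ *: _); ring.
have e2 (u : I -> R) : \sum_i u i *: toR (p i) =
    \sum_(q : pos_prims d M) (\sum_(i | p i == val q) u i) *: toR (val q).
  pose f i : pos_prims d M := [` pM i]%fset.
  rewrite (partition_big f xpredT)//=; apply: eq_bigr => q _.
  rewrite scaler_suml; apply: eq_big => i; first by rewrite -val_eqE.
  by move=> /eqP <-.
apply/seteqP; split => [_ [s /= s01 <-]|_ [t /= t01 <-]].
  rewrite e1 e2 addrA.
  exists (fun q : pos_prims d M => (\sum_(i | p i == val q) flip s i * `|mu i|) / K (val q)).
    move=> q /=; have F := flip01 _ s01.
    have le : \sum_(i | p i == val q) flip s i * `|mu i| <= K (val q).
      by apply: ler_sum => i _; have /andP[? ?] := F i; rewrite ler_piMl.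
    have ge : 0 <= \sum_(i | p i == val q) flip s i * `|mu i|.
      by apply: sumr_ge0 => i _; have /andP[? ?] := F i; rewrite mulr_ge0.
    have K0 := le_trans ge le; rewrite divr_ge0//=.
    have [->|Kn] := eqVneq (K (val q)) 0; first by rewrite invr0 mulr0.
    by rewrite ler_pdivrMr ?mul1r// lt_neqAle eq_sym Kn.
  congr (_ + _); apply: eq_bigr => q _; rewrite scalerA; congr (_ *: _).
  have [K0|Kn] := eqVneq (K (val q)) 0; last by rewrite divfK.
  rewrite K0 invr0 mulr0 mul0r; apply/esym.
  rewrite big1// => i pi; have /eqP := K0; rewrite psumr_eq0//.
  by move=> /allP/(_ i (mem_index_enum i)); rewrite pi/= => /eqP ->; rewrite mulr0.
exists (flip (fun i => t [` pM i]%fset)); first exact: flip01.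
rewrite e1 flipK e2 addrA; congr (_ + _); apply: eq_bigr => q _; rewrite scalerA.
congr (_ *: _); rewrite mulr_sumr; apply: eq_bigr => i /eqP pi; congr (t _ * _).
by apply/val_inj.
Qed.

End lattice_zonotopes.

(** * Canonical form of a lattice zonotope in the cube *)

Section canonical_form.
Context {R : realType} {d : nat}.
Hypothesis d_gt0 : (0 < d)%N.
Implicit Types (c x w : 'rV[R]_d) (P : set 'rV[R]_d) (p q z : 'rV[int]_d) (n : nat).

Local Notation toR := (map_mx (intr : int -> R)).

Lemma in_pos_prims M q : (q \in pos_prims d M) = (norm1 q <= M)%N && pos_primitive q.
Proof. by rewrite -in_ball1 !inE. Qed.

(** Default direction for zero generators, short enough to lie in every [pos_prims d M] with
    [M > 0]. *)
Lemma small_pos_primitive : exists p : 'rV[int]_d, pos_primitive p && (norm1 p <= 1)%N.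
Proof.
pose e : 'rV[int]_d := delta_mx 0 (Ordinal d_gt0).
have ne : norm1 e = 1%N.
  rewrite /norm1 (bigD1 (Ordinal d_gt0))//= mxE !eqxx/= big1 ?addn0// => j ji.
  by rewrite mxE (negbTE ji) andbF.
have e0 : e != 0 by rewrite -norm1_eq0 ne.
have pe : primitive e.
  by have := vgcd_le_norm1 e; rewrite ne => le1; rewrite /primitive eqn_leq le1 vgcd_gt0.
have [pos|npos] := boolP (positive e).
  by exists e; rewrite /pos_primitive pe pos ne.
by exists (- e); rewrite /pos_primitive primitiveN pe positiveN// npos norm1N ne.
Qed.

(** For [a i] nonzero, the edge sum is a positive multiple of [a i] and, by [edge_lattice], a
    lattice vector; so [a i] lies on the line of a primitive vector. Its own coefficient [pm.2] is
    just real, and integrality is stated for the edge. *)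
Lemma generator_rep n (I : finType) c (a : I -> 'rV[R]_d) i : (0 < n)%N ->
  vertices (zset c a) `<=` @scaled_lattice R d n ->
  exists pm : 'rV[int]_d * R, [/\ pos_primitive pm.1, a i = pm.2 *: toR pm.1,
    pm.2 = 0 -> (norm1 pm.1 <= 1)%N &
    pm.2 != 0 -> exists g : nat,
      \sum_(j | parallel (a i) (a j)) Num.sg (dot (a j) (a i)) *: a j =
      (Num.sg pm.2 * (g%:R / n%:R)) *: toR pm.1].
Proof.
move=> n0 vl; have [ai0|ai0] := eqVneq (a i) 0.
  have [p /andP[pp p1]] := small_pos_primitive.
  by exists (p, 0); split => //=; rewrite ?scale0r// eqxx.
have nR : (0 : R) < n%:R by rewrite ltr0n.
have [z _ ez] := edge_lattice vl ai0.
have aa := dot_gt0 ai0.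
set E := \sum_(j | _) _ in ez *.
pose l := \sum_(j | parallel (a i) (a j)) `|dot (a j) (a i)| / dot (a i) (a i).
have El : E = l *: a i.
  rewrite /E /l scaler_suml; apply: eq_bigr => j pj.
  by rewrite {2}(eqP pj) scalerA mulrA -normrEsg.
have l0 : 0 < l.
  have pii : parallel (a i) (a i) by rewrite -{2}(scale1r (a i)) parallelZ.
  rewrite /l (bigD1 i)//= ger0_norm ?dot_ge0// divff ?gt_eqF// ltr_pwDl//.
  by apply: sumr_ge0 => j _; rewrite divr_ge0// ltW.
have z0 : z != 0.
  apply: contraNneq ai0 => z0; move: ez; rewrite z0 map_mx0 scaler0 El => /esym/eqP.
  by rewrite scaler_eq0 gt_eqF.
have [p [g [pp g0 zE]]] := pos_primitive_rep z0.
have gR : (0 : R) < g%:R by rewrite ltr0n.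
have toRZ : toR (g%:Z *: p) = g%:R *: toR p by rewrite map_mxZ.
have aE (s : R) : E = (s * (g%:R / n%:R)) *: toR p -> a i = (s * (g%:R / n%:R) / l) *: toR p.
  rewrite El => h; have := congr1 (fun y => l^-1 *: y) h.
  by rewrite !scalerA mulVf ?gt_eqF// scale1r mulrC.
case: zE => zE; rewrite zE in ez.
  have EE : E = (1 * (g%:R / n%:R)) *: toR p by rewrite -ez toRZ scalerA mul1r mulrC.
  exists (p, 1 * (g%:R / n%:R) / l); rewrite mul1r; split => //=.
  - by rewrite -[g%:R / _]mul1r; exact: aE.
  - by move/eqP; rewrite !mulf_eq0 !invr_eq0 !gt_eqF.
  - by move=> _; exists g; rewrite EE gtr0_sg ?divr_gt0.
have EE : E = (-1 * (g%:R / n%:R)) *: toR p.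
  by rewrite -ez map_mxN toRZ scalerN scalerA mulN1r scaleNr mulrC.
exists (p, -1 * (g%:R / n%:R) / l); split => //=.
- exact: aE.
- by move/eqP; rewrite !mulf_eq0 !invr_eq0 oppr_eq0 oner_eq0 !gt_eqF.
- by move=> _; exists g; rewrite EE ltr0_sg// mulN1r mulNr oppr_lt0 !divr_gt0.
Qed.

(** Grouping gives one segment per direction [p], with total coefficient [K p], a multiple of [1/n]
    although its parts may not be. As widths in the cube are at most 2, a nonzero [K p >= 1/n]
    forces [|p_j| <= 2n], whence the condition on [M]. *)
Lemma lattice_zonotope_canonical n M P : (0 < n)%N -> (2 * n * d <= M)%N ->
  lattice_zonotopes (@cube R d) n P ->
  exists z (k : pos_prims d M -> nat), [/\ z \in box d n, forall j, (kwidth k j <= 2 * n)%N &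
    P = zset (n%:R^-1 *: toR z) (@gens R d n M k)].
Proof.
move=> n0 nM [/zonotopeP[m [c [a PE]]] Pcube Pvert].
have nR : (0 : R) < n%:R by rewrite ltr0n.
rewrite PE in Pvert Pcube.
have /choice[pm hpm] : forall i, _ := fun i => generator_rep i n0 Pvert.
pose p i := (pm i).1; pose mu i := (pm i).2.
have pp i : pos_primitive (p i) by case: (hpm i).
have aE i : a i = mu i *: toR (p i) by case: (hpm i).
have p0 i : toR (p i) != 0.
  by rewrite toR_eq0 primitive_neq0//; have /andP[] := pp i.
pose K q := \sum_(j | p j == q) `|mu j|.
have Kg i : mu i != 0 -> exists g : nat, K (p i) = g%:R / n%:R.
  move=> mi; have [_ _ _ /(_ mi)[g hg]] := hpm i; exists g; move: hg.
  have ai0 : a i != 0 by rewrite aE scaler_eq0 negb_or mi p0.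
  (* Positive primitive vectors represent lines, so among nonzero generators being parallel to [a i]
     is having the direction [p i]. *)
  have -> : \sum_(j | parallel (a i) (a j)) Num.sg (dot (a j) (a i)) *: a j =
      (Num.sg (mu i) * K (p i)) *: toR (p i).
    rewrite /K mulr_sumr scaler_suml big_mkcond [RHS]big_mkcond; apply: eq_bigr => j _.
    have [mj|mj] := eqVneq (mu j) 0.
      have aj0 : a j = 0 by rewrite aE mj scale0r.
      by rewrite aj0 scaler0 mj normr0 mulr0 scale0r !if_same.
    have [pji|pji] := eqVneq (p j) (p i).
      have aji : a j = (mu j / mu i) *: a i by rewrite !aE pji scalerA divfK.
      rewrite ifT; last by rewrite aji parallelZ.
      rewrite !aE pji dotZl dotZr !sgrM (gtr0_sg (dot_gt0 (p0 i))) mulr1 scalerA normrEsg.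
      by congr (_ *: _); ring.
    rewrite ifN//; apply: contra pji => /eqP h; apply/eqP.
    apply: (@pos_primitive_parallel R d _ _ ((mu j)^-1 * (dot (a j) (a i) / dot (a i) (a i) * mu i))) => //.
    by rewrite -scalerA -scalerA -aE -h aE scalerA mulVf// scale1r.
  move=> /eqP; rewrite -subr_eq0 -scalerBl scaler_eq0 (negbTE (p0 i)) orbF -mulrBr mulf_eq0.
  by rewrite sgr_eq0 (negbTE mi)/= subr_eq0 => /eqP.
have wid j : \sum_i `|a i 0 j| <= 2 := zset_cube_width j Pcube.
have pM i : p i \in pos_prims d M.
  rewrite in_pos_prims pp andbT.
  have [mi|mi] := eqVneq (mu i) 0.
    have [_ _ /(_ mi) le1 _] := hpm i; apply: leq_trans le1 _; apply: leq_trans nM.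
    by rewrite !muln_gt0 n0 d_gt0.
  have [g gE] := Kg i mi.
  have K0 : 0 < K (p i).
    by rewrite /K (bigD1 i)//= ltr_pwDl ?normr_gt0// sumr_ge0.
  have g1 : (1 : R) <= g%:R.
    by rewrite ler1n -(ltr0n R); move: K0; rewrite gE pmulr_lgt0// invr_gt0.
  have le j : (`|p i 0%R j| <= 2 * n)%N.
    have : K (p i) * `|toR (p i) 0 j| <= 2.
      apply: le_trans (wid j); rewrite /K mulr_suml big_mkcond/=; apply: ler_sum => l _.
      case: eqP => // pl; by rewrite aE pl !mxE normrM.
    rewrite gE mulrAC ler_pdivrMr// mxE -intr_norm -natr_absz => h.
    rewrite -(ler_nat R) natrM; apply: le_trans h; by rewrite ler_peMl.
  apply: (@leq_trans (\sum_(j < d) 2 * n)%N); first by apply: leq_sum => j _; exact: le.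
  by rewrite sum_nat_const card_ord mulnC.
have Kk q : exists g : nat, K q = g%:R / n%:R.
  have [[i /andP[/eqP <- mi]]|no] := pselect (exists i, (p i == q) && (mu i != 0)); first exact: Kg.
  exists 0%N; rewrite mul0r /K big1// => i pi; apply/eqP; rewrite normr_eq0.
  by apply: contrapT => /negP mi; apply: no; exists i; rewrite pi mi.
have [k0 hk] := choice Kk; pose k (i : pos_prims d M) := k0 (val i).
pose c' := c + \sum_(i | mu i < 0) mu i *: toR (p i).
have PE' : P = zset c' (@gens R d n M k).
  rewrite PE (_ : a = (fun i => mu i *: toR (p i))); last by apply/funext => i; exact: aE.
  rewrite (zset_group c mu pM); congr zset; apply/funext => q; rewrite /gens /k -hk.
  by [].
rewrite -PE PE' in Pvert Pcube.
have [w hw] : exists w, forall i : pos_prims d M, dot (toR (val i)) w != 0.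
  apply: generic_direction => i; rewrite toR_eq0 primitive_neq0//.
  by have /andP[] := pos_primsP i.
have gw (i : pos_prims d M) : @gens R d n M k i != 0 -> dot (@gens R d n M k i) w != 0.
  rewrite /gens scaler_eq0 negb_or => /andP[h _]; by rewrite dotZl mulf_neq0// hw.
(* The base point is a vertex minus the lattice vectors leading to it. *)
have lc : scaled_lattice n c'.
  have := Pvert _ (zvert_vertex c' gw); rewrite /zvert => lv.
  have -> : c' = zvert c' (@gens R d n M k) w - \sum_(i | 0 < dot (@gens R d n M k i) w) @gens R d n M k i.
    by rewrite /zvert addrK.
  by apply: latB => //; apply: lat_sum => i _; exact: lat_mult.
case: lc => z _ zc; exists z, k; rewrite zc; split => //.
- rewrite in_box; apply/forallP => j.
  have /(_ j) := Pcube _ (zset_base c' (@gens R d n M k)).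
  rewrite -zc !mxE -ler_norml normrM gtr0_norm ?invr_gt0// mulrC ler_pdivrMr// mul1r.
  by rewrite -intr_norm -natr_absz ler_nat.
- move=> j; have := zset_cube_width j Pcube.
  rewrite -(ler_nat R) natrM /kwidth natr_sum -ler_pdivrMr// mulr_suml => h.
  apply: le_trans h; apply: ler_sum => i _.
  by rewrite /gens mxE normrM ger0_norm ?divr_ge0// mxE -intr_norm natrM natr_absz mulrAC.
Qed.

End canonical_form.

(** * Counting zonotopes by multiplicity functions *)

Section zonotope_counting.
Context {R : realType} {d : nat}.
Implicit Types (c x w : 'rV[R]_d) (p q z : 'rV[int]_d) (n M K : nat).

Local Notation toR := (map_mx (intr : int -> R)).

Lemma zsupp_set (I J : finType) c (a : I -> 'rV[R]_d) c' (a' : J -> 'rV[R]_d) w :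
  zset c a = zset c' a' -> zsupp c a w = zsupp c' a' w.
Proof.
move=> e; apply/eqP; rewrite eq_le; apply/andP; split.
  by rewrite -zsupp_vert; apply: zsupp_ge; rewrite -e; exact: zset_vert.
by rewrite -zsupp_vert; apply: zsupp_ge; rewrite e; exact: zset_vert.
Qed.

(* Along a direction orthogonal to one generator only, the width function has
   a kink whose size is the multiplicity of that generator. *)
Lemma gens_inj n M c c' (k k' : pos_prims d M -> nat) : (0 < n)%N ->
  zset c (@gens R d n M k) = zset c' (@gens R d n M k') -> k =1 k'.
Proof.
move=> n0 e i0; have nR : (0 : R) < n%:R by rewrite ltr0n.
pose a (i : pos_prims d M) : 'rV[R]_d := toR (val i).
have a0 i : a i != 0.
  by rewrite toR_eq0 primitive_neq0//; have /andP[] := pos_primsP i.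
have [w [t [t0 hw]]] := edge_direction a (a0 i0).
have npar i : i != i0 -> ~~ parallel (a i0) (a i).
  move=> ii0; apply: contra ii0 => /eqP h; apply/eqP/val_inj.
  exact: (pos_primitive_parallel (pos_primsP i) (pos_primsP i0) h).
pose F (l : pos_prims d M -> nat) v := \sum_i (l i)%:R * `|dot (a i) v|.
have FE v : F k v = F k' v.
  have W l c0 : zsupp c0 (@gens R d n M l) v + zsupp c0 (@gens R d n M l) (- v) = F l v / n%:R.
    rewrite zset_width /F mulr_suml; apply: eq_bigr => i _.
    by rewrite /gens dotZl normrM ger0_norm ?divr_ge0// mulrAC.
  have := W k c; rewrite (zsupp_set v e) (zsupp_set (- v) e) W => /esym.
  by move/(mulIf _); apply; rewrite invr_eq0 gt_eqF.
have kink l : F l (w + t *: a i0) + F l (w - t *: a i0) - 2 * F l w =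
    (l i0)%:R * (2 * (t * dot (a i0) (a i0))).
  rewrite /F mulr_sumr -big_split/= -sumrB (bigD1 i0)//= [X in _ + X]big1 ?addr0.
    have [h1 _] := hw i0; rewrite !dotDr dotNr dotZr h1; last first.
      by rewrite -{2}(scale1r (a i0)) parallelZ.
    rewrite add0r sub0r normrN normr0 ger0_norm; last by rewrite mulr_ge0 ?dot_ge0// ltW.
    by ring.
  move=> i ii0; have [_ /(_ (npar i ii0))] := hw i.
  rewrite !dotDr dotNr dotZr -{1}(gtr0_norm t0) -normrM.
  move: (dot (a i) w) (t * _) => x y xy.
  rewrite -mulrDr; have -> : `|x + y| + `|x - y| = 2 * `|x|.
    move: xy; rewrite lter_norml; have [x0|x0|->] := ltgtP x 0; last by rewrite normr0 oppr0; lra.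
      rewrite ltr0_norm// => /andP[h1 h2]; rewrite !ltr0_norm; [ring|lra|lra].
    rewrite gtr0_norm// => /andP[h1 h2]; rewrite !gtr0_norm; [ring|lra|lra].
  by ring.
have := kink k; rewrite !FE kink => /mulIf h; apply/eqP; rewrite -(eqr_nat R); apply/eqP/esym/h.
by rewrite gt_eqF// !mulr_gt0// dot_gt0.
Qed.

Lemma gens_zonotope n M (k : pos_prims d M -> nat) : (0 < n)%N ->
  (forall j, (kwidth k j <= 2 * n)%N) ->
  exists c, lattice_zonotopes (@cube R d) n (zset c (@gens R d n M k)).
Proof.
move=> n0 kn; have nR : (0 : R) < n%:R by rewrite ltr0n.
(* The zonotope is made to touch each face [x_j = -1]: the base point is raised by the total
   negative extent of the generators. *)
pose z : 'rV[int]_d := \row_j (- n%:Z + \sum_i (k i)%:Z * Num.max 0 (- (val i 0 j))).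
exists (n%:R^-1 *: toR z); split; first exact: zonotope_zset.
  move=> _ [s /= s01 <-] j; rewrite -ler_norml.
  suff : `|n%:R * (n%:R^-1 *: toR z + \sum_i s i *: @gens R d n M k i) 0 j| <= n%:R.
    by rewrite normrM gtr0_norm// ger_pMr.
  rewrite !mxE summxE mulrDr mulVKf ?gt_eqF// mulr_sumr.
  have -> : \sum_i n%:R * (s i *: @gens R d n M k i) 0 j =
      \sum_i (k i)%:R * (s i * (val i 0 j)%:~R).
    by apply: eq_bigr => i _; rewrite !mxE; field; rewrite gt_eqF.
  rewrite intrD intrN /= rmorph_sum/= -addrA -big_split/=.
  set S := \sum_i _.
  have S0 : 0 <= S.
    apply: sumr_ge0 => i _; rewrite intrM -mulrDr mulr_ge0//.
    have /andP[s0 s1] := s01 i; move: (val i 0 j) => y.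
    have [y0|y0] := leP 0 y; first by rewrite max_l ?oppr_le0// add0r mulr_ge0// ler0z.
    rewrite max_r ?oppr_ge0 ?(ltW y0)// intrN.
    have : (y%:~R : R) <= 0 by rewrite lerz0 ltW.
    by nra.
  have S1 : S <= 2 * n%:R.
    apply: (@le_trans _ _ (kwidth k j)%:R); last by rewrite -natrM ler_nat.
    rewrite /kwidth natr_sum; apply: ler_sum => i _; rewrite natrM intrM -mulrDr ler_wpM2l//.
    have /andP[s0 s1] := s01 i; rewrite natr_absz intr_norm; move: (val i 0 j) => y.
    have [y0|y0] := leP 0 y.
      rewrite max_l ?oppr_le0// add0r ger0_norm ?ler0z// ler_piMl// ler0z//.
    rewrite max_r ?oppr_ge0 ?(ltW y0)// intrN.
    have yn : (y%:~R : R) <= 0 by rewrite lerz0 ltW.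
    by rewrite ler0_norm//; nra.
  by rewrite ler_norml; apply/andP; split; lra.
apply: vertices_zset_lat; first by exists z.
by move=> i; exact: lat_mult.
Qed.

(** A primitive vector has a coordinate with [|p_j| >= 1], so the width bound gives
    [k_p <= 2n <= K]. *)
Lemma lattice_zonotope_cover n M K : (0 < d)%N -> (0 < n)%N -> (2 * n * d <= M)%N -> (2 * n <= K)%N ->
  forall P, lattice_zonotopes (@cube R d) n P ->
  exists z (k : {ffun pos_prims d M -> 'I_K.+1}), [/\ z \in box d n,
    forall j, (kwidth (fun i => k i) j <= 2 * n)%N &
    P = zset (n%:R^-1 *: toR z) (@gens R d n M (fun i => k i))].
Proof.
move=> d0 n0 nM nK P LP.
have [z [k [zn kn ->]]] := lattice_zonotope_canonical d0 n0 nM LP.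
have kK i : (k i < K.+1)%N.
  rewrite ltnS; apply: leq_trans nK.
  have pi : val i != 0 by apply: primitive_neq0; have /andP[] := pos_primsP i.
  have [j pj] : exists j, val i 0 j != 0.
    apply: contrapT => /forallNP h; move/eqP: pi; apply; apply/rowP => j; rewrite mxE.
    by have /negP/negPn/eqP := h j.
  apply: leq_trans (kn j); rewrite /kwidth (bigD1 i)//= (leq_trans _ (leq_addr _ _))//.
  by rewrite leq_pmulr// absz_gt0.
exists z, [ffun i => Ordinal (kK i)].
have -> : (fun i => nat_of_ord ([ffun i => Ordinal (kK i)] i)) = k.
  by apply/funext => i; rewrite ffunE.
by split.
Qed.

Lemma lattice_zonotopes_card_le n M K (Bad : set (set 'rV[R]_d))
    (B : pred {ffun pos_prims d M -> 'I_K.+1}) :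
  (0 < d)%N -> (0 < n)%N -> (2 * n * d <= M)%N -> (2 * n <= K)%N ->
  Bad `<=` lattice_zonotopes (@cube R d) n ->
  (forall z (k : {ffun pos_prims d M -> 'I_K.+1}),
    Bad (zset (n%:R^-1 *: toR z) (@gens R d n M (fun i => k i))) ->
    (forall j, (kwidth (fun i => k i) j <= 2 * n)%N) -> B k) ->
  finite_set Bad /\
  (set_card Bad <= n.*2.+1 ^ d * #|[pred k : {ffun pos_prims d M -> 'I_K.+1} |
     B k && [forall j, (kwidth (fun i => k i) j <= 2 * n)%N]]|)%N.
Proof.
move=> d0 n0 nM nK BL BB.
pose T := ({ffun 'I_d -> 'I_n.*2.+1} * {ffun pos_prims d M -> 'I_K.+1})%type.
pose f (x : T) := zset (n%:R^-1 *: toR (box_vector x.1)) (@gens R d n M (fun i => x.2 i)).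
pose Q := [pred k : {ffun pos_prims d M -> 'I_K.+1} |
  B k && [forall j, (kwidth (fun i => k i) j <= 2 * n)%N]].
pose F : {fset (set 'rV[R]_d)} := [fset f x | x in [predX predT & Q]]%fset.
have sub : Bad `<=` [set` F].
  move=> P BP; have [z [k [zn kn PE]]] := lattice_zonotope_cover d0 n0 nM nK (BL _ BP).
  move: zn => /imfsetP[g _ zg]; apply/imfsetP; exists (g, k); last by rewrite PE /f zg.
  rewrite !inE/= (BB z)//=; last by rewrite -PE.
  by apply/forallP.
have fB : finite_set Bad by apply: sub_finite_set sub _; exact: finite_fset.
split => //; rewrite /set_card.
apply: (@leq_trans #|` F|).
  apply: fsubset_leq_card; apply/fsubsetP => P; rewrite in_fset_set// inE => BP.
  exact: sub.
apply: leq_trans (leq_imfset_card _ _ _) _.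
by rewrite /= -cardE cardX card_ffun !card_ord.
Qed.

(** One translate per multiplicity function is enough; [gens_inj] keeps these sets distinct. *)
Lemma lattice_zonotopes_card_ge n M K : (0 < n)%N ->
  finite_set (lattice_zonotopes (@cube R d) n) ->
  (#|[pred k : {ffun pos_prims d M -> 'I_K.+1} | [forall j, (kwidth (fun i => k i) j <= 2 * n)%N]]|
    <= set_card (lattice_zonotopes (@cube R d) n))%N.
Proof.
move=> n0 fL; set Q := [pred k | _].
have /choice[c hc] : forall k : {ffun pos_prims d M -> 'I_K.+1}, exists c, Q k ->
    lattice_zonotopes (@cube R d) n (zset c (@gens R d n M (fun i => k i))).
  move=> k; have [Qk|] := boolP (Q k); last by exists 0.
  by have [c hc] := gens_zonotope n0 (fun j => forallP Qk j); exists c.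
pose f k := zset (c k) (@gens R d n M (fun i => k i)).
have finj : injective f.
  by move=> k k' /(gens_inj n0) e; apply/ffunP => i; apply/val_inj; exact: e.
rewrite cardE -(size_map f); apply: uniq_leq_size.
  by rewrite map_inj_uniq ?enum_uniq.
move=> P /mapP[k]; rewrite mem_enum => Qk ->.
by rewrite in_fset_set// inE; exact: hc.
Qed.

End zonotope_counting.

(** * Hausdorff distance from support functions *)

Section hausdorff.
Context {R : realType} {d : nat}.
Implicit Types (A B : set 'rV[R]_d) (x y u v : 'rV[R]_d).

Lemma enormE x : enorm x ^+ 2 = dot x x.
Proof. by rewrite sqr_sqrtr// dot_ge0. Qed.

(* A nearly nearest point [y0] of a convex set nearly supports it in the direction [x - y0]. *)
Lemma convex_approx B x (eta L : R) :
  (forall y z (s : R), B y -> B z -> 0 <= s <= 1 -> B (s *: y + (1 - s) *: z)) ->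
  B !=set0 -> (forall y z, B y -> B z -> dot (y - z) (y - z) <= L) -> 0 <= eta ->
  (forall u (e : R), dot u u = 1 -> 0 < e -> exists2 y, B y & dot x u <= dot y u + eta + e) ->
  forall e : R, 0 < e -> exists2 y, B y & enorm (x - y) <= eta + e.
Proof.
move=> cB B0 BL eta0 hB e e0.
pose q y := dot (x - y) (x - y).
pose S := [set q y | y in B].
have Slb : lbound S 0 by move=> _ [y _ <-]; exact: dot_ge0.
have Sinf : has_inf S.
  by split; [have [y By] := B0; exists (q y), y|exists 0].
pose m := inf S.
have m0 : 0 <= m by apply: lb_le_inf => //; case: Sinf.
have mle y : B y -> m <= q y by move=> By; apply: ge_inf; [case: Sinf|exists y].
have mnear (t : R) : 0 < t -> exists2 y, B y & q y < m + t.
  by move=> t0; have [_ [y By <-] lt] := inf_adherent t0 Sinf; exists y.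
pose delta := Num.sqrt m.
have dm : delta ^+ 2 = m by rewrite sqr_sqrtr.
have delta0 : 0 <= delta by exact: sqrtr_ge0.
suff de : delta <= eta.
  have [y By qy] := mnear (e * (2 * delta + e)) (mulr_gt0 e0 (ltr_wpDl (mulr_ge0 (ler0n _ 2) delta0) e0)).
  exists y => //; apply: (@le_trans _ _ (delta + e)); last by rewrite lerD2r.
  rewrite -ler_sqr ?nnegrE ?sqrtr_ge0 ?addr_ge0 ?(ltW e0)// enormE -/(q y).
  by apply: le_trans (ltW qy) _; rewrite -dm; nra.
rewrite leNgt; apply/negP => ed.
have d0 : 0 < delta by exact: le_lt_trans ed.
pose theta := delta - eta; have th0 : 0 < theta by rewrite subr_gt0.
have L0 : 0 <= L by have [y By] := B0; apply: le_trans (dot_ge0 (y - y)) (BL _ _ By By).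
(* Step length from [y0] towards another point of [B], so small that the second-order term, at most
   [s^2 L], and the slack [s^2] in the choice of [y0] stay below a fraction of the gap [theta]. *)
pose s := Num.min 1 (theta * delta / (2 * (1 + L))).
have L1 : 0 < 2 * (1 + L) by lra.
have s0 : 0 < s by rewrite lt_min ltr01/= divr_gt0// mulr_gt0.
have s1 : s <= 1 by rewrite ge_min lexx.
have sL : s * (1 + L) <= theta * delta / 2.
  have : s <= theta * delta / (2 * (1 + L)) by rewrite ge_min lexx orbT.
  by rewrite ler_pdivlMr// => h; lra.
have [y0 By0 qy0] := mnear (s ^+ 2) (exprn_gt0 2 s0).
pose r := enorm (x - y0).
have rE : r ^+ 2 = q y0 by rewrite enormE.
have r0 : 0 <= r by exact: sqrtr_ge0.
have dr : delta <= r by rewrite -ler_sqr ?nnegrE// dm rE mle.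
have rp : 0 < r by exact: lt_le_trans dr.
pose u := r^-1 *: (x - y0).
have uu : dot u u = 1 by rewrite dotZl dotZr -/(q y0) -rE expr2 mulKf ?mulVf// gt_eqF.
have [y By hy] := hB u (theta / 4) uu (divr_gt0 th0 (ltr0n _ 4)).
have ru : dot x u - dot y0 u = r.
  by rewrite -dotBl dotZr -/(q y0) -rE expr2 mulKf// gt_eqF.
pose g := dot (x - y0) (y - y0).
have gE : dot y u - dot y0 u = g / r by rewrite -dotBl dotZr dotC mulrC.
have gs : g <= s * (1 + L) / 2.
  (* By convexity this point lies in [B], so its squared distance to [x] is at least [m]; this
     bounds the first-order term [g]. *)
  have Bz : B (s *: y + (1 - s) *: y0) by apply: cB => //; rewrite s1 ltW.
  have := mle _ Bz; rewrite /q.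
  have -> : x - (s *: y + (1 - s) *: y0) = (x - y0) - s *: (y - y0).
    by apply/rowP => i; rewrite !mxE; ring.
  have ex (X Y : 'rV[R]_d) : dot (X - s *: Y) (X - s *: Y) =
      dot X X - 2 * s * dot X Y + s ^+ 2 * dot Y Y.
    by rewrite dotBl !dotDr !dotNr !dotZr !dotZl (dotC Y X); ring.
  rewrite ex -/(q y0) -/g => h.
  have := BL _ _ By By0 => h2.
  have h3 : s ^+ 2 * dot (y - y0) (y - y0) <= s ^+ 2 * L by rewrite ler_wpM2l// sqr_ge0.
  have h4 : 2 * s * g <= s ^+ 2 * (1 + L) by rewrite mulrDr mulr1; move: h h3 qy0; lra.
  rewrite -(ler_pM2l (mulr_gt0 (ltr0n R 2) s0)); apply: le_trans h4 _.
  by rewrite le_eqVlt; apply/orP; left; apply/eqP; field.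
have gr : g / r <= theta / 4.
  rewrite ler_pdivrMr//; apply: le_trans gs _.
  have : theta * delta <= theta * r by rewrite ler_pM2l.
  by lra.
by move: hy; rewrite -/theta; have := ru; have := gE; rewrite /theta in gr *; lra.
Qed.

Lemma excess_le A B (eta : R) :
  (forall x, A x -> forall e : R, 0 < e -> exists2 y, B y & enorm (x - y) <= eta + e) ->
  (ereal_sup [set ereal_inf [set (enorm (x - y))%:E | y in B] | x in A] <= eta%:E)%E.
Proof.
move=> h; apply: ge_ereal_sup => _ [x Ax <-]; apply/lee_addgt0Pr => e e0.
have [y By le] := h x Ax e e0; rewrite -EFinD.
apply: (@le_trans _ _ (enorm (x - y))%:E); last by rewrite lee_fin.
by apply: ereal_inf_lbound; exists y.
Qed.

End hausdorff.

(** * Reduction to finitely many directions *)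

Section net.
Context {R : realType} {d : nat}.
Variables (Q0 : set 'rV[R]_d) (h : 'rV[R]_d -> R).
Hypothesis Q0_convex : @convex_set R 'rV[R]_d Q0.
Hypothesis Q0_h : forall v, support_fun Q0 v = (h v)%:E.
Hypothesis h_delta : forall j, h (delta_mx 0 j) = 1.

Local Notation toR := (map_mx (intr : int -> R)).

Let Q0_le y v : Q0 y -> dot y v <= h v.
Proof.
move=> Qy; rewrite -lee_fin -Q0_h; apply: ereal_sup_ubound; by exists y.
Qed.

Let Q0_near v (e : R) : 0 < e -> exists2 y, Q0 y & h v <= dot y v + e.
Proof.
move=> e0; have fs : support_fun Q0 v \is a fin_num by rewrite Q0_h.
have [_ [y Qy <-]] := ub_ereal_sup_adherent e0 fs.
rewrite -/(support_fun Q0 v) Q0_h -EFinB lte_fin => lt; exists y => //; lra.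
Qed.

Let Q0_bounded : exists2 L : R, 0 <= L & forall y, Q0 y -> forall i, `|y 0 i| <= L.
Proof.
pose L := \sum_i (`|h (delta_mx 0 i)| + `|h (- delta_mx 0 i)|).
exists L => [|y Qy i]; first by apply: sumr_ge0 => i _; rewrite addr_ge0.
have le : `|h (delta_mx 0 i)| + `|h (- delta_mx 0 i)| <= L.
  by rewrite /L (bigD1 i)//= lerDl sumr_ge0// => j _; rewrite addr_ge0.
have := Q0_le (delta_mx 0 i) Qy; have := Q0_le (- delta_mx 0 i) Qy.
rewrite dotNr dot_delta => h1 h2.
have := ler_norm (h (delta_mx 0 i)); have := ler_norm (h (- delta_mx 0 i)).
have := normr_ge0 (h (delta_mx 0 i)); have := normr_ge0 (h (- delta_mx 0 i)).
by rewrite ler_norml => *; apply/andP; split; lra.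
Qed.

Lemma box_diameter (B : set 'rV[R]_d) (L : R) : (forall y, B y -> forall i, `|y 0 i| <= L) ->
  forall y z, B y -> B z -> dot (y - z) (y - z) <= d%:R * (2 * L) ^+ 2.
Proof.
move=> hB y z By Bz; rewrite mulr_natl -[X in _ *+ X]card_ord -sumr_const.
apply: ler_sum => i _; rewrite -expr2 -real_normK ?num_real// lerXn2r ?nnegrE//.
  by apply: le_trans (normr_ge0 (y 0 i)) _; have := hB y By i; have := normr_ge0 (y 0 i); lra.
rewrite !mxE; apply: le_trans (ler_normB _ _) _.
by have := hB y By i; have := hB z Bz i; lra.
Qed.

Lemma hausdorff_zset (I : finType) c (a : I -> 'rV[R]_d) (eta : R) : 0 <= eta ->
  zset c a `<=` @cube R d ->
  (forall u, dot u u = 1 -> `|zsupp c a u - h u| <= eta) ->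
  (hausdorff_dist (zset c a) Q0 <= eta%:E)%E.
Proof.
move=> eta0 Pc hu; rewrite /hausdorff_dist ge_max; apply/andP; split; apply: excess_le.
  have [L L0 hL] := Q0_bounded.
  move=> x Px; apply: (convex_approx _ _ (box_diameter hL)) => //.
  - exact/convex_setP.
  - by have [y Qy _] := Q0_near 0 ltr01; exists y.
  move=> u e uu e0; have [y Qy hy] := Q0_near u e0; exists y => //.
  have := zsupp_ge u Px; have := hu u uu; rewrite ler_norml => /andP[? ?]; lra.
move=> x Qx; apply: (convex_approx _ _ (box_diameter (L := 1) _)) => //.
- by move=> y z s; exact: zset_convex.
- by exists c; exact: zset_base.
- by move=> y /Pc/= yc i; rewrite ler_norml; exact: yc.
move=> u e uu e0; exists (zvert c a u); first exact: zset_vert.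
have := Q0_le u Qx; have := hu u uu; rewrite zsupp_vert ler_norml => /andP[? ?]; lra.
Qed.

(** The net condition sees only the centred zonotope. Along the axes it gives width at least
    [2 - 2e] inside a cube of width 2, which pins the centre; from the net it extends to all unit
    vectors because both support functions are Lipschitz in the direction. *)
Lemma hausdorff_net (eta : R) : 0 < eta -> exists (e : R) (m : nat), [/\ 0 < e, (0 < m)%N &
  forall (I : finType) c (a : I -> 'rV[R]_d), zset c a `<=` @cube R d ->
  (forall z, z \in box d m -> let v := m%:R^-1 *: toR z in
    `|(\sum_i `|dot (a i) v|) / 2 - h v| <= e) ->
  (hausdorff_dist (zset c a) Q0 <= eta%:E)%E].
Proof.
move=> eta0; have [L L0 hL] := Q0_bounded.
(* The net condition costs [e] and the centre [d * e], together [eta / 2]; the other half of [eta]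
   is spent on rounding directions to the grid. *)
pose e := eta / 2 / (1 + d%:R).
have d1 : (0 : R) < 1 + d%:R by rewrite ltr_pwDl.
have e0 : 0 < e by rewrite !divr_gt0.
have [m m0 hm] := @large_nat R ((1 + L) * d%:R) (eta / 2) (divr_gt0 eta0 (ltr0n _ 2)).
have mR : (0 : R) < m%:R by rewrite ltr0n.
exists e, m; split => // I c a Pc net.
apply: hausdorff_zset; [exact: ltW|exact: Pc|move=> u uu].
pose z : 'rV[int]_d := \row_i Num.floor (u 0 i * m%:R).
pose v := m%:R^-1 *: toR z.
have u1 i : `|u 0 i| <= 1.
  rewrite -ler_sqr ?nnegrE// expr1n real_normK ?num_real// -uu /dot (bigD1 i)//= -expr2.
  by rewrite lerDl sumr_ge0// => j _; rewrite -expr2 sqr_ge0.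
have zb : z \in box d m.
  rewrite in_box; apply/forallP => i; rewrite mxE.
  have := u1 i; rewrite ler_norml => /andP[h1 h2].
  have f1 : Num.floor (u 0 i * m%:R) <= m%:Z.
    by rewrite -(ler_int R) (le_trans (floor_le _))//= ger_pMl.
  have f2 : - m%:Z <= Num.floor (u 0 i * m%:R).
    rewrite floor_ge_int intrN; change (- m%:R <= u 0 i * m%:R); nra.
  by move: f1 f2; move: (Num.floor _) => f; lia.
have v1 i : `|v 0 i| <= 1.
  rewrite !mxE normrM gtr0_norm ?invr_gt0// mulrC ler_pdivrMr// mul1r -intr_norm -natr_absz ler_nat.
  by have := zb; rewrite in_box => /forallP/(_ i); rewrite mxE.
have uv i : `|(u - v) 0 i| <= m%:R^-1.
  rewrite !mxE -(ler_pM2l mR) divff ?gt_eqF// -{1}(gtr0_norm mR) -normrM.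
  have -> : m%:R * (u 0 i - m%:R^-1 * (Num.floor (u 0 i * m%:R))%:~R) =
     u 0 i * m%:R - (Num.floor (u 0 i * m%:R))%:~R :> R.
    by field; rewrite gt_eqF.
  have /andP[] := floor_itv (u 0 i * m%:R); rewrite intrD => h1 h2.
  by rewrite ler_norml; apply/andP; split; lra.
have l1C (w w' : 'rV[R]_d) : l1norm (w - w') = l1norm (w' - w) :> R.
  by apply: eq_bigr => i _; rewrite !mxE distrC.
have l1uv : l1norm (u - v) <= d%:R / m%:R.
  rewrite mulr_natl -[X in _ *+ X]card_ord -sumr_const; apply: ler_sum => i _; exact: uv.
have zs : `|zsupp c a u - zsupp c a v| <= d%:R / m%:R.
  have one w w' : zsupp c a w - zsupp c a w' <= l1norm (w - w').
    rewrite -(zsupp_vert c a w); have := zsupp_ge w' (zset_vert c a w).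
    have : `|dot (zvert c a w) (w - w')| <= 1 * l1norm (w - w').
      by apply: ler_norm_dot => i; rewrite ler_norml; exact: Pc (zset_vert c a w) i.
    rewrite mul1r dotDr dotNr => /(le_trans (ler_norm _)); lra.
  have := one u v; have := one v u; rewrite (l1C v u) => o1 o2.
  by rewrite ler_norml; apply/andP; split; lra.
have hs : `|h u - h v| <= L * (d%:R / m%:R).
  have one w w' : h w - h w' <= L * l1norm (w - w').
    rewrite lerBlDr; apply/ler_addgt0Pr => t t0; have [y Qy hy] := Q0_near w t0.
    have := Q0_le w' Qy; have : `|dot y (w - w')| <= L * l1norm (w - w').
      by apply: ler_norm_dot => i; exact: hL.
    rewrite dotDr dotNr => /(le_trans (ler_norm _)); lra.
  have := one u v; have := one v u; rewrite (l1C v u) => o1 o2.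
  have := ler_wpM2l L0 l1uv => o3.
  by rewrite ler_norml; apply/andP; split; lra.
(* The centre of symmetry: the support function splits into a linear part and the half-width. *)
pose C := c + 2^-1 *: \sum_i a i.
have zE w : zsupp c a w = dot C w + (\sum_i `|dot (a i) w|) / 2.
  rewrite /zsupp /C dotDl dotZl dot_suml -addrA; congr (_ + _).
  rewrite mulr_sumr mulr_suml -big_split/=; apply: eq_bigr => i _.
  have /orP[x0|x0] := le_total 0 (dot (a i) w); first by rewrite max_r// ger0_norm//; field.
  by rewrite max_l// ler0_norm//; field.
have Cj j : `|C 0 j| <= e.
  pose zj : 'rV[int]_d := m%:Z *: delta_mx 0 j.
  have zjE : m%:R^-1 *: toR zj = delta_mx 0 j :> 'rV[R]_d.
    by rewrite map_mxZ scalerA mulVf ?gt_eqF// scale1r map_delta_mx.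
  have zjb : zj \in box d m.
    rewrite in_box; apply/forallP => i; rewrite !mxE eqxx/=.
    by case: (_ == _); rewrite ?mulr1 ?mulr0 ?absz0 ?absz_nat.
  have := net zj zjb; rewrite /= zjE h_delta ler_norml => /andP[n1 _].
  have := Pc _ (zset_vert c a (delta_mx 0 j)) j; have := zE (delta_mx 0 j).
  have := Pc _ (zset_vert c a (- delta_mx 0 j)) j; have := zE (- delta_mx 0 j).
  rewrite -!zsupp_vert !dotNr !dot_delta.
  under eq_bigr do rewrite dotNr normrN.
  by move=> h1 /andP[? ?] h2 /andP[? ?]; rewrite ler_norml; apply/andP; split; lra.
have Cv : `|dot C v| <= e * d%:R.
  apply: le_trans (ler_norm_dot _ Cj) _; rewrite ler_pM2l//.
  rewrite -[leRHS](mulr1) mulr_natl -[X in _ *+ X]card_ord -sumr_const.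
  by apply: ler_sum => i _; exact: v1.
have nv := net z zb; rewrite /= -/v in nv.
have E1 : `|zsupp c a v - h v| <= e * (1 + d%:R).
  rewrite zE -addrA; apply: le_trans (ler_normD _ _) _; move: Cv nv; lra.
have E2 : e * (1 + d%:R) = eta / 2 by rewrite divfK// gt_eqF.
have E3 : d%:R / m%:R + L * (d%:R / m%:R) <= eta / 2 by move: hm; rewrite mulrDl mul1r mulrDl -mulrA.
have -> : zsupp c a u - h u = (zsupp c a u - zsupp c a v) + ((zsupp c a v - h v) + (h v - h u)).
  by ring.
apply: le_trans (ler_normD _ _) _.
have := ler_normD (zsupp c a v - h v) (h v - h u); rewrite (distrC (h v)).
move: zs hs E1; rewrite E2; lra.
Qed.

End net.

(** * From weights of configurations to numbers of configurations *)

Section counting_bounds.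
Context {R : realType} {d : nat}.
Hypothesis d_gt1 : (1 < d)%N.
Implicit Types (v : 'rV[R]_d) (b : R) (n M K : nat).

Lemma deviation_seq (s : seq 'rV[R]_d) (eps : R) : 0 < eps -> exists2 c : R, 0 < c &
  \forall b \near (0:R)^'+, exists M0, forall M K, (M0 <= M)%N ->
    forall v, v \in s -> tail_bound v eps c b M K.
Proof.
move=> eps0; elim: s => [|v s [c c0 ih]].
  by exists 1 => //; apply: nearW => b; exists 0%N.
have [c' c'0 hv] := deviation d_gt1 v eps0.
exists (Num.min c c'); first by rewrite lt_min c0.
near=> b; have b0 : 0 < b by near: b; exact: nbhs_right_gt.
have [M0 hM0] : exists M0, forall M K, (M0 <= M)%N -> forall v, v \in s -> tail_bound v eps c b M K.
  by near: b; exact: ih.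
have [M1 hM1] : exists M0, forall M K, (M0 <= M)%N -> tail_bound v eps c' b M K.
  by near: b; exact: hv.
exists (maxn M0 M1) => M K; rewrite geq_max => /andP[le0 le1] u; pose D := bose_cst R d / b ^+ d.+1.
have Z0 : 0 <= partition_lim (@weight R d b M).
  by rewrite ltW// partition_lim_gt0// => i; exact: weight_gt0.
have Db0 : 0 <= D * b.
  by rewrite mulr_ge0 ?(ltW b0)// divr_ge0 ?exprn_ge0 ?(ltW b0) ?(ltW (bose_cst_gt0 d_gt1)).
have weak (x : R) : Num.min c c' <= x ->
    partition_lim (@weight R d b M) * expR (- (x * (D * b))) <=
    partition_lim (@weight R d b M) * expR (- (Num.min c c' * (D * b))).
  by move=> hx; rewrite ler_wpM2l// ler_expR lerN2 ler_wpM2r.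
rewrite inE => /orP[/eqP ->|us].
  have [h1 h2] := hM1 M K le1.
  by split; [apply: le_trans h1 _|apply: le_trans h2 _]; apply: weak; rewrite ge_min lexx orbT.
have [h1 h2] := hM0 M K le0 u us.
by split; [apply: le_trans h1 _|apply: le_trans h2 _]; apply: weak; rewrite ge_min lexx.
Unshelve. all: by end_near. Qed.

Section fixed_parameters.
Variables (M K : nat) (b : R).
Local Notation config := {ffun pos_prims d M -> 'I_K.+1}.
Implicit Types k : config.

Lemma energy_slope_delta k j :
  energy (@slope R d (delta_mx 0 j) M) k = (kwidth (fun i => k i) j)%:R.
Proof.
rewrite /energy /kwidth natr_sum; apply: eq_bigr => i _.
by rewrite /slope absdot_delta natrM.
Qed.

(** The l1 norm in the Boltzmann weight is chosen for this: the energy depends on the configuration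
    through its [d] widths, the very quantities that the cube constrains. *)
Lemma energy_weight k :
  energy (@weight R d b M) k = b * \sum_j (kwidth (fun i => k i) j)%:R.
Proof.
rewrite /energy mulr_sumr; under [RHS]eq_bigr do rewrite /kwidth natr_sum mulr_sumr.
rewrite exchange_big/=; apply: eq_bigr => i _.
rewrite /weight /norm1 natr_sum !mulr_sumr; apply: eq_bigr => j _.
by rewrite natrM; ring.
Qed.

Lemma sum_gens n k v :
  \sum_i `|dot (@gens R d n M (fun i => k i) i) v| = energy (@slope R d v M) k / n%:R.
Proof.
rewrite /energy mulr_suml; apply: eq_bigr => i _.
by rewrite /gens dotZl normrM ger0_norm ?divr_ge0// mulrAC.
Qed.

Definition admissible n k := [forall j, (kwidth (fun i => k i) j <= 2 * n)%N].

Local Notation W k := (expR (- energy (@weight R d b M) k)).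
Local Notation Z := (partition_lim (@weight R d b M)).

Lemma admissible_weight n k : 0 < b -> admissible n k -> expR (- (2 * n%:R * b * d%:R)) <= W k.
Proof.
move=> b0 /forallP ok; rewrite ler_expR lerN2 energy_weight.
rewrite (_ : 2 * n%:R * b * d%:R = b * \sum_(j < d) (2 * n)%:R).
  by rewrite ler_pM2l//; apply: ler_sum => j _; rewrite ler_nat; exact: ok.
by rewrite sumr_const card_ord -mulr_natr natrM; ring.
Qed.

(** Admissible configurations have weight at least [exp (- 2nbd)], so a bound on the mass of the bad
    ones bounds their number. *)
Lemma count_bad_le n (s : seq 'rV[R]_d) (e D q : R) (B : pred config) : 0 < b ->
  (forall k, B k -> admissible n k -> has (fun v =>
     (D * (limit_h v + e) <= energy (@slope R d v M) k) ||
     (energy (@slope R d v M) k <= D * (limit_h v - e))) s) ->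
  (forall v, v \in s ->
    \sum_(k : config | D * (limit_h v + e) <= energy (@slope R d v M) k) W k <= q /\
    \sum_(k : config | energy (@slope R d v M) k <= D * (limit_h v - e)) W k <= q) ->
  #|[pred k | B k && admissible n k]|%:R * expR (- (2 * n%:R * b * d%:R)) <= (size s)%:R * (2 * q).
Proof.
move=> b0 hB hs.
apply: (@le_trans _ _ (\sum_(k : config | B k && admissible n k) W k)).
  rewrite -sum1_card natr_sum mulr_suml; apply: ler_sum => k /andP[_ ok].
  by rewrite mul1r admissible_weight.
pose T v k := (if D * (limit_h v + e) <= energy (@slope R d v M) k then W k else 0) +
  (if energy (@slope R d v M) k <= D * (limit_h v - e) then W k else 0).
have T0 v k : 0 <= T v k by rewrite /T; do 2 case: ifP => _; rewrite ?addr_ge0 ?expR_ge0.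
apply: (@le_trans _ _ (\sum_(k : config) \sum_(v <- s) T v k)).
  rewrite big_mkcond/=; apply: ler_sum => k _.
  have Ts : 0 <= \sum_(v <- s) T v k by exact: sumr_ge0.
  case: ifP => // /andP[Bk ok]; have /hasP[v vs hv] := hB k Bk ok.
  apply: (@le_trans _ _ (T v k)).
    rewrite /T; case/orP: hv => ->; first by rewrite lerDl; case: ifP => _; rewrite ?expR_ge0.
    by rewrite lerDr; case: ifP => _; rewrite ?expR_ge0.
  by rewrite (big_rem v)//= lerDl sumr_ge0.
rewrite exchange_big/= big_seq.
apply: (@le_trans _ _ (\sum_(v <- s | v \in s) 2 * q)); last first.
  by rewrite -big_seq big_const_seq count_predT iter_addr_0 -[leLHS]mulr_natl.
apply: ler_sum => v vs; have [h1 h2] := hs v vs.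
by rewrite /T big_split/= -!big_mkcond/=; lra.
Qed.

(** Avoiding the upper tails makes a configuration admissible, since [D (1 + delta) <= 2n]; avoiding
    the lower tails bounds its weight from above. The [2d] tails remove at most [Z / 4] from a mass
    of at least [Z / 2], and the rest is divided by the largest weight. *)
Lemma count_admissible_ge n (D q delta : R) : 0 < b -> 0 < delta <= 2^-1 ->
  D = 2 * n%:R * (1 - delta) -> 2 * d%:R * q <= 4^-1 ->
  (forall j,
    \sum_(k : config | D * (1 + delta) <= energy (@slope R d (delta_mx 0 j) M) k) W k <= Z * q /\
    \sum_(k : config | energy (@slope R d (delta_mx 0 j) M) k <= D * (1 - delta)) W k <= Z * q) ->
  Z / 2 <= partition_fun K (@weight R d b M) ->
  Z / 4 * expR (b * d%:R * (D * (1 - delta))) <= #|[pred k : config | admissible n k]|%:R.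
Proof.
move=> b0 /andP[dl0 dl1] DE q4 tails Z2.
have Z0 : 0 < Z by apply: partition_lim_gt0 => i; exact: weight_gt0.
have D0 : 0 <= D by rewrite DE !mulr_ge0//; lra.
pose up j k := D * (1 + delta) <= energy (@slope R d (delta_mx 0 j) M) k.
pose lo j k := energy (@slope R d (delta_mx 0 j) M) k <= D * (1 - delta).
pose mid k := [forall j, ~~ up j k && ~~ lo j k].
have midok k : mid k -> admissible n k.
  move=> /forallP mk; apply/forallP => j; have /andP[+ _] := mk j.
  rewrite /up -ltNge energy_slope_delta => lt; rewrite -(ler_nat R) ltW//.
  apply: lt_le_trans lt _; rewrite DE natrM.
  rewrite (_ : _ * (1 + delta) = 2 * n%:R * ((1 - delta) * (1 + delta))); last by rewrite mulrA.
  by apply: ler_piMr; [rewrite mulr_ge0|nra].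
have midW k : mid k -> W k <= expR (- (b * d%:R * (D * (1 - delta)))).
  move=> /forallP mk; rewrite ler_expR lerN2 energy_weight -mulrA ler_pM2l//.
  rewrite -[X in X%:R * _]card_ord mulr_natl -sumr_const; apply: ler_sum => j _.
  have /andP[_] := mk j; rewrite /lo -ltNge energy_slope_delta; exact: ltW.
have split : \sum_(k : config) W k <= \sum_(k : config | mid k) W k +
    \sum_j (\sum_(k : config | up j k) W k + \sum_(k : config | lo j k) W k).
  rewrite (bigID mid)/= lerD2l.
  pose T j k := (if up j k then W k else 0) + (if lo j k then W k else 0).
  have T0 j k : 0 <= T j k by rewrite /T; do 2 case: ifP => _; rewrite ?addr_ge0 ?expR_ge0.
  apply: (@le_trans _ _ (\sum_(k : config) \sum_j T j k)); last first.
    rewrite exchange_big/=; apply: ler_sum => j _.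
    by rewrite /T big_split/= -!big_mkcond/=.
  rewrite big_mkcond/=; apply: ler_sum => k _.
  have Ts : 0 <= \sum_j T j k by exact: sumr_ge0.
  case: ifP => // /forallPn[j]; rewrite negb_and !negbK => hj.
  apply: (@le_trans _ _ (T j k)).
    rewrite /T; case/orP: hj => ->; first by rewrite lerDl; case: ifP => _; rewrite ?expR_ge0.
    by rewrite lerDr; case: ifP => _; rewrite ?expR_ge0.
  by rewrite (bigD1 j)//= lerDl sumr_ge0.
have tail : \sum_j (\sum_(k : config | up j k) W k + \sum_(k : config | lo j k) W k) <= Z / 4.
  apply: (@le_trans _ _ (\sum_(j < d) 2 * (Z * q))).
    by apply: ler_sum => j _; have [h1 h2] := tails j; rewrite /up /lo; lra.
  rewrite sumr_const card_ord -[leLHS]mulr_natl; have := ler_wpM2l (ltW Z0) q4.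
  by rewrite (_ : Z * (2 * d%:R * q) = d%:R * (2 * (Z * q)))//; ring.
move: split; rewrite sum_expR_energy => split.
have mid4 : Z / 4 <= \sum_(k : config | mid k) W k by lra.
rewrite -ler_pdivlMr ?expR_gt0// -expRN; apply: le_trans mid4 _.
apply: (@le_trans _ _ (\sum_(k : config | admissible n k) expR (- (b * d%:R * (D * (1 - delta)))))).
  rewrite big_mkcond [leRHS]big_mkcond/=; apply: ler_sum => k _.
  case: ifP => mk; first by rewrite (midok k mk) midW.
  by case: ifP => // _; exact: expR_ge0.
by rewrite -sum1_card natr_sum mulr_suml; apply: ler_sum => k _; rewrite mul1r.
Qed.

End fixed_parameters.

Lemma expR_ge_pow (y : R) (m : nat) : 0 <= y -> (0 < m)%N -> (y / m%:R) ^+ m <= expR y.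
Proof.
move=> y0 m0; have mR : (0 : R) < m%:R by rewrite ltr0n.
have -> : expR y = expR (y / m%:R) ^+ m by rewrite -expRM_natl mulrC divfK// gt_eqF.
rewrite lerXn2r ?nnegrE ?divr_ge0 ?expR_ge0//.
by apply: le_trans (expR_ge1Dx _); rewrite lerDr.
Qed.

End counting_bounds.

(** * Elementary estimates and the limit theorem *)

Lemma exp_beats_power {R : realType} (A c eps : R) (p : nat) : 0 <= A -> 0 < c -> 0 < eps ->
  exists2 Y : R, 0 < Y & forall X, Y <= X -> A * X ^+ p * expR (- (c * X)) <= eps.
Proof.
move=> A0 c0 eps0; pose g := c / p.+1%:R.
have g0 : 0 < g by rewrite divr_gt0.
have gp0 : 0 < g ^+ p.+1 by rewrite exprn_gt0.
pose Y := A / (g ^+ p.+1 * eps) + 1.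
have Y0 : 0 < Y by rewrite ltr_wpDl// divr_ge0// mulr_ge0// ltW.
exists Y => // X YX; have X0 : 0 < X by exact: lt_le_trans YX.
have := @expR_ge_pow R (c * X) p.+1 (mulr_ge0 (ltW c0) (ltW X0)) (ltn0Sn p).
rewrite mulrAC -/g exprMn => h.
rewrite expRN ler_pdivrMr ?expR_gt0//; apply: le_trans (ler_wpM2l (ltW eps0) h).
rewrite [X ^+ p.+1]exprSr !mulrA mulrAC ler_wpM2r ?exprn_ge0 ?(ltW X0)//.
have AX : A / (g ^+ p.+1 * eps) <= X by apply: le_trans YX; rewrite lerDl.
by move: AX; rewrite ler_pdivrMr ?mulr_gt0//; rewrite [eps * _]mulrC -[_ * X]mulrC.
Qed.

Lemma root_exists {R : realType} (y : R) (p : nat) : 0 < y -> exists2 b : R, 0 < b & b ^+ p.+1 = y.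
Proof.
move=> y0; exists (y `^ (p.+1%:R^-1)); first exact: powR_gt0.
by rewrite -powR_mulrn ?powR_ge0// -powRrM mulVf ?pnatr_eq0// powRr1// ltW.
Qed.

(** Passing from the scale [2n] to [2n(1 - delta)] lowers [h] by [delta * h <= e / 2], which is why
    half of [e] is given up. *)
Lemma relative_deviation {R : realType} (E n h e delta : R) : 0 < n ->
  0 < delta <= 2^-1 -> 0 <= h -> 0 < e -> delta * h <= e / 2 -> e < `|E / n / 2 - h| ->
  (2 * n * (1 - delta) * (h + e / 2) <= E) || (E <= 2 * n * (1 - delta) * (h - e / 2)).
Proof.
move=> n0 /andP[dl0 dl1] h0 e0 dh; rewrite lter_normr => /orP[lt|lt]; apply/orP.
  left; have : h + e < E / n / 2 by lra.
  rewrite !ltr_pdivlMr// => h'; apply: le_trans (ltW h').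
  rewrite (_ : (h + e) * 2 * n = 2 * n * (h + e)); last by ring.
  by rewrite -mulrA ler_pM2l ?mulr_gt0//; nra.
right; have : E / n / 2 < h - e by lra.
rewrite !ltr_pdivrMr// => h'; apply: le_trans (ltW h') _.
rewrite (_ : (h - e) * 2 * n = 2 * n * (h - e)); last by ring.
by rewrite -[leRHS]mulrA ler_pM2l ?mulr_gt0//; nra.
Qed.

Theorem theorem6p2 (R : realType) (d : nat) (hd : (2 <= d)%N)
    (Q0 : set 'rV[R]_d) (compact_Q0 : compact Q0)
    (convex_Q0 : @convex_set R 'rV[R]_d Q0)
    (support_Q0 : forall v, support_fun Q0 v = limit_support v)
    (eta : R) (eta_gt0 : 0 < eta) :
  (fun n : nat =>
     (set_card [set P | lattice_zonotopes (@cube R d) n P /\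
                    (eta%:E < hausdorff_dist P Q0)%E])%:R /
     (set_card (lattice_zonotopes (@cube R d) n))%:R : R) @ \oo --> (0 : R).
Proof.
have d0 : (0 < d)%N by exact: ltnW.
have dR : (0 : R) < d%:R by rewrite ltr0n.
have hE v : support_fun Q0 v = (limit_h v)%:E by rewrite support_Q0 limit_supportE.
have [e [m [e0 m0 net]]] := hausdorff_net convex_Q0 hE (limit_h_delta d0) eta_gt0.
pose vz z : 'rV[R]_d := m%:R^-1 *: map_mx intr z.
pose s := [seq vz z | z <- box d m].
have [c c0 dev1] := deviation_seq hd s (divr_gt0 e0 (ltr0n R 2)).
pose H : R := \sum_(v <- s) limit_h v.
have H0 : 0 <= H by apply: sumr_ge0 => v _; exact: limit_h_ge0.
have Hv v : v \in s -> limit_h v <= H.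
  by move=> vs; rewrite /H (big_rem v)//= lerDl sumr_ge0// => u _; exact: limit_h_ge0.
(* [c / (8d)] keeps the loss from the mismatch of [D] and [2n] below half the gain [c X];
   [e / (2 (1 + H))] serves [relative_deviation] for all net directions; [1/2] ensures [n <= D]. *)
pose delta := Num.min 2^-1 (Num.min (c / (8 * d%:R)) (e / (2 * (1 + H)))).
have delta0 : 0 < delta by rewrite !lt_min invr_gt0 ltr0n/= !divr_gt0 ?mulr_gt0//; lra.
have delta1 : delta <= 2^-1 by rewrite ge_min lexx.
have delta2 : 8 * d%:R * delta <= c.
  have : delta <= c / (8 * d%:R) by rewrite !ge_min lexx orbT.
  by rewrite ler_pdivlMr ?mulr_gt0// mulrC.
have delta3 : delta * (1 + H) <= e / 2.
  have : delta <= e / (2 * (1 + H)) by rewrite !ge_min lexx !orbT.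
  by rewrite ler_pdivlMr; lra.
pose s' : seq 'rV[R]_d := [seq delta_mx 0 j | j <- enum 'I_d].
have [c' c'0 dev2] := deviation_seq hd s' delta0.
have C0 : 0 < bose_cst R d := bose_cst_gt0 hd.
have [r /= r0 hr] := filterI dev1 dev2.
apply/cvgrPdist_le => eps eps0.
(* Constants of the final quotient: 2 tails per net direction, 4 from the count of admissible
   configurations, [(2n+1)^d <= (3D)^d], and [D^d = X^(d+1) / bose_cst]. *)
pose A : R := 8 * (size s)%:R * 3 ^+ d / bose_cst R d.
have A0 : 0 <= A by rewrite divr_ge0 ?(ltW C0)// !mulr_ge0 ?exprn_ge0.
have [Y Y0 hY] := exp_beats_power d.+1 A0 (divr_gt0 c0 (ltr0n R 2)) eps0.
have q40 : (0 : R) < 4^-1 by rewrite invr_gt0.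
have [Y' Y'0 hY'] := @exp_beats_power R (2 * d%:R) c' 4^-1 0 (mulr_ge0 (ler0n _ 2) (ltW dR)) c'0 q40.
near=> n.
have n1 : (1 : R) <= n%:R by near: n; exact: nbhs_infty_ger.
have nr : bose_cst R d / r ^+ d.+1 + 1 <= n%:R by near: n; exact: nbhs_infty_ger.
have nY : (Y + Y') ^+ d.+1 / bose_cst R d <= n%:R by near: n; exact: nbhs_infty_ger.
have n0 : (0 < n)%N by rewrite -(ltr0n R); lra.
pose D : R := 2 * n%:R * (1 - delta).
have nD : n%:R <= D by rewrite /D; nra.
have D0 : 0 < D by lra.
(* This [b] makes the asymptotic mean of each coordinate width equal to [D]. *)
have [b b0 bE] := root_exists d (divr_gt0 C0 D0).
have DE : bose_cst R d / b ^+ d.+1 = D by rewrite bE invf_div mulrC divfK// gt_eqF.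
have br : b < r.
  rewrite -(ltr_pXn2r (ltn0Sn d)) ?nnegrE ?(ltW b0) ?(ltW r0)// bE ltr_pdivrMr//.
  have rd0 : 0 < r ^+ d.+1 by rewrite exprn_gt0.
  rewrite mulrC -ltr_pdivrMr//; lra.
pose X := D * b.
have X0 : 0 < X by rewrite mulr_gt0.
have XE : X ^+ d.+1 = bose_cst R d * D ^+ d.
  by rewrite exprMn bE exprSr -mulrA [D * _]mulrC divfK ?gt_eqF// mulrC.
have XY : Y + Y' <= X.
  have YY0 : 0 <= Y + Y' by lra.
  rewrite -(ler_pXn2r (ltn0Sn d)) ?nnegrE ?(ltW X0)// XE -ler_pdivrMl// mulrC.
  apply: (le_trans nY); apply: (le_trans nD).
  by rewrite -[leLHS]expr1 ler_weXn2l//; lra.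
have [|[M0 h0] [M1 h1]] := hr b _ b0; first by rewrite /= sub0r normrN gtr0_norm.
(* [M] covers all directions occurring in the cube and both concentration thresholds; [K] below
   covers all multiplicities and makes [partition_fun] at least half its limit. *)
pose M := maxn (2 * n * d) (maxn M0 M1).
have nM : (2 * n * d <= M)%N by rewrite leq_maxl.
have M0M : (M0 <= M)%N by rewrite /M !leq_max leqnn orbT.
have M1M : (M1 <= M)%N by rewrite /M !leq_max leqnn !orbT.
have w0 (i : pos_prims d M) : 0 < weight b i by exact: weight_gt0.
set Z := partition_lim (@weight R d b M).
have Z0 : 0 < Z by exact: partition_lim_gt0.
have [K0 _ hK0] : \forall K \near \oo, `|Z - partition_fun K (@weight R d b M)| <= Z / 2.
  by have /cvgrPdist_le := cvg_partition_fun w0; apply; rewrite divr_gt0.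
pose K := maxn (2 * n) K0.
have nK : (2 * n <= K)%N by rewrite leq_maxl.
have Z2 : Z / 2 <= partition_fun K (@weight R d b M).
  by have := hK0 K (leq_maxr _ _); rewrite /= ler_norml => /andP[_]; lra.
pose N := #|[pred k : {ffun pos_prims d M -> 'I_K.+1} | admissible n k]|.
have hN : Z / 4 * expR (b * d%:R * (D * (1 - delta))) <= N%:R.
  apply: (@count_admissible_ge R d M K b n D (expR (- (c' * X)))) => //.
  - by rewrite delta0.
  - by have := hY' X; rewrite expr0 mulr1; apply; lra.
  move=> j; have := h1 M K M1M (delta_mx 0 j); rewrite /tail_bound DE limit_h_delta// -/X; apply.
  by apply/mapP; exists j; rewrite ?mem_enum.
pose B (k : {ffun pos_prims d M -> 'I_K.+1}) :=
  has (fun v => e < `|energy (@slope R d v M) k / n%:R / 2 - limit_h v|) s.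
have hB : #|[pred k | B k && admissible n k]|%:R * expR (- (2 * n%:R * b * d%:R)) <=
    (size s)%:R * (2 * (Z * expR (- (c * X)))).
  apply: (@count_bad_le R d M K b n s (e / 2) D) => //; last first.
    by move=> v vs; have := h0 M K M0M v vs; rewrite /tail_bound DE -/X.
  move=> k /hasP[v vs ev] _; apply/hasP; exists v => //.
  have hv0 : 0 <= limit_h v := limit_h_ge0 d0 v.
  have dh : delta * limit_h v <= e / 2.
    by apply: le_trans delta3; rewrite ler_pM2l//; have := Hv v vs; lra.
  by apply: (relative_deviation (lt_le_trans ltr01 n1)) dh ev => //; rewrite delta0.
set L := lattice_zonotopes (@cube R d) n.
pose Bad := [set P | L P /\ (eta%:E < hausdorff_dist P Q0)%E].
have [finL _] := @lattice_zonotopes_card_le R d n M K L xpredT d0 n0 nM nK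
  (fun P LP => LP) (fun _ _ _ _ => isT).
have [_ cBad] : finite_set Bad /\ (set_card Bad <= n.*2.+1 ^ d * #|[pred k | B k && admissible n k]|)%N.
  apply: lattice_zonotopes_card_le => // [P []//|z k [[_ Pc _] far] ok].
  apply: contraTT far => nB; rewrite -leNgt; apply: net => // y yb /=.
  rewrite sum_gens leNgt; apply: contraNN nB => lt; apply/hasP; exists (vz y) => //.
  by apply/mapP; exists y.
have cL : (N <= set_card L)%N by exact: lattice_zonotopes_card_ge.
have E0 := expR_gt0 (b * d%:R * (D * (1 - delta))).
have N0 : (0 : R) < N%:R by apply: lt_le_trans hN; rewrite mulr_gt0// divr_gt0.
have L0 : (0 : R) < (set_card L)%:R by apply: lt_le_trans N0 _; rewrite ler_nat.
rewrite sub0r normrN ger0_norm ?divr_ge0// ler_pdivrMr//.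
apply: (@le_trans _ _ (eps * N%:R)); last by rewrite ler_pM2l// ler_nat.
apply: (@le_trans _ _ ((n.*2.+1 ^ d)%:R * #|[pred k | B k && admissible n k]|%:R)).
  by rewrite -natrM ler_nat.
rewrite -ler_pdivlMr ?expR_gt0// -expRN opprK in hB.
apply: (@le_trans _ _ ((3 * D) ^+ d *
  ((size s)%:R * (2 * (Z * expR (- (c * X)))) * expR (2 * n%:R * b * d%:R)))).
  have n3 : n.*2.+1%:R <= 3 * D by rewrite -natr1 -mul2n natrM; lra.
  apply: ler_pM => //; rewrite natrX; apply: lerXn2r; rewrite ?nnegrE//.
  exact: le_trans n3.
apply: (@le_trans _ _ (eps * (Z / 4 * expR (b * d%:R * (D * (1 - delta)))))); last by rewrite ler_pM2l.
(* As [2n - D (1 - delta) = 2n (2 delta - delta^2)], the loss in the exponent is at most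
   [4 d delta n b <= c X / 2]. *)
have ex : expR (- (c * X)) * expR (2 * n%:R * b * d%:R) <=
    expR (- (c / 2 * X)) * expR (b * d%:R * (D * (1 - delta))).
  rewrite -!expRD ler_expR.
  have : 2 * n%:R * b * d%:R - b * d%:R * (D * (1 - delta)) <= c / 2 * X; last by lra.
  have -> : 2 * n%:R * b * d%:R - b * d%:R * (D * (1 - delta)) =
      n%:R * b * (2 * d%:R * (2 * delta - delta ^+ 2)) by rewrite /D; ring.
  apply: (@le_trans _ _ (n%:R * b * (c / 2))).
    rewrite ler_wpM2l ?mulr_ge0 ?(ltW b0)//.
    have : 0 <= d%:R * delta ^+ 2 by rewrite mulr_ge0 ?sqr_ge0.
    by move: delta2; lra.
  by rewrite mulrC ler_pM2l ?divr_gt0// /X ler_pM2r.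
have YX : Y <= X by lra.
have := hY X YX; rewrite /A XE => h.
have h2 : 8 * (size s)%:R * (3 * D) ^+ d * expR (- (c / 2 * X)) <= eps.
  apply: le_trans h; rewrite exprMn le_eqVlt; apply/orP; left; apply/eqP.
  by move: (expR _) (3 ^+ d) (D ^+ d) => x y w; field; rewrite gt_eqF.
have sD0 : 0 <= 8 * (size s)%:R * (3 * D) ^+ d by rewrite !mulr_ge0// exprn_ge0// mulr_ge0// ltW.
have := ler_wpM2l sD0 ex; have := ler_wpM2r (ltW E0) h2 => h3 h4.
have h5 : 8 * (size s)%:R * (3 * D) ^+ d * (expR (- (c * X)) * expR (2 * n%:R * b * d%:R)) <=
   eps * expR (b * d%:R * (D * (1 - delta))).
  by apply: le_trans h4 _; rewrite [leLHS]mulrA; exact: h3.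
have := ler_wpM2l (ltW (divr_gt0 Z0 (ltr0n R 4))) h5.
move: (expR (- (c * X))) (expR (2 * n%:R * b * d%:R)) (expR (b * d%:R * _)) ((3 * D) ^+ d) => x1 x2 x3 x4 h6.
rewrite (_ : eps * (Z / 4 * x3) = Z / 4 * (eps * x3)); last by ring.
by apply: le_trans h6; rewrite le_eqVlt; apply/orP; left; apply/eqP; field.
Unshelve. all: by end_near. Qed.
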